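(* Let $J\in C^2(\mathbb R)$ satisfy $J''<0$ and $J(0)=J(1)=0$, and let $m\in(0,1)$ be the unique maximum point of $J$. Let $\rho_-,\rho_+\in C^1(\mathbb R_+)$ take values in $[0,1]$ and let $u_0\in L^\infty([0,1])$ take values in $[0,1]$ almost everywhere. Suppose that $(\rho_-(t),\rho_+(t))\notin\Theta$ for almost all $t\ge 0$, where $\Theta=\{(z,z^* )\in[0,1]^2:\ z<m\}$ is the critical segment. For $\varepsilon>0$ let $u^\varepsilon\in L^\infty(\mathbb R_+\times[0,1])$ be the entropy solution of $$\varepsilon\partial_t u^\varepsilon+\partial_x J(u^\varepsilon)=0,\qquad u^\varepsilon(t,0)=\rho_-(t),\quad u^\varepsilon(t,1)=\rho_+(t),\quad u^\varepsilon(0,x)=u_0(x).$$ Then, as $\varepsilon\to0$, for every $T>0$, $u^\varepsilon$ converges in the weak-$\star$ topology of $L^\infty([0,T]\times[0,1])$ to the function $u$ given by $$u(t,x)=\begin{cases}\rho_-(t),&\text{if }\rho_-(t)<m,\ \rho_+(t)<\rho_-^*(t),\\ \rho_+(t),&\text{if }\rho_+(t)>m,\ \rho_-(t)>\rho_+^*(t),\\ m,&\text{if }\rho_-(t)\ge m,\ \rho_+(t)\le m.\end{cases}$$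
   Context: Notation: $\mathbb R_+=[0,\infty)$; $C_0$ and $C_0^\infty$ denote continuous, respectively smooth, compactly supported functions. For $u\in[0,1]\setminus\{m\}$, $u^*$ is the unique element of $[0,1]\setminus\{m\}$ with $u^*\ne u$ and $J(u^* )=J(u)$; $m^*=m$. Write $\rho_\pm^*(t)=(\rho_\pm(t))^*$. A Lax entropy--entropy flux pair is a pair $(S,Q)$ with $S,Q\in C^2(\mathbb R)$, $S''\ge0$, $Q'=J'S'$. A boundary entropy--entropy flux pair is a pair $S,Q\in C^2(\mathbb R^2)$ such that for each $w\in\mathbb R$, $(S(\cdot,w),Q(\cdot,w))$ is a Lax entropy--entropy flux pair, and $S(w,w)=Q(w,w)=\partial_vS(v,w)|_{v=w}=0$; then $Q$ is called a boundary entropy flux. Entropy solution: $u^\varepsilon\in L^\infty(\mathbb R_+\times[0,1])$ is the entropy solution of the initial--boundary value problem (in the sense of Otto) if: (i) for all $\phi\in C_0^\infty(\mathbb R\times(0,1))$, $\int_0^\infty\int_0^1[\varepsilon u^\varepsilon\partial_t\phi+J(u^\varepsilon)\partial_x\phi]\,dx\,dt+\varepsilon\int_0^1u_0(x)\phi(0,x)\,dx=0$; (ii) for all Lax pairs $(S,Q)$ and all $\varphi\in C_0^\infty(\mathbb R\times(0,1))$ with $\varphi\ge0$, $\int_0^\infty\int_0^1[\varepsilon S(u^\varepsilon)\partial_t\varphi+Q(u^\varepsilon)\partial_x\varphi]\,dx\,dt+\varepsilon\int_0^1S(u_0(x))\varphi(0,x)\,dx\ge0$; (iii) for every boundary entropy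 flux $Q$ and every $\beta\in C_0(\mathbb R)$ with $\beta\ge0$, $\operatorname{ess\,lim}_{r\to0+}\int_0^\infty Q(u^\varepsilon(t,r),\rho_-(t))\beta(t)\,dt\le0$ and $\operatorname{ess\,lim}_{r\to0+}\int_0^\infty Q(u^\varepsilon(t,1-r),\rho_+(t))\beta(t)\,dt\ge0$. *)

(* Defs.v *)
From HB Require Import structures.
From mathcomp Require Import all_boot all_order all_algebra.
From mathcomp Require Import all_classical all_reals all_analysis.

Set Implicit Arguments.
Unset Strict Implicit.
Unset Printing Implicit Defensive.

Import Order.TTheory GRing.Theory Num.Theory.
Import numFieldNormedType.Exports.

Local Open Scope classical_set_scope.
Local Open Scope ring_scope.

Section Regularity.
Variable R : realType.

Fixpoint Ck (k : nat) (f : R -> R) : Prop :=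
  match k with
  | 0 => continuous f
  | k'.+1 => (forall x, derivable f x 1) /\ Ck k' (derive1 f)
  end.

(* Points of R * R are (t, x), resp. (v, w). *)
Definition partial1 (f : R * R -> R) : R * R -> R := fun z => 'D_(1, 0) f z.
Definition partial2 (f : R * R -> R) : R * R -> R := fun z => 'D_(0, 1) f z.

(* Continuity of f is required explicitly, as the existence of partial
   derivatives alone does not imply it. *)
Fixpoint Ck2 (k : nat) (f : R * R -> R) : Prop :=
  match k with
  | 0 => continuous f
  | k'.+1 =>
      [/\ continuous f,
          (forall z, derivable f z (1, 0)) /\ Ck2 k' (partial1 f)
        & (forall z, derivable f z (0, 1)) /\ Ck2 k' (partial2 f)]
  end.

(* C^1 on [0, +oo[, with a one-sided derivative at 0; the values of rho on
   the negative half-line are irrelevant. *)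
Definition C1_Rplus (rho : R -> R) : Prop :=
  exists2 drho : R -> R, {within `[0, +oo[, continuous drho} &
    forall t, 0 <= t ->
      h^-1 * (rho (t + h) - rho t) @[h --> within [set h | 0 <= t + h] 0^']
        --> drho t.

Definition supp (T : topologicalType) (f : T -> R) : set T :=
  closure [set x | f x != 0].

Definition C0_test (beta : R -> R) : Prop :=
  continuous beta /\ compact (supp beta).

(* Elements of C_0^oo(R x (0,1)), extended by zero to R x R. *)
Definition smooth_test (phi : R * R -> R) : Prop :=
  [/\ forall k, Ck2 k phi, compact (supp phi) &
      supp phi `<=` setT `*` `]0, 1[].

End Regularity.

Section Lebesgue.
Variable R : realType.

Definition leb : {measure set (measurableTypeR R) -> \bar R} :=
  lebesgue_measure.

Definition leb2 : {measure set (measurableTypeR R * measurableTypeR R) -> \bar R} :=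
  (@lebesgue_measure R \x @lebesgue_measure R)%E.

(* L^p(D), through extension by zero outside D. *)
Definition Lp_on d (T : measurableType d) (mu : {measure set T -> \bar R})
    (p : \bar R) (D : set T) (f : T -> R) : Prop :=
  f \_ D \in Lfun mu p.

(* Convergence along the filter F in the weak-star topology of
   L^oo(D), seen as the dual of L^1(D). *)
Definition weak_star_cvg d (T : measurableType d)
    (mu : {measure set T -> \bar R}) (D : set T)
    (F : set_system R) (f : R -> T -> R) (l : T -> R) : Prop :=
  [/\ \forall e \near F, Lp_on mu +oo%E D (f e),
      Lp_on mu +oo%E D l &
      forall g, Lp_on mu 1%E D g ->
        \int[mu]_(z in D) (f e z * g z) @[e --> F]
          --> \int[mu]_(z in D) (l z * g z)].

Definition ess_lim_0plus (F : R -> R) (l : R) : Prop :=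
  forall e, 0 < e -> exists2 d, 0 < d &
    {ae leb, forall r, 0 < r < d -> `|F r - l| < e}.

Definition strip : set (R * R) := `[0, +oo[ `*` `[0, 1].

End Lebesgue.

Section EntropySolution.
Variables (R : realType) (J : R -> R).

Definition lax_pair (S Q : R -> R) : Prop :=
  [/\ Ck 2 S, Ck 2 Q, forall v, 0 <= derive1n 2 S v &
      forall v, derive1 Q v = derive1 J v * derive1 S v].

Definition boundary_pair (S Q : R * R -> R) : Prop :=
  [/\ Ck2 2 S, Ck2 2 Q,
      forall w, lax_pair (fun v => S (v, w)) (fun v => Q (v, w)) &
      forall w, [/\ S (w, w) = 0, Q (w, w) = 0 & partial1 S (w, w) = 0]].

Definition boundary_flux (Q : R * R -> R) : Prop :=
  exists S, boundary_pair S Q.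

Definition weak_formulation (eps : R) (u0 : R -> R) (u : R * R -> R) : Prop :=
  forall phi, smooth_test phi ->
    \int[@leb2 R]_(z in @strip R)
        (eps * u z * partial1 phi z + J (u z) * partial2 phi z)
      + eps * \int[@leb R]_(x in `[0, 1]) (u0 x * phi (0, x)) = 0.

Definition entropy_inequality (eps : R) (u0 : R -> R) (u : R * R -> R) : Prop :=
  forall S Q, lax_pair S Q ->
  forall phi, smooth_test phi -> (forall z, 0 <= phi z) ->
    0 <= \int[@leb2 R]_(z in @strip R)
           (eps * S (u z) * partial1 phi z + Q (u z) * partial2 phi z)
         + eps * \int[@leb R]_(x in `[0, 1]) (S (u0 x) * phi (0, x)).

(* As usual, an inequality on an essential limit includes its existence. *)
Definition boundary_conditions (rhom rhop : R -> R) (u : R * R -> R) : Prop :=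
  forall Q, boundary_flux Q ->
  forall beta, C0_test beta -> (forall t, 0 <= beta t) ->
    (exists2 l, ess_lim_0plus
       (fun r => \int[@leb R]_(t in `[0, +oo[) (Q (u (t, r), rhom t) * beta t)) l
       & l <= 0)
    /\
    (exists2 l, ess_lim_0plus
       (fun r => \int[@leb R]_(t in `[0, +oo[)
                   (Q (u (t, 1 - r), rhop t) * beta t)) l
       & 0 <= l).

Definition entropy_solution (eps : R) (rhom rhop u0 : R -> R)
    (u : R * R -> R) : Prop :=
  [/\ Lp_on (@leb2 R) +oo%E (@strip R) u,
      weak_formulation eps u0 u,
      entropy_inequality eps u0 u &
      boundary_conditions rhom rhop u].

End EntropySolution.

Section QuasiStatic.
Variables (R : realType) (J : R -> R) (m : R).

Definition star (u : R) : R :=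
  if u == m then m
  else xget m [set v | [/\ 0 <= v <= 1, v != m, v != u & J v = J u]].

Definition critical_segment : set (R * R) :=
  [set z | [/\ 0 <= z.1 <= 1, 0 <= z.2 <= 1, z.1 < m & z.2 = star z.1]].

(* When (rhom t, rhop t) is off the critical segment exactly one of the first
   three branches applies; the final value 0 is a dummy. *)
Definition quasi_static_profile (rhom rhop : R -> R) (z : R * R) : R :=
  let t := z.1 in
  if (rhom t < m) && (rhop t < star (rhom t)) then rhom t
  else if (m < rhop t) && (star (rhop t) < rhom t) then rhop t
  else if (m <= rhom t) && (rhop t <= m) then m
  else 0.

End QuasiStatic.

(* Main.v *)
Require Import Defs.
From HB Require Import structures.
From mathcomp Require Import all_boot all_order all_algebra.
From mathcomp Require Import all_classical all_reals all_analysis.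
From mathcomp Require Import measurable_realfun ess_sup_inf.
From mathcomp Require Import ring lra.

Import Order.TTheory GRing.Theory Num.Theory.
Import numFieldNormedType.Exports.

Local Open Scope classical_set_scope.
Local Open Scope ring_scope.

(* As eps -> 0 the equation forces, at almost every time, a stationary state:
   for a Lax pair (S, Q) the mean q(x) of Q(u(t,x)) over a short time window is
   nonincreasing in x up to O(eps), while boundary entropy fluxes have q(0+) <= 0
   on the left and q(1-) >= 0 on the right. Hence the mean of Q over the strip
   is at most O(eps) for left fluxes and at least -O(eps) for right fluxes.

   Take Bregman entropies S(v,w) = P(v) - P(w) - P'(w)(v-w), where P' is a
   smooth step from al to be. Their flux Q(.,w) does not depend on w as long as
   w <= al, or as long as w >= be, so that boundary data varying in a short time
   window do no harm. Off the critical segment, a suitable combination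
   H = sum of left fluxes - sum of right fluxes is nonnegative on [0,1] and
   vanishes only near the value c predicted by the profile; since the mean of H
   is O(eps), u concentrates near c. A countable cover of the good times then
   gives convergence in measure, and the maximum principle, proved with the same
   entropies, gives weak-star convergence. *)

(** * Smooth calculus and the smooth step *)

(** No estimate on the variation of u that is uniform in eps is at hand, and boundary values enter
    only through essential limits of time integrals. All information therefore comes from
    inequalities between averaged fluxes. The space test functions rise in a thin layer [r, 2r] next
    to an end and fall along a ramp spread over the whole of [y, 1 - y], or the reverse: one
    inequality then links a boundary condition to a strip average with positive weight. The
    thickness r may depend on eps; the constant in O(eps) does not.

    The critical segment matters for the following reason. If the left datum a < m prevails, the
    left flux that penalises v > a grows up to m and then falls with J; it is sure to be positive
    only until J has fallen back to about J a. From there on a right flux must take over, and it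
    vanishes up to max(b, m). The two ranges overlap when J a < J(max b m), and strictness leaves
    room for data moving by d. A large multiple of the second flux then absorbs the negative values
    of the first. *)

Section SmoothCalculus.
Context {R : realType}.
Implicit Types (f g : R -> R) (k : nat).

Lemma is_derive_derive1 f (df : R -> R) :
  (forall x, is_derive x (1 : R) f (df x)) ->
  (forall x, derivable f x (1 : R)) /\ derive1 f = df.
Proof.
move=> h; split=> [x|]; first exact: (@ex_derive _ _ _ _ _ _ _ (h x)).
by apply/funext => x; rewrite derive1E (@derive_val _ _ _ _ _ _ _ (h x)).
Qed.

Lemma CkSP k f (df : R -> R) :
  (forall x, is_derive x (1 : R) f (df x)) -> Ck k df -> Ck k.+1 f.
Proof. by move=> /is_derive_derive1[h1 h2] /= h3; rewrite h2. Qed.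

Lemma CkS_is_derive k f : Ck k.+1 f -> forall x, is_derive x (1 : R) f (derive1 f x).
Proof. by move=> [h _] x; rewrite derive1E; exact: derivableP. Qed.

Lemma Ck_continuous k f : Ck k f -> continuous f.
Proof.
case: k => [//|k] [h _] x.
exact/differentiable_continuous/derivable1_diffP.
Qed.

Lemma CkW k f : Ck k.+1 f -> Ck k f.
Proof.
elim: k f => [f|k IH f [h1 h2]]; first by move/Ck_continuous.
by split=> //; exact: IH.
Qed.

Lemma Ck_cst k (c : R) : Ck k (cst c).
Proof.
elim: k c => [c|k IH c]; first exact: cst_continuous.
exact: (CkSP _ _ _ (fun x => is_derive_cst c x 1) (IH 0)).
Qed.

Lemma Ck_id k : Ck k (@id R).
Proof.
case: k => [|k]; first by move=> x; exact: cvg_id.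
exact: (CkSP _ _ _ (fun x => is_derive_id x 1) (Ck_cst k 1)).
Qed.

Lemma CkD k f g : Ck k f -> Ck k g -> Ck k (fun x => f x + g x).
Proof.
elim: k f g => [f g cf cg x|k IH f g cf cg]; first exact: cvgD (cf x) (cg x).
apply: (@CkSP _ _ (fun x => derive1 f x + derive1 g x)).
  by move=> x; have := CkS_is_derive _ _ cf x; have := CkS_is_derive _ _ cg x;
    move=> *; exact: is_deriveD.
have [_ dcf] := cf; have [_ dcg] := cg; exact: IH.
Qed.

Lemma CkM k f g : Ck k f -> Ck k g -> Ck k (fun x => f x * g x).
Proof.
elim: k f g => [f g cf cg x|k IH f g cf cg]; first exact: cvgM (cf x) (cg x).
apply: (@CkSP _ _ (fun x => f x * derive1 g x + g x * derive1 f x)).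
  by move=> x; have := CkS_is_derive _ _ cf x; have := CkS_is_derive _ _ cg x;
    move=> *; exact: is_deriveM.
have [_ dcf] := cf; have [_ dcg] := cg.
by apply: CkD; apply: IH => //; exact: CkW.
Qed.

Lemma CkN k f : Ck k f -> Ck k (fun x => - f x).
Proof.
move=> cf; have := CkM _ _ _ (Ck_cst k (-1)) cf.
by under eq_fun do rewrite mulN1r.
Qed.

Lemma CkV k f : (forall x, f x != 0) -> Ck k f -> Ck k (fun x => (f x)^-1).
Proof.
move=> f0; elim: k => [cf x|k IH cf]; first exact: cvgV (f0 x) (cf x).
apply: (@CkSP _ _ (fun x => - (f x)^-1 * (f x)^-1 * derive1 f x)).
  move=> x; have dfx := CkS_is_derive _ _ cf x.
  apply: (is_derive_eq (is_deriveV (f0 x) dfx)).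
  by rewrite /GRing.scale /= -exprVn expr2 !mulNr.
have cV : Ck k (fun x => (f x)^-1) by apply: IH; exact: CkW.
by apply: CkM; [apply: CkM => //; exact: CkN|case: cf].
Qed.

Lemma Ck_comp k f g : Ck k f -> Ck k g -> Ck k (fun x => f (g x)).
Proof.
elim: k f g => [f g cf cg x|k IH f g cf cg].
  by apply: (@continuous_comp _ _ _ g f); [exact: cg|exact: cf].
apply: (@CkSP _ _ (fun x => derive1 f (g x) * derive1 g x)).
  move=> x; have dg := CkS_is_derive _ _ cg x.
  have df := CkS_is_derive _ _ cf (g x).
  exact: is_derive1_comp.
have [_ dcf] := cf; have [_ dcg] := cg.
by apply: CkM => //; apply: IH => //; exact: CkW.
Qed.

End SmoothCalculus.

Section SmoothStep.
Context {R : realType}.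
Implicit Types (x : R) (n : nat).

(* The derivatives of exp(-1/x) on x > 0 are combinations of these. *)
Definition flat n x : R := if 0 < x then x ^- n * expR (- x^-1) else 0.

Lemma flat_ge0 n x : 0 <= flat n x.
Proof.
rewrite /flat; case: ifP => // x0.
by rewrite mulr_ge0 ?expR_ge0// invr_ge0 exprn_ge0// ltW.
Qed.

Lemma flat_gt0 n x : 0 < x -> 0 < flat n x.
Proof. by move=> x0; rewrite /flat x0 mulr_gt0 ?expR_gt0// invr_gt0 exprn_gt0. Qed.

Lemma flat_le0 n x : x <= 0 -> flat n x = 0.
Proof. by move=> x0; rewrite /flat ltNge x0. Qed.

(** The exponential series gives expR (1/x) >= (1/x)^(n+2) / (n+2)!. Two powers of x are kept
    because the difference quotient at 0 consumes one and the other must still tend to 0. *)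
Lemma flat_le_sqr n x : flat n x <= (n.+2`!)%:R * x ^+ 2.
Proof.
have [x0|x0] := ltP 0 x; last by rewrite flat_le0// mulr_ge0// sqr_ge0.
have h : 0 < (n.+2)`!%:R * x ^+ 2 :> R by rewrite mulr_gt0 ?exprn_gt0// ltr0n fact_gt0.
have := @expR_ge1Dxn R x^-1 n.+1; rewrite invr_ge0 ltW// => /(_ erefl) hx.
rewrite /flat x0 expRN -invfM -[leRHS]invrK lef_pV2 ?posrE ?invr_gt0//; last first.
  by rewrite mulr_gt0 ?exprn_gt0 ?expR_gt0.
apply: (@le_trans _ _ (x ^+ n * (x^-1 ^+ n.+2 / n.+2`!%:R))).
  have -> : x ^+ n * (x^-1 ^+ n.+2 / n.+2`!%:R) = x^-1 ^+ 2 / n.+2`!%:R.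
    by rewrite mulrA -[in x^-1 ^+ _]addn2 exprD mulrA -exprMn divff ?gt_eqF// expr1n mul1r.
  by rewrite invfM exprVn mulrC.
by rewrite ler_pM2l ?exprn_gt0//; apply: le_trans hx; rewrite lerDr.
Qed.

(** Differentiation stays inside the span of the family [flat], so smoothness of every order follows
    by induction, without formulas for higher derivatives. *)
Lemma is_derive_flat n x :
  is_derive x (1 : R) (flat n) (flat n.+2 x - n%:R * flat n.+1 x).
Proof.
have [x0|x0|x0] := ltgtP x 0.
- rewrite !flat_le0 ?(ltW x0)// mulr0 subr0.
  apply: (@near_eq_is_derive _ _ _ (cst 0)).
  near=> y; rewrite flat_le0//; apply: ltW; near: y.
  exact: lt_nbhsl.
- have d1 : is_derive x (1 : R) (fun y : R => y^-1) (- x ^- 2).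
    have := is_deriveV (lt0r_neq0 x0) (is_derive_id x (1 : R)).
    by rewrite /GRing.scale /= mulr1.
  have d2 := is_deriveX n d1.
  have d3 : is_derive x (1 : R) (fun y : R => expR (- y^-1)) (expR (- x^-1) * - - x ^- 2).
    exact: (@is_derive1_comp _ expR (fun y : R => - y^-1)).
  have d4 := is_deriveM d2 d3.
  apply: (is_derive_eq (near_eq_is_derive _ d4)).
    near=> y; rewrite /flat ifT; last by near: y; exact: lt_nbhsr.
    by rewrite fctE exprfctE/= exprVn.
  rewrite exprfctE /flat x0 /GRing.scale /= opprK -!exprVn.
  case: n {d2 d4} => [|n]; first by rewrite !mulr0n !mul0r mulr0 addr0 subr0 !expr0 mul1r mulrC.
  by rewrite /= !exprS; ring.
- rewrite x0 !flat_le0// mulr0 subr0.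
  (* The slope function at 0 is bounded by (n+2)! |y|, and the convention 0 / 0 = 0 gives it the
     right value at 0; Caratheodory's criterion then yields derivative 0. *)
  have c : (fun y => flat n y / y) @ (0 : R) --> (0 : R).
    apply/cvgr0Pnorm_lt => e e0.
    near=> y; apply: (@le_lt_trans _ _ (n.+2`!%:R * `|y|)).
      rewrite normrM normfV ger0_norm ?flat_ge0//.
      have [->|y0] := eqVneq y 0; first by rewrite flat_le0// mul0r normr0 mulr0.
      rewrite ler_pdivrMr ?normr_gt0// -mulrA -normrM -expr2.
      by rewrite ger0_norm ?sqr_ge0// flat_le_sqr.
    rewrite -ltr_pdivlMl ?ltr0n ?fact_gt0//.
    near: y; exists ((n.+2)`!%:R^-1 * e); last by move=> z; rewrite /ball/= sub0r normrN.
    by rewrite /= mulr_gt0// invr_gt0 ltr0n fact_gt0.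
  have f0 : flat n 0 / 0 = 0 by rewrite flat_le0// mul0r.
  apply/is_derive1_caratheodory; exists (fun y => flat n y / y); split=> //.
  + move=> y; rewrite subr0 (flat_le0 n 0)// subr0.
    by have [->|y0] := eqVneq y 0; [rewrite flat_le0// mulr0|rewrite divfK].
  + by rewrite /prop_for /continuous_at f0; exact: c.
Unshelve. all: by end_near. Qed.

Lemma Ck_flat k n : Ck k (flat n).
Proof.
elim: k n => [|k IH] n.
  move=> x; apply/differentiable_continuous/derivable1_diffP.
  by have [] := is_derive_flat n x.
apply: (CkSP _ _ _ (is_derive_flat n)).
by apply: CkD => //; apply: CkN; apply: CkM => //; exact: Ck_cst.
Qed.

Definition step x : R := flat 0 x / (flat 0 x + flat 0 (1 - x)).

Lemma step_den_gt0 x : 0 < flat 0 x + flat 0 (1 - x).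
Proof.
have [x0|x0] := ltP 0 x; first by rewrite ltr_pwDl ?flat_gt0 ?flat_ge0.
by rewrite ltr_wpDl ?flat_gt0 ?flat_ge0//; lra.
Qed.

Lemma Ck_step k : Ck k step.
Proof.
apply: CkM; first exact: Ck_flat.
apply: CkV; first by move=> x; rewrite gt_eqF// step_den_gt0.
apply: CkD; first exact: Ck_flat.
apply: (Ck_comp _ _ (fun x => 1 - x)); first exact: Ck_flat.
by apply: CkD; [exact: Ck_cst|apply: CkN; exact: Ck_id].
Qed.

Lemma step_ge0 x : 0 <= step x.
Proof. by rewrite divr_ge0 ?flat_ge0// ltW// step_den_gt0. Qed.

Lemma step_le1 x : step x <= 1.
Proof. by rewrite ler_pdivrMr ?step_den_gt0// mul1r lerDl flat_ge0. Qed.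

Lemma step_le0E x : x <= 0 -> step x = 0.
Proof. by move=> x0; rewrite /step flat_le0// mul0r. Qed.

Lemma step_ge1E x : 1 <= x -> step x = 1.
Proof.
move=> x1; rewrite /step (flat_le0 0 (1 - x)) ?addr0 ?divff//; last by lra.
by rewrite gt_eqF// flat_gt0//; lra.
Qed.

Lemma step_gt0 x : 0 < x -> 0 < step x.
Proof. by move=> x0; rewrite divr_gt0 ?flat_gt0 ?step_den_gt0. Qed.

Lemma step_lt1 x : x < 1 -> step x < 1.
Proof. by move=> x1; rewrite ltr_pdivrMr ?step_den_gt0// mul1r ltrDl flat_gt0//; lra. Qed.

Lemma is_derive_step x : is_derive x (1 : R) step
  ((flat 2 x * flat 0 (1 - x) + flat 0 x * flat 2 (1 - x))
   / (flat 0 x + flat 0 (1 - x)) ^+ 2).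
Proof.
have d0 := is_derive_flat 0 x.
have d1 : is_derive x (1 : R) (fun y => flat 0 (1 - y)) (- flat 2 (1 - x)).
  have := is_derive_flat 0 (1 - x); rewrite mul0r subr0 => d.
  have d' : is_derive x (1 : R) (fun y : R => 1 - y) (0 - 1) by exact: is_deriveB.
  apply: (is_derive_eq (@is_derive1_comp _ _ (fun y => 1 - y) _ _ _ d d')).
  by rewrite /= add0r mulrN mulr1.
have d2 := is_deriveD d0 d1.
have d3 := @is_deriveV R (flat 0 + (fun y : R => flat 0 (1 - y))) _ _ _ (lt0r_neq0 (step_den_gt0 x)) d2.
apply: (is_derive_eq (is_deriveM d0 d3)).
have := lt0r_neq0 (step_den_gt0 x) => h.
rewrite mul0r subr0 /GRing.scale /= fctE /=; field.
exact: h.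
Qed.

Lemma derive_step_ge0 x : 0 <= derive1 step x.
Proof.
rewrite derive1E (@derive_val _ _ _ _ _ _ _ (is_derive_step x)).
by rewrite divr_ge0 ?sqr_ge0// addr_ge0// mulr_ge0// flat_ge0.
Qed.

Lemma derive_step_gt0 x : 0 < x < 1 -> 0 < derive1 step x.
Proof.
move=> /andP[x0 x1].
rewrite derive1E (@derive_val _ _ _ _ _ _ _ (is_derive_step x)).
rewrite divr_gt0 ?exprn_gt0 ?step_den_gt0//.
by rewrite addr_gt0// mulr_gt0// flat_gt0//; lra.
Qed.

End SmoothStep.

(** * Antiderivatives and Bregman boundary pairs *)

Section Antiderivative.
Context {R : realType}.
Local Notation mu := (@lebesgue_measure R).

(** The fundamental theorem of calculus needs a lower endpoint to the left of x, so no single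
    endpoint serves the whole line. Integrals from -N are used, with N depending on x; the
    difference of the values at x and at 0 does not depend on N, by additivity. *)
Lemma continuous_antiderivative (f : R -> R) : continuous f ->
  exists F : R -> R, forall x, is_derive x (1 : R) F (f x).
Proof.
move=> cf.
have intf (a b : R) : mu.-integrable `[a, b] (EFin \o f).
  apply: continuous_compact_integrable; first exact: segment_compact.
  exact: continuous_subspaceT.
pose G (N x : R) := (\int[mu]_(t in `[- N, x]) f t)%R.
have GB (M N x : R) : M <= N -> - M <= x ->
    G N x = (\int[mu]_(t in `[- N, - M]) f t)%R + G M x.
  move=> MN Mx; apply/eqP; rewrite addrC -subr_eq; apply/eqP.
  have e1 : (BLeft (- N) <= BRight (- M))%O by rewrite bnd_simp lerN2.
  have e2 : (BRight (- M) <= BRight x)%O by rewrite bnd_simp.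
  rewrite /G (Rintegral_itvB (intf _ _) e1 e2) Rintegral_itv_obnd_cbnd//.
  apply: integrableS (intf (- M) x) => //.
  by apply: subset_itvr; rewrite bnd_simp.
exists (fun x => G (`|x| + 1) x - G (`|x| + 1) 0) => x.
(* This N exceeds |y| + 1 for every y within distance 1 of x, so near x the moving endpoint may be
   replaced by a fixed one. *)
pose N := `|x| + 2.
have [d1 d2] := @continuous_FTC1_closed R f (- N) x (x + 1) (ltac:(lra))
  (intf _ _) (ltac:(rewrite /N; have := ler_norm (- x); rewrite normrN; lra)) (cf x).
have d : is_derive x (1 : R) (fun y => G N y - G N 0) (f x).
  have dG : is_derive x (1 : R) (G N) (f x) by split; [exact: d1|rewrite -d2 derive1E].
  exact: (is_derive_eq (is_deriveB dG (is_derive_cst (G N 0) x 1)) (subr0 _)).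
apply: near_eq_is_derive d.
near=> y.
have yN : `|y| + 1 <= N.
  have : `|x - y| < 1.
    by near: y; exists 1 => /=.
  rewrite distrC => /ltW h; have := ler_normD (y - x) x; rewrite subrK /N; lra.
rewrite (GB _ _ y yN) ?(GB _ _ 0 yN); first by ring.
- by have := normr_ge0 y; lra.
- by have := ler_norm (- y); rewrite normrN; lra.
Unshelve. all: by end_near. Qed.

End Antiderivative.

(** * Functions of two variables: tensor products and test functions *)

Section TwoVariables.
Context {R : realType}.
Implicit Types (F G : R * R -> R) (f g : R -> R).

Lemma is_derive_partial1 F z (d : R) :
  is_derive z.1 (1 : R) (fun s => F (s, z.2)) d -> is_derive (z : R * R) ((1, 0) : R * R) F d.
Proof.
have E : (fun h : R => h^-1 *: ((F \o shift z) (h *: ((1, 0) : R * R)) - F z)) =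
    (fun h : R => h^-1 *: (((fun s => F (s, z.2)) \o shift z.1) (h *: 1) - F (z.1, z.2))).
  apply/funext => h; case: z => a b /=.
  by congr (_ *: (F _ - _)); rewrite /= /shift /=; congr (_, _); rewrite /= scaler0 add0r.
move=> [h1 h2]; split; first by rewrite /derivable E.
by rewrite /derive E.
Qed.

Lemma is_derive_partial2 F z (d : R) :
  is_derive z.2 (1 : R) (fun s => F (z.1, s)) d -> is_derive (z : R * R) ((0, 1) : R * R) F d.
Proof.
have E : (fun h : R => h^-1 *: ((F \o shift z) (h *: ((0, 1) : R * R)) - F z)) =
    (fun h : R => h^-1 *: (((fun s => F (z.1, s)) \o shift z.2) (h *: 1) - F (z.1, z.2))).
  apply/funext => h; case: z => a b /=.
  by congr (_ *: (F _ - _)); rewrite /= /shift /=; congr (_, _); rewrite /= scaler0 add0r.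
move=> [h1 h2]; split; first by rewrite /derivable E.
by rewrite /derive E.
Qed.

(** Every test function used below is such a product, and the boundary pairs are sums of such
    products, so regularity in two variables reduces to regularity in one. *)
Definition tensor f g : R * R -> R := fun z => f z.1 * g z.2.

Lemma is_derive_tensor1 f g (df : R -> R) : (forall x, is_derive x (1 : R) f (df x)) ->
  forall z, is_derive (z : R * R) ((1, 0) : R * R) (tensor f g) (tensor df g z).
Proof.
move=> h z; apply: is_derive_partial1; rewrite /tensor /=.
apply: (is_derive_eq (is_deriveM (h z.1) (is_derive_cst (g z.2) z.1 1))).
by rewrite scaler0 add0r /GRing.scale /= mulrC.
Qed.

Lemma is_derive_tensor2 f g (dg : R -> R) : (forall x, is_derive x (1 : R) g (dg x)) ->
  forall z, is_derive (z : R * R) ((0, 1) : R * R) (tensor f g) (tensor f dg z).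
Proof.
move=> h z; apply: is_derive_partial2; rewrite /tensor /=.
apply: (is_derive_eq (is_deriveM (is_derive_cst (f z.1) z.2 1) (h z.2))).
by rewrite scaler0 addr0 /GRing.scale /=.
Qed.

Lemma continuous_tensor f g : continuous f -> continuous g -> continuous (tensor f g).
Proof.
move=> cf cg z; apply: cvgM.
  by apply: (@continuous_comp _ _ _ fst f); [exact: cvg_fst|exact: cf].
by apply: (@continuous_comp _ _ _ snd g); [exact: cvg_snd|exact: cg].
Qed.

Lemma Ck2SP k F (F1 F2 : R * R -> R) : continuous F ->
  (forall z, is_derive (z : R * R) ((1, 0) : R * R) F (F1 z)) -> (forall z, is_derive (z : R * R) ((0, 1) : R * R) F (F2 z)) ->
  Ck2 k F1 -> Ck2 k F2 -> Ck2 k.+1 F.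
Proof.
move=> cF d1 d2 c1 c2; split=> //; split.
- by move=> z; have [] := d1 z.
- suff -> : partial1 F = F1 by [].
  by apply/funext => z; have [] := d1 z.
- by move=> z; have [] := d2 z.
- suff -> : partial2 F = F2 by [].
  by apply/funext => z; have [] := d2 z.
Qed.

Lemma Ck2_continuous k F : Ck2 k F -> continuous F.
Proof. by case: k => [//|k] []. Qed.

Lemma Ck2_is_derive1 k F : Ck2 k.+1 F -> forall z, is_derive (z : R * R) ((1, 0) : R * R) F (partial1 F z).
Proof. by move=> [_ [d _] _] z; exact: derivableP. Qed.

Lemma Ck2_is_derive2 k F : Ck2 k.+1 F -> forall z, is_derive (z : R * R) ((0, 1) : R * R) F (partial2 F z).
Proof. by move=> [_ _ [d _]] z; exact: derivableP. Qed.

Lemma Ck2_tensor k f g : Ck k f -> Ck k g -> Ck2 k (tensor f g).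
Proof.
elim: k f g => [f g|k IH f g cf cg]; first exact: continuous_tensor.
have [_ df] := cf; have [_ dg] := cg.
apply: (@Ck2SP _ _ (tensor (derive1 f) g) (tensor f (derive1 g))).
- by apply: continuous_tensor; apply: Ck_continuous; eassumption.
- exact/is_derive_tensor1/CkS_is_derive/cf.
- exact/is_derive_tensor2/CkS_is_derive/cg.
- by apply: IH => //; exact: CkW.
- by apply: IH => //; exact: CkW.
Qed.

Lemma Ck2D k F G : Ck2 k F -> Ck2 k G -> Ck2 k (fun z => F z + G z).
Proof.
elim: k F G => [F G cF cG z|k IH F G cF cG]; first exact: cvgD (cF z) (cG z).
have [_ [_ F1] [_ F2]] := cF; have [_ [_ G1] [_ G2]] := cG.
apply: (@Ck2SP _ _ (fun z => partial1 F z + partial1 G z)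
  (fun z => partial2 F z + partial2 G z)).
- by move=> z; apply: cvgD; apply: Ck2_continuous; eassumption.
- by move=> z; exact: is_deriveD (Ck2_is_derive1 _ _ cF z) (Ck2_is_derive1 _ _ cG z).
- by move=> z; exact: is_deriveD (Ck2_is_derive2 _ _ cF z) (Ck2_is_derive2 _ _ cG z).
- exact: IH.
- exact: IH.
Qed.

Lemma supp_subset (T : topologicalType) (f : T -> R) (A : set T) : closed A ->
  (forall x, ~ A x -> f x = 0) -> supp f `<=` A.
Proof.
move=> cA fA; rewrite [X in _ `<=` X]((closure_id A).1 cA).
apply: closureS => x /= /eqP fx; have [//|nAx] := pselect (A x).
by case: fx; exact: fA.
Qed.

Lemma smooth_test_tensor f g (a b c d : R) :
  (forall k, Ck k f) -> (forall k, Ck k g) -> 0 < c -> d < 1 ->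
  (forall t, ~ `[a, b]%classic t -> f t = 0) ->
  (forall x, ~ `[c, d]%classic x -> g x = 0) -> smooth_test (tensor f g).
Proof.
move=> cf cg c0 d1 f0 g0.
have cK : closed (`[a, b] `*` `[c, d] : set (R * R)).
  apply: closedI.
    by apply: (@preimage_closed _ _ fst) => [z _|]; [exact: cvg_fst|exact: interval_closed].
  by apply: (@preimage_closed _ _ snd) => [z _|]; [exact: cvg_snd|exact: interval_closed].
have sK : supp (tensor f g) `<=` `[a, b] `*` `[c, d].
  apply: supp_subset => // -[t x] /= h; rewrite /tensor /=.
  have [Kt|Kt] := pselect (`[a, b]%classic t); last by rewrite f0// mul0r.
  by rewrite g0 ?mulr0// => Kx; apply: h; split.
split.
- by move=> k; exact: Ck2_tensor.
- apply: (@subclosed_compact _ _ (`[a, b] `*` `[c, d])) => //.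
    exact: closed_closure.
  by apply: compact_setX; exact: segment_compact.
- move=> z /sK [_]; rewrite /= !in_itv /= => /andP[h1 h2]; split=> //=.
  by apply/andP; split; lra.
Qed.

Lemma partial1_tensor f g : Ck 1 f -> partial1 (tensor f g) = tensor (derive1 f) g.
Proof.
by move=> cf; apply/funext => z; have [] := is_derive_tensor1 f g _ (CkS_is_derive _ _ cf) z.
Qed.

Lemma partial2_tensor f g : Ck 1 g -> partial2 (tensor f g) = tensor f (derive1 g).
Proof.
by move=> cg; apply/funext => z; have [] := is_derive_tensor2 f g _ (CkS_is_derive _ _ cg) z.
Qed.

End TwoVariables.

Section BregmanPair.
Context {R : realType}.
Variables (J g P q : R -> R).
Hypotheses (J2 : Ck 2 J) (g2 : Ck 2 g) (g_ge0 : forall v, 0 <= derive1 g v).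
Hypotheses (dP : forall v, is_derive v (1 : R) P (g v))
  (dq : forall v, is_derive v (1 : R) q (derive1 J v * g v)).

Definition bregman_entropy (z : R * R) : R := P z.1 - P z.2 - g z.2 * (z.1 - z.2).
Definition bregman_flux (z : R * R) : R := q z.1 - q z.2 - g z.2 * (J z.1 - J z.2).

Let Ck2_P : Ck 2 P. Proof. by apply: CkW; exact: CkSP dP g2. Qed.

Let Ck2_q : Ck 2 q.
Proof. by apply: (CkSP _ _ _ dq); apply: CkM; [case: J2|exact: CkW]. Qed.

(** The derivatives in v are g v - g w and J' v (g v - g w): subtracting the affine part at w
    changes the flux by a multiple of J and a constant, and convexity remains g' >= 0. *)
Lemma lax_pair_bregman w :
  lax_pair J (fun v => bregman_entropy (v, w)) (fun v => bregman_flux (v, w)).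
Proof.
have dS v : is_derive v (1 : R) (fun v => bregman_entropy (v, w)) (g v - g w).
  rewrite /bregman_entropy /=.
  have h := is_deriveB (is_deriveB (dP v) (is_derive_cst (P w) v 1))
    (is_deriveM (is_derive_cst (g w) v 1) (is_deriveB (is_derive_id v (1 : R)) (is_derive_cst w v 1))).
  apply: (is_derive_eq h).
  by rewrite /GRing.scale /=; ring.
have dQ v : is_derive v (1 : R) (fun v => bregman_flux (v, w)) (derive1 J v * (g v - g w)).
  rewrite /bregman_flux /=.
  have dJ := CkS_is_derive _ _ J2 v.
  have h := is_deriveB (is_deriveB (dq v) (is_derive_cst (q w) v 1))
    (is_deriveM (is_derive_cst (g w) v 1) (is_deriveB dJ (is_derive_cst (J w) v 1))).
  apply: (is_derive_eq h).
  by rewrite /GRing.scale /=; ring.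
have gw : Ck 2 (fun v => g v - g w) := CkD 2 g (cst (- g w)) g2 (Ck_cst 2 _).
have [_ dSE] := is_derive_derive1 _ _ dS.
have [_ dQE] := is_derive_derive1 _ _ dQ.
split.
- by apply: CkW; exact: CkSP dS gw.
- by apply: (CkSP _ _ _ dQ); apply: CkM; [case: J2|exact: CkW].
- move=> v; rewrite /= dSE derive1E.
  have dg := CkS_is_derive _ _ g2 v.
  have h := is_deriveB dg (is_derive_cst (g w) v 1).
  rewrite (@derive_val _ _ _ _ _ _ _ h) subr0; exact: g_ge0.
- by move=> v; rewrite dQE dSE.
Qed.

(** The second variable enters through g w = P' w, so joint C^2 regularity asks for one more
    derivative of P than a Lax pair does; hence a smooth step for g rather than a piecewise linear
    one. Both functions are sums of three tensor products. *)
Lemma boundary_flux_bregman : boundary_flux J bregman_flux.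
Proof.
have c1 k : Ck k (cst 1 : R -> R) by exact: Ck_cst.
exists bregman_entropy; split.
- have -> : bregman_entropy = fun z => (tensor P (cst 1) z
      + tensor (cst 1) (fun w => g w * w - P w) z) + tensor id (fun w => - g w) z.
    by apply/funext => -[v w]; rewrite /bregman_entropy /tensor /cst /=; ring.
  have cgP := CkD 2 _ _ (CkM 2 _ _ g2 (Ck_id 2)) (CkN 2 _ Ck2_P).
  exact: (Ck2D 2 _ _ (Ck2D 2 _ _ (Ck2_tensor 2 _ _ Ck2_P (c1 2))
    (Ck2_tensor 2 _ _ (c1 2) cgP)) (Ck2_tensor 2 _ _ (Ck_id 2) (CkN 2 _ g2))).
- have -> : bregman_flux = fun z => (tensor q (cst 1) z
      + tensor (cst 1) (fun w => g w * J w - q w) z) + tensor J (fun w => - g w) z.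
    by apply/funext => -[v w]; rewrite /bregman_flux /tensor /cst /=; ring.
  have cgq := CkD 2 _ _ (CkM 2 _ _ g2 J2) (CkN 2 _ Ck2_q).
  exact: (Ck2D 2 _ _ (Ck2D 2 _ _ (Ck2_tensor 2 _ _ Ck2_q (c1 2))
    (Ck2_tensor 2 _ _ (c1 2) cgq)) (Ck2_tensor 2 _ _ J2 (CkN 2 _ g2))).
- exact: lax_pair_bregman.
- move=> w; split; [by rewrite /bregman_entropy /=; ring|by rewrite /bregman_flux /=; ring|].
  have h : is_derive ((w, w) : R * R) ((1, 0) : R * R) bregman_entropy (g w - g w).
    apply: is_derive_partial1; rewrite /bregman_entropy /=.
    have h := is_deriveB (is_deriveB (dP w) (is_derive_cst (P w) w 1))
      (is_deriveM (is_derive_cst (g w) w 1) (is_deriveB (is_derive_id w (1 : R)) (is_derive_cst w w 1))).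
    apply: (is_derive_eq h).
    by rewrite /GRing.scale /=; ring.
  by have [_] := h; rewrite subrr.
Qed.

End BregmanPair.

(** * Step entropies and the signs of their fluxes *)

Section MeanValue.
Context {R : realType}.
Variables (F f : R -> R).
Hypothesis dF : forall x, is_derive x (1 : R) F (f x).

Lemma derive_continuous : continuous F.
Proof. by move=> x; apply/differentiable_continuous/derivable1_diffP; have [] := dF x. Qed.

Lemma mean_value (a b : R) : a < b ->
  exists2 c, a < c < b & F b - F a = f c * (b - a).
Proof.
move=> ab.
have [c + e] := MVT ab (fun x _ => dF x) (continuous_subspaceT derive_continuous).
by rewrite in_itv /= => h; exists c.
Qed.

Lemma derive_ge0_le (a b : R) : (forall x, a < x < b -> 0 <= f x) -> a <= b -> F a <= F b.
Proof.
move=> h; rewrite le_eqVlt => /predU1P[->//|ab].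
have [c /h fc e] := mean_value _ _ ab.
by rewrite -subr_ge0 e mulr_ge0// subr_ge0 ltW.
Qed.

Lemma derive_le0_le (a b : R) : (forall x, a < x < b -> f x <= 0) -> a <= b -> F b <= F a.
Proof.
move=> h; rewrite le_eqVlt => /predU1P[->//|ab].
have [c /h fc e] := mean_value _ _ ab.
by rewrite -subr_le0 e mulr_le0_ge0// subr_ge0 ltW.
Qed.

Lemma derive_gt0_lt (a b : R) : (forall x, a < x < b -> 0 < f x) -> a < b -> F a < F b.
Proof.
move=> h ab; have [c /h fc e] := mean_value _ _ ab.
by rewrite -subr_gt0 e mulr_gt0// subr_gt0.
Qed.

Lemma derive_lt0_lt (a b : R) : (forall x, a < x < b -> f x < 0) -> a < b -> F b < F a.
Proof.
move=> h ab; have [c /h fc e] := mean_value _ _ ab.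
by rewrite -subr_lt0 e nmulr_rlt0// subr_gt0.
Qed.

Lemma derive_eq0_eq (a b : R) : (forall x, a < x < b -> f x = 0) -> a <= b -> F a = F b.
Proof.
move=> h ab; apply/eqP; rewrite eq_le; apply/andP; split.
  by apply: derive_ge0_le => // x /h ->.
by apply: derive_le0_le => // x /h ->.
Qed.

End MeanValue.

Section StepPairs.
Context {R : realType}.
Variable J : R -> R.
Hypothesis J2 : Ck 2 J.

(* The entropy pair (S, F) is the section at any w in W of one boundary pair. *)
Definition boundary_family (W : set R) (S F : R -> R) : Prop :=
  lax_pair J S F /\
  exists2 Q, boundary_flux J Q & forall v w, W w -> Q (v, w) = F v.

Definition ramp (al be v : R) : R := step ((v - al) / (be - al)).

Variables (al be : R).
Hypothesis albe : al < be.
Local Notation g := (ramp al be).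

Lemma ramp_le v : v <= al -> g v = 0.
Proof.
move=> h; apply: step_le0E; rewrite mulr_le0_ge0//; first by rewrite subr_le0.
by rewrite invr_ge0 subr_ge0 ltW.
Qed.

Lemma ramp_ge v : be <= v -> g v = 1.
Proof. by move=> h; apply: step_ge1E; rewrite ler_pdivlMr ?subr_gt0// mul1r; lra. Qed.

Lemma ramp_ge0 v : 0 <= g v. Proof. exact: step_ge0. Qed.

Lemma ramp_le1 v : g v <= 1. Proof. exact: step_le1. Qed.

Lemma ramp_gt0 v : al < v -> 0 < g v.
Proof. by move=> h; apply: step_gt0; rewrite divr_gt0// subr_gt0. Qed.

Lemma ramp_lt1 v : v < be -> g v < 1.
Proof. by move=> h; apply: step_lt1; rewrite ltr_pdivrMr ?subr_gt0// mul1r; lra. Qed.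

Lemma is_derive_ramp v :
  is_derive v (1 : R) g (derive1 step ((v - al) / (be - al)) / (be - al)).
Proof.
have d1 := CkS_is_derive _ _ (Ck_step 1) ((v - al) / (be - al)).
have d2 : is_derive v (1 : R) (fun v : R => (v - al) / (be - al)) (be - al)^-1.
  have h := is_deriveM (is_deriveB (is_derive_id v (1 : R)) (is_derive_cst al v 1))
    (is_derive_cst (be - al)^-1 v 1).
  by apply: (is_derive_eq h); rewrite scaler0 add0r subr0 /GRing.scale /= mulr1.
exact: (@is_derive1_comp _ step (fun v : R => (v - al) / (be - al))).
Qed.

Lemma Ck_ramp k : Ck k g.
Proof.
apply: (Ck_comp _ step (fun v => (v - al) / (be - al))); first exact: Ck_step.
apply: CkM; last exact: Ck_cst.
by apply: CkD; [exact: Ck_id|exact: (Ck_cst k (- al))].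
Qed.

Lemma ramp_derive_ge0 v : 0 <= derive1 g v.
Proof.
rewrite derive1E (@derive_val _ _ _ _ _ _ _ (is_derive_ramp v)).
by rewrite divr_ge0 ?derive_step_ge0// subr_ge0 ltW.
Qed.

Let dJ := CkS_is_derive _ _ J2.

Lemma step_pairs : exists S F S' F' : R -> R,
  [/\ boundary_family [set w | w <= al] S F,
      (forall v, v <= al -> S v = 0) /\ (forall v, al < v -> 0 < S v),
      (forall v, v <= al -> F v = 0) &
      forall v, is_derive v (1 : R) F (derive1 J v * g v)] /\
  [/\ boundary_family [set w | be <= w] S' F',
      (forall v, be <= v -> S' v = 0) /\ (forall v, v < be -> 0 < S' v),
      (forall v, be <= v -> F' v = 0) &
      forall v, is_derive v (1 : R) F' (derive1 J v * (g v - 1))].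
Proof.
have [P dP] := continuous_antiderivative _ (Ck_continuous _ _ (Ck_ramp 0)).
have cJg : continuous (fun v => derive1 J v * g v).
  apply: (Ck_continuous 0); apply: CkM; last exact: Ck_ramp.
  by case: J2 => _ [+ _] => h; move=> x; exact/differentiable_continuous/derivable1_diffP.
have [q dq] := continuous_antiderivative _ cJg.
pose S := bregman_entropy g P; pose Q := bregman_flux J g q.
have lS w := lax_pair_bregman J g P q J2 (Ck_ramp 2) ramp_derive_ge0 dP dq w.
have bQ := boundary_flux_bregman J g P q J2 (Ck_ramp 2) ramp_derive_ge0 dP dq.
have d1 w v : is_derive v (1 : R) (fun v => P v - v * w) (g v - w).
  have h := is_deriveB (dP v) (is_deriveM (is_derive_id v (1 : R)) (is_derive_cst w v 1)).
  by apply: (is_derive_eq h); rewrite scaler0 add0r /GRing.scale /= mulr1.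
have d2 w v : is_derive v (1 : R) (fun v => q v - J v * w) (derive1 J v * (g v - w)).
  have h := is_deriveB (dq v) (is_deriveM (dJ v) (is_derive_cst w v 1)).
  by apply: (is_derive_eq h); rewrite scaler0 add0r /GRing.scale /= mulrBr (mulrC w).
have dB w v : is_derive v (1 : R) (fun v => S (v, w)) (g v - g w).
  have -> : (fun v => S (v, w)) = (fun v => (P v - v * g w) + (- P w + g w * w)).
    by apply/funext => x; rewrite /S /bregman_entropy /=; ring.
  by apply: (is_derive_eq (is_deriveD (d1 (g w) v) (is_derive_cst _ v 1))); rewrite addr0.
have dQ w v : is_derive v (1 : R) (fun v => Q (v, w)) (derive1 J v * (g v - g w)).
  have -> : (fun v => Q (v, w)) = (fun v => (q v - J v * g w) + (- q w + g w * J w)).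
    by apply/funext => x; rewrite /Q /bregman_flux /=; ring.
  by apply: (is_derive_eq (is_deriveD (d2 (g w) v) (is_derive_cst _ v 1))); rewrite addr0.
have Sww w : S (w, w) = 0 by rewrite /S /bregman_entropy /=; ring.
have Qww w : Q (w, w) = 0 by rewrite /Q /bregman_flux /=; ring.
have gal := ramp_le _ (lexx al); have gbe := ramp_ge _ (lexx be).
exists (fun v => S (v, al)), (fun v => Q (v, al)), (fun v => S (v, be)), (fun v => Q (v, be)).
have dQal v := dQ al v; have dQbe v := dQ be v.
have dSal v := dB al v; have dSbe v := dB be v.
rewrite gal in dQal, dSal; rewrite gbe in dQbe, dSbe.
split; split.
- split; first exact: lS.
  exists Q => // v w /= wal; rewrite /Q /bregman_flux /= gal ramp_le// !mul0r !subr0.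
  congr (_ - _); apply: (derive_eq0_eq _ _ dq) => // x /andP[_ xal].
  by rewrite ramp_le ?mulr0// ltW.
- split=> v h.
    rewrite -(Sww al); apply: (derive_eq0_eq _ _ dSal) => // x /andP[_ xal].
    by rewrite subr0 ramp_le// ltW.
  rewrite -(Sww al); apply: (derive_gt0_lt _ _ dSal) => // x /andP[xal _].
  by rewrite subr0 ramp_gt0.
- move=> v h; rewrite -(Qww al); apply: (derive_eq0_eq _ _ dQal) => // x /andP[_ xal].
  by rewrite subr0 ramp_le ?mulr0// ltW.
- by move=> v; apply: (is_derive_eq (dQal v)); rewrite subr0.
- split; first exact: lS.
  exists Q => // v w /= wbe; rewrite /Q /bregman_flux /= gbe ramp_ge// !mul1r.
  (* The derivative of q - J is J' (g - 1), which vanishes where the ramp has reached 1. *)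
  suff : q be - J be * 1 = q w - J w * 1 by move=> e; lra.
  apply: (derive_eq0_eq _ _ (d2 1)) => // x /andP[bex _].
  by rewrite ramp_ge ?subrr ?mulr0// ltW.
- split=> v h.
    rewrite -(Sww be); apply/esym; apply: (derive_eq0_eq _ _ dSbe) => // x /andP[xbe _].
    by rewrite ramp_ge ?subrr// ltW.
  rewrite -(Sww be); apply: (derive_lt0_lt _ _ dSbe) => // x /andP[_ xbe].
  by rewrite subr_lt0 ramp_lt1.
- move=> v h; rewrite -(Qww be); apply/esym.
  apply: (derive_eq0_eq _ _ dQbe) => // x /andP[xbe _].
  by rewrite ramp_ge ?subrr ?mulr0// ltW.
- exact: dQbe.
Qed.

End StepPairs.

(** * Signs of the step fluxes for a concave flux function *)

Section FluxSigns.
Context {R : realType}.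
Variables (J : R -> R) (m : R).
Hypotheses (J2 : Ck 2 J) (J_concave : forall x, derive1n 2 J x < 0)
  (m_max : forall x, x != m -> J x < J m).

Let dJ := CkS_is_derive _ _ J2.
Let ddJ : forall x, is_derive x (1 : R) (derive1 J) (derive1n 2 J x).
Proof. by case: J2 => _ c x; exact: (@CkS_is_derive R 0 (derive1 J) c x). Qed.

Lemma derive_flux_max : derive1 J m = 0.
Proof.
rewrite derive1E.
have := @derive1_at_max R J (m - 1) (m + 1) m.
case.
- by lra.
- by move=> t _; have [] := dJ t.
- by rewrite in_itv /=; apply/andP; split; lra.
- by move=> t _; have [->//|/m_max/ltW] := eqVneq t m.
- by [].
Qed.

Lemma derive_flux_gt0 x : x < m -> 0 < derive1 J x.
Proof. by move=> xm; rewrite -derive_flux_max; apply: (derive_lt0_lt _ _ ddJ). Qed.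

Lemma derive_flux_lt0 x : m < x -> derive1 J x < 0.
Proof. by move=> xm; rewrite -derive_flux_max; apply: (derive_lt0_lt _ _ ddJ). Qed.

Lemma flux_incr (x y : R) : x < y -> y <= m -> J x < J y.
Proof.
move=> xy ym; apply: (derive_gt0_lt _ _ dJ) => // z /andP[_ zy].
by apply: derive_flux_gt0; lra.
Qed.

Lemma flux_decr (x y : R) : x < y -> m <= x -> J y < J x.
Proof.
move=> xy ym; apply: (derive_lt0_lt _ _ dJ) => // z /andP[zx _].
by apply: derive_flux_lt0; lra.
Qed.

Section Upper.
Variables (al be : R) (F : R -> R).
Hypotheses (albe : al < be) (F0 : forall v, v <= al -> F v = 0)
  (dF : forall v, is_derive v (1 : R) F (derive1 J v * ramp al be v)).

Lemma upper_gt0 v : al < v -> v <= m -> 0 < F v.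
Proof.
move=> alv vm; rewrite -(F0 al (lexx _)); apply: (derive_gt0_lt _ _ dF) => // x /andP[ax xv].
by rewrite mulr_gt0 ?ramp_gt0// derive_flux_gt0//; lra.
Qed.

Lemma upper_nincr (x y : R) : m <= x -> x <= y -> F y <= F x.
Proof.
move=> mx xy; apply: (derive_le0_le _ _ dF) => // z /andP[xz _].
by rewrite mulr_le0_ge0 ?ramp_ge0// ltW// derive_flux_lt0//; lra.
Qed.

(** Beyond be the ramp is 1, so F - J is constant there and F v = F be + J v - J be with F be > 0.
    Hence F remains positive past m for as long as J v >= J be, that is, up to the conjugate point
    of be. *)
Lemma upper_ge v : be <= m -> be <= v -> J v - J be <= F v.
Proof.
move=> bem bev.
have d w : is_derive w (1 : R) (fun v => F v - J v) (derive1 J w * (ramp al be w - 1)).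
  by apply: (is_derive_eq (is_deriveB (dF w) (dJ w))); rewrite mulrBr mulr1.
have := derive_eq0_eq _ _ d be v; move=> /(_ _ bev).
have Fbe : 0 < F be by exact: upper_gt0.
have h x : be < x < v -> derive1 J x * (ramp al be x - 1) = 0.
  by move=> /andP[bex _]; rewrite ramp_ge ?subrr ?mulr0// ltW.
by move=> /(_ h) e; lra.
Qed.

Lemma upper_lt0 v : m <= al -> al < v -> F v < 0.
Proof.
move=> mal alv; rewrite -(F0 al (lexx _)); apply: (derive_lt0_lt _ _ dF) => // x /andP[ax xv].
by rewrite nmulr_rlt0 ?ramp_gt0// derive_flux_lt0//; lra.
Qed.

End Upper.

Section Lower.
Variables (al be : R) (F : R -> R).
Hypotheses (albe : al < be) (F0 : forall v, be <= v -> F v = 0)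
  (dF : forall v, is_derive v (1 : R) F (derive1 J v * (ramp al be v - 1))).

Lemma lower_lt0 v : v < be -> m <= v -> F v < 0.
Proof.
move=> alv vm; rewrite -(F0 be (lexx _)); apply: (derive_gt0_lt _ _ dF) => // x /andP[ax xv].
by rewrite nmulr_rgt0 ?subr_lt0 ?ramp_lt1// derive_flux_lt0//; lra.
Qed.

Lemma lower_nincr (x y : R) : y <= m -> x <= y -> F y <= F x.
Proof.
move=> ym xy; apply: (derive_le0_le _ _ dF) => // z /andP[_ zy].
by rewrite mulr_ge0_le0 ?subr_le0 ?ramp_le1// ltW// derive_flux_gt0//; lra.
Qed.

(** Mirror image of [upper_ge]: below al the ramp is 0, F + J is constant and F al < 0. *)
Lemma lower_le v : m <= al -> v <= al -> F v <= J al - J v.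
Proof.
move=> mal val.
have d w : is_derive w (1 : R) (fun v => F v + J v) (derive1 J w * ramp al be w).
  by apply: (is_derive_eq (is_deriveD (dF w) (dJ w))); rewrite mulrBr mulr1 subrK.
have := derive_eq0_eq _ _ d v al; move=> /(_ _ val).
have Fal : F al < 0 by exact: lower_lt0.
have h x : v < x < al -> derive1 J x * ramp al be x = 0.
  by move=> /andP[_ xal]; rewrite ramp_le ?mulr0// ltW.
by move=> /(_ h) e; lra.
Qed.

Lemma lower_gt0 v : be <= m -> v < be -> 0 < F v.
Proof.
move=> bem vbe; rewrite -(F0 be (lexx _)); apply: (derive_lt0_lt _ _ dF) => // x /andP[ax xv].
by rewrite pmulr_rlt0 ?subr_lt0 ?ramp_lt1// derive_flux_gt0//; lra.
Qed.

End Lower.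

End FluxSigns.

(** Where A is negative, B is at least c, and K = (|min A| + 1) / c makes K B outweigh A there;
    elsewhere both terms are nonnegative and one of them is positive at distance r from a.
    Compactness of the points of [0,1] at distance at least r turns positivity into a uniform bound
    c0. *)
Lemma separating_combination (R : realType) (A B : R -> R) (a r c : R) :
  continuous A -> continuous B -> 0 < c ->
  (forall v, 0 <= v <= 1 -> 0 <= B v) ->
  (forall v, 0 <= v <= 1 -> 0 <= A v \/ c <= B v) ->
  (forall v, 0 <= v <= 1 -> r <= `|v - a| -> 0 < A v \/ 0 < B v) ->
  exists K c0, [/\ 0 <= K, 0 < c0 & forall v, 0 <= v <= 1 ->
    0 <= A v + K * B v /\ (r <= `|v - a| -> c0 <= A v + K * B v)].
Proof.
move=> cA cB c0 B0 AB pos.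
have [x0 _ minA] := EVT_min (@ler01 R) (continuous_subspaceT cA).
have hA v : 0 <= v <= 1 -> A x0 <= A v by move=> h; apply: minA; rewrite in_itv.
pose K := (`|A x0| + 1) / c.
have K0 : 0 < K by rewrite divr_gt0// ltr_wpDl.
have H v : 0 <= v <= 1 -> 0 <= A v + K * B v /\ (r <= `|v - a| -> 0 < A v + K * B v).
  move=> h; have Bv := B0 v h; have KB : 0 <= K * B v by rewrite mulr_ge0// ltW.
  have [Av|cBv] := AB v h.
    split; first by rewrite addr_ge0.
    move=> /(pos v h)[Av'|Bv']; first by rewrite ltr_pwDl.
    by rewrite ltr_wpDl// mulr_gt0.
  suff : 0 < A v + K * B v by move=> p; split=> // ; exact: ltW.
  have : K * c <= K * B v by rewrite ler_pM2l.
  rewrite {1}/K divfK ?gt_eqF//.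
  by have := hA v h; have := ler_norm (- A x0); rewrite normrN; lra.
pose C : set R := `[0, 1]%classic `&` [set v : R | r <= `|v - a|].
have cH : continuous (fun v => A v + K * B v).
  by move=> v; apply: cvgD; [exact: cA|apply: cvgM; [exact: cvg_cst|exact: cB]].
(* If no point of [0,1] is that far from a, the bound is vacuous and c0 = 1 serves. *)
have [C0|/set0P C0] := eqVneq C set0.
  exists K, 1; split=> //; first exact: ltW.
  move=> v h; have [h1 h2] := H v h; split=> // rv.
  by have : C v; [split=> //=; rewrite in_itv|rewrite C0].
have kC : compact C.
  apply: (@subclosed_compact R C `[0, 1]%classic); last by move=> v [].
    apply: closedI; first exact: interval_closed.
    apply: (@preimage_closed _ _ (fun v : R => `|v - a|) [set y | r <= y]); last exact: closed_ge.
    move=> v _; apply: (@continuous_comp _ _ _ (fun v : R => v - a) (fun x : R => `|x|)).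
      by apply: cvgB; [exact: cvg_id|exact: cvg_cst].
    exact: norm_continuous.
  exact: segment_compact.
have [v0 v0C minH] := compact_EVT_min C0 kC (continuous_subspaceT cH).
exists K, (A v0 + K * B v0).
have [v01 v0r] : (0 <= v0 <= 1) /\ r <= `|v0 - a|.
  by move: v0C; rewrite inE => -[/=]; rewrite in_itv.
split; first exact: ltW.
  by have [_] := H v0 v01; exact.
move=> v h; have [h1 h2] := H v h; split=> // rv.
by apply: minH; rewrite inE; split=> //=; rewrite in_itv.
Qed.

(** * Almost-everywhere integrals and test integrals *)

Lemma aeS d (T : measurableType d) (R : realType) (mu : {measure set T -> \bar R})
  (P Q : T -> Prop) : (forall x, P x -> Q x) ->
  {ae mu, forall x, P x} -> {ae mu, forall x, Q x}.
Proof. by move=> PQ; apply: filterS. Qed.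

Lemma aeI d (T : measurableType d) (R : realType) (mu : {measure set T -> \bar R})
  (P Q : T -> Prop) : {ae mu, forall x, P x} -> {ae mu, forall x, Q x} ->
  {ae mu, forall x, P x /\ Q x}.
Proof. by move=> hP hQ; near=> x; split; near: x. Unshelve. all: by end_near. Qed.

Section AlmostEverywhereIntegrals.
Context d (T : measurableType d) (R : realType).
Variable mu : {measure set T -> \bar R}.
Variable D : set T.
Hypothesis mD : measurable D.
Implicit Types f g : T -> R.

Lemma ae_Rintegral_ge0 f : measurable_fun D f ->
  {ae mu, forall x, D x -> 0 <= f x} -> 0 <= \int[mu]_(x in D) f x.
Proof.
move=> mf f0; pose g x := Num.max (f x) 0.
have -> : \int[mu]_(x in D) f x = \int[mu]_(x in D) g x.
  rewrite /Rintegral; congr fine; apply: ae_eq_integral => //.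
  - exact/measurable_EFinP.
  - by apply/measurable_EFinP; apply: measurable_maxr => //.
  - by apply: filterS f0 => x /= h /h fx; rewrite /g max_l.
by apply: Rintegral_ge0 => x _; rewrite /g le_max lexx orbT.
Qed.

Lemma ae_le_Rintegral f g : mu.-integrable D (EFin \o f) -> mu.-integrable D (EFin \o g) ->
  {ae mu, forall x, D x -> f x <= g x} ->
  \int[mu]_(x in D) f x <= \int[mu]_(x in D) g x.
Proof.
move=> If Ig fg; rewrite -subr_ge0 -RintegralB//; apply: ae_Rintegral_ge0.
  by apply: measurable_funB; apply/measurable_EFinP;
    [case/integrableP: Ig|case/integrableP: If].
by apply: filterS fg => x /= h /h; rewrite subr_ge0.
Qed.

Lemma ae_le_integrable f g : measurable_fun D f -> mu.-integrable D (EFin \o g) ->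
  {ae mu, forall x, D x -> `|f x| <= g x} -> mu.-integrable D (EFin \o f).
Proof.
move=> mf Ig fg; apply/integrableP; split; first exact/measurable_EFinP.
have /integrableP[mg goo] := Ig; apply: le_lt_trans goo.
apply: ae_ge0_le_integral => //.
- by apply: measurableT_comp => //; exact/measurable_EFinP.
- exact: measurableT_comp.
- apply: filterS fg => x /= h /h fx; rewrite lee_fin.
  by apply: (le_trans fx); exact: ler_norm.
Qed.

Lemma ae_normr_Rintegral_le f g : measurable_fun D f -> mu.-integrable D (EFin \o g) ->
  {ae mu, forall x, D x -> `|f x| <= g x} ->
  `|\int[mu]_(x in D) f x| <= \int[mu]_(x in D) g x.
Proof.
move=> mf Ig fg; have If := ae_le_integrable _ _ mf Ig fg.
apply: le_trans (le_normr_Rintegral mD If) _; apply: ae_le_Rintegral => //.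
exact: integrable_norm.
Qed.

Lemma Rintegral_eq0_ae f : mu.-integrable D (EFin \o f) ->
  (forall x, D x -> 0 <= f x) -> \int[mu]_(x in D) f x <= 0 ->
  {ae mu, forall x, D x -> f x = 0}.
Proof.
move=> If f0 intf.
have /integrableP[mf _] := If.
have /(ae_eq_integral_abs mu mD mf) : (\int[mu]_(x in D) `|(EFin \o f) x| = 0)%E.
  rewrite (eq_integral (EFin \o f)); last first.
    by move=> x /set_mem Dx; rewrite gee0_abs// lee_fin; exact: f0.
  apply/eqP; rewrite eq_le; apply/andP; split; last first.
    by apply: integral_ge0 => x Dx; rewrite lee_fin f0.
  rewrite -[leLHS]fineK ?lee_fin//; exact: integrable_fin_num.
by apply: filterS => x /= h /h [].
Qed.

End AlmostEverywhereIntegrals.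

(** * Lebesgue measure: reflection, null lines and rectangles *)

Section LebesgueNull.
Context {R : realType}.

(** The right boundary condition is written in the distance r = 1 - x, and its exceptional set has
    to be carried over to x. The image measure under x -> 1 - x agrees with Lebesgue measure on
    half-open intervals, hence equals it. *)
Lemma ae_reflect (P : R -> Prop) :
  {ae @leb R, forall x, P x} -> {ae @leb R, forall x, P (1 - x)}.
Proof.
have mf : measurable_fun setT (fun x : measurableTypeR R => (1 - x : measurableTypeR R)).
  by apply: measurable_funB.
move=> [N [mN N0 PN]].
exists ((fun x : R => 1 - x) @^-1` N); split; last by move=> x /= h; exact: PN.
  by rewrite -[X in measurable X]setTI; exact: mf.
have h : lebesgue_measure N = pushforward (@lebesgue_measure R) (fun x : measurableTypeR R => (1 - x : measurableTypeR R)) N.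
  apply: lebesgue_measure_unique => // _ [[a b]] _ <-.
  transitivity (lebesgue_measure (`[1 - b, 1 - a[%classic : set R)); last first.
    congr (lebesgue_measure _).
    by apply/seteqP; split=> x /=; rewrite !in_itv /= => /andP[h1 h2]; apply/andP; split; lra.
  rewrite !lebesgue_measure_itv /= !lte_fin ltrD2l ltrN2.
  by case: ifP => // _; rewrite -!EFinB; congr EFin; lra.
by rewrite -N0 /leb; exact: (esym h).
Qed.

Lemma leb2_setX (A B : set (measurableTypeR R)) : measurable A -> measurable B ->
  @leb2 R (A `*` B) = (lebesgue_measure A * lebesgue_measure B)%E.
Proof. exact: product_measure1E. Qed.

Lemma ae_leb2_vertical (c : R) : {ae @leb2 R, forall z, z.1 != c}.
Proof.
exists ([set c] `*` setT); split.
- by apply: measurableX.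
- by rewrite leb2_setX// lebesgue_measure_set1 mul0e.
- by move=> [a b] /= /negP; rewrite negbK => /eqP ->.
Qed.

Lemma ae_leb2_horizontal (c : R) : {ae @leb2 R, forall z, z.2 != c}.
Proof.
exists (setT `*` [set c]); split.
- by apply: measurableX.
- by rewrite leb2_setX// lebesgue_measure_set1 mule0.
- by move=> [a b] /= /negP; rewrite negbK => /eqP ->.
Qed.

Lemma measurable_strip : measurable (@strip R : set (measurableTypeR R * measurableTypeR R)).
Proof. by apply: measurableX. Qed.

Lemma leb2_rectangle (a b c d : R) : a <= b -> c <= d ->
  @leb2 R (`[a, b] `*` `[c, d]) = ((b - a) * (d - c))%:E.
Proof.
move=> ab cd; rewrite leb2_setX// !lebesgue_measure_itv /= !lte_fin.
move: ab cd; rewrite le_eqVlt => /predU1P[->|ab]; first by rewrite ltxx subrr mul0e mul0r.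
rewrite le_eqVlt => /predU1P[->|cd]; first by rewrite ltxx subrr mule0 mulr0.
by rewrite ab cd EFinM.
Qed.

Lemma continuous_bounded (S : R -> R) (a b : R) : continuous S ->
  exists2 C, 0 <= C & forall v, a <= v <= b -> `|S v| <= C.
Proof.
move=> cS; have [ab|ba] := leP a b; last first.
  by exists 0 => // v /andP[h1 h2]; move: (le_lt_trans (le_trans h1 h2) ba); rewrite ltxx.
have cN : continuous (fun v => `|S v|).
  by move=> v; apply: continuous_comp; [exact: cS|exact: norm_continuous].
have [c _ hc] := EVT_max ab (continuous_subspaceT cN).
by exists `|S c| => // v h; apply: hc; rewrite in_itv.
Qed.

End LebesgueNull.

(** * Integrals against tensor test functions *)

Section TestIntegrals.
Context {R : realType}.
Local Notation strip := (@strip R).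
Local Notation leb2 := (@leb2 R).
Local Notation leb := (@leb R).
Variables (u : R * R -> R) (M : R).
Hypothesis mu : measurable_fun (strip : set (measurableTypeR R * measurableTypeR R))
  (u : measurableTypeR R * measurableTypeR R -> measurableTypeR R).
Hypothesis uM : {ae leb2, forall z, strip z -> `|u z| <= M}.
Variables (S b k : R -> R) (p q : R).
Hypotheses (cS : continuous S) (cb : continuous b) (ck : continuous k) (pq : p <= q).
Hypothesis b0 : forall t, ~ `[p, q]%classic t -> b t = 0.

(** The shape taken by each term of the entropy inequality when the test function is a tensor
    product. The strip is unbounded in time, so integrability rests on the support of b. *)
Definition test_integrand (z : R * R) : R := S (u z) * b z.1 * k z.2.

Lemma measurable_test_integrand :
  measurable_fun (strip : set (measurableTypeR R * measurableTypeR R)) test_integrand.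
Proof.
apply: measurable_funM; first apply: measurable_funM.
- by apply: measurableT_comp mu; exact: continuous_measurable_fun.
- apply: (@measurableT_comp _ _ _ _ _ _ b _ fst); last exact: measurable_funTS.
  exact: continuous_measurable_fun.
- apply: (@measurableT_comp _ _ _ _ _ _ k _ snd); last exact: measurable_funTS.
  exact: continuous_measurable_fun.
Qed.

Let K : set (measurableTypeR R * measurableTypeR R) := `[p, q] `*` `[0, 1].

Let mK : measurable K. Proof. by apply: measurableX. Qed.

Let integrable_bound (C : R) : leb2.-integrable strip (EFin \o (fun z => C * \1_K z)).
Proof.
have h := @integrableZl _ _ _ leb2 _ measurable_strip C (fun z => (\1_K z)%:E).
apply: h.
apply: (integrableS measurableT); [exact: measurable_strip|by []|].
apply/integrableP; split; first exact/measurable_EFinP.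
rewrite (eq_integral (fun z => (\1_K z)%:E)).
  by rewrite integral_indic// setIT /K leb2_rectangle ?ltry.
by move=> z _; rewrite gee0_abs// lee_fin.
Qed.

Let Rintegral_bound (C : R) : 0 <= C ->
  \int[leb2]_(z in strip) (C * \1_K z) <= C * (q - p).
Proof.
move=> C0.
have I1 : leb2.-integrable strip (EFin \o \1_K).
  by have := integrable_bound 1; under eq_fun do rewrite mul1r.
rewrite RintegralZl//; last exact: measurable_strip.
rewrite ler_wpM2l// /Rintegral integral_indic//; last exact: measurable_strip.
rewrite -[leRHS]/(fine (q - p)%:E) fine_le//.
- rewrite ge0_fin_numE//; apply: (@le_lt_trans _ _ (leb2 K)).
    by apply: le_measure => //; rewrite inE//; apply: measurableI => //; exact: measurable_strip.
  by rewrite /K leb2_rectangle ?ltry.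
- apply: (@le_trans _ _ (leb2 K)).
    by apply: le_measure => //; rewrite inE//; apply: measurableI => //; exact: measurable_strip.
  by rewrite /K leb2_rectangle// subr0 mulr1.
Qed.

Let ae_bound (CS Cb Ck : R) : 0 <= CS -> 0 <= Cb -> 0 <= Ck ->
  {ae leb2, forall z, strip z -> `|S (u z)| <= CS} ->
  (forall t, p <= t <= q -> `|b t| <= Cb) -> (forall x, 0 <= x <= 1 -> `|k x| <= Ck) ->
  {ae leb2, forall z, strip z -> `|test_integrand z| <= CS * Cb * Ck * \1_K z}.
Proof.
move=> CS0 Cb0 Ck0 hS hb hk; apply: aeS hS => -[t x] /= h sz.
have [_ /= x01] := sz.
rewrite /test_integrand /= indicE.
have [tpq|tpq] := pselect (`[p, q]%classic t); last first.
  by rewrite b0// mulr0 mul0r normr0 mulr_ge0// !mulr_ge0.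
rewrite mem_set ?mulr1; last by split.
rewrite !normrM ler_pM ?mulr_ge0// ?ler_pM//; first exact: h.
  exact: hb.
exact: hk.
Qed.

(** The function u enters the bound only through CS, so the estimate is uniform over any family of u
    for which S(u) is uniformly bounded. *)
Lemma test_integral_le (CS Cb Ck : R) : 0 <= CS -> 0 <= Cb -> 0 <= Ck ->
  {ae leb2, forall z, strip z -> `|S (u z)| <= CS} ->
  (forall t, p <= t <= q -> `|b t| <= Cb) -> (forall x, 0 <= x <= 1 -> `|k x| <= Ck) ->
  `|\int[leb2]_(z in strip) test_integrand z| <= CS * Cb * Ck * (q - p).
Proof.
move=> CS0 Cb0 Ck0 hS hb hk.
apply: (@le_trans _ _ (\int[leb2]_(z in strip) (CS * Cb * Ck * \1_K z))).
  apply: ae_normr_Rintegral_le; first exact: measurable_strip.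
  - exact: measurable_test_integrand.
  - exact: integrable_bound.
  - exact: ae_bound.
by apply: Rintegral_bound; rewrite !mulr_ge0.
Qed.

Lemma integrable_test : leb2.-integrable strip (EFin \o test_integrand).
Proof.
have [CS CS0 hS] := continuous_bounded S (- M) M cS.
have [Cb Cb0 hb] := continuous_bounded b p q cb.
have [Ck Ck0 hk] := continuous_bounded k 0 1 ck.
apply: (ae_le_integrable _ _ _ leb2 _ measurable_strip _ (fun z => CS * Cb * Ck * \1_K z)).
- exact: measurable_test_integrand.
- exact: integrable_bound.
- apply: ae_bound => //; apply: aeS uM => z /= h /h; rewrite ler_norml; exact: hS.
Qed.

End TestIntegrals.

(** * The entropy inequality for tensor products *)

Lemma Lp_onoo_bounded d (T : measurableType d) (R : realType)
    (mu : {measure set T -> \bar R}) (D : set T) (f : T -> R) :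
  measurable D -> Lp_on mu +oo%E D f ->
  measurable_fun D f /\ exists M, {ae mu, forall x, D x -> `|f x| <= M}.
Proof.
move=> mD fL; split.
  by apply/measurable_restrictT => //; have /sub_Lfun_mfun := fL; rewrite inE.
have /sub_Lfun_finLfun := fL; rewrite inE /= /finite_norm unlock /=.
(* If the whole space is null, the essential supremum norm carries no information, but every bound
   then holds almost everywhere. *)
case: ifPn => [_|]; last first.
  rewrite -leNgt => mu0 _; exists 0; exists setT; split=> //.
  by apply/eqP; rewrite eq_le mu0 measure_ge0.
move=> fin.
have [M hM] : exists M : R, (ess_sup mu (abse \o (EFin \o f \_ D)) <= M%:E)%E.
  case: (ess_sup _ _) fin => [r _|//|_]; first by exists r.
  by exists 0; rewrite leNye.
exists M; have /ess_supP := hM; apply: aeS => x /= h Dx.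
by move: h; rewrite patchE mem_set// lee_fin.
Qed.

Section TensorEntropy.
Context {R : realType}.
Local Notation strip := (@strip R).
Local Notation leb2 := (@leb2 R).
Local Notation leb := (@leb R).
Variables (J : R -> R) (eps : R) (u0 : R -> R) (u : R * R -> R) (M : R).
Hypothesis eps_gt0 : 0 < eps.
Hypothesis mu : measurable_fun (strip : set (measurableTypeR R * measurableTypeR R))
  (u : measurableTypeR R * measurableTypeR R -> measurableTypeR R).
Hypothesis uM : {ae leb2, forall z, strip z -> `|u z| <= M}.
Hypothesis mu0 : measurable_fun (`[0, 1]%classic : set (measurableTypeR R)) (u0 : R -> measurableTypeR R).
Hypothesis ent : entropy_inequality J eps u0 u.
Variables (beta : R -> R) (p q : R).
Hypotheses (pq : p <= q) (beta_smooth : forall k, Ck k beta) (beta_ge0 : forall t, 0 <= beta t)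
  (beta0 : forall t, ~ `[p, q]%classic t -> beta t = 0).

(** For 0 <= a < b <= 1 the derivative of the ramp is a nonnegative kernel of mass one living on
    [a, b]. This is thus an average over x in [a, b] of the time-weighted flux, standing in for
    values at single points. *)
Definition flux_integral (F : R -> R) (a b : R) : R :=
  \int[leb2]_(z in strip) test_integrand u F beta (derive1 (ramp a b)) z.

(** A plateau that rises on [a, b] and falls on [c, d]. Its derivative is a difference of two
    kernels of mass one, so the entropy inequality compares two flux averages. *)
Definition gate (a b c d x : R) : R := ramp a b x - ramp c d x.

Lemma Ck_gate (a b c d : R) k : a < b -> c < d -> Ck k (gate a b c d).
Proof.
by move=> ab cd; exact: CkD k _ _ (Ck_ramp a b k) (CkN k _ (Ck_ramp c d k)).
Qed.

Lemma derive_gate (a b c d : R) : a < b -> c < d ->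
  derive1 (gate a b c d) = fun x => derive1 (ramp a b) x - derive1 (ramp c d) x.
Proof.
move=> ab cd; have d1 := CkS_is_derive _ _ (Ck_ramp a b 1).
have d2 := CkS_is_derive _ _ (Ck_ramp c d 1).
have h x : is_derive x (1 : R) (gate a b c d) (derive1 (ramp a b) x - derive1 (ramp c d) x).
  exact: is_deriveB (d1 x) (d2 x).
by have [_] := is_derive_derive1 _ _ h.
Qed.

Lemma gate_bounds (a b c d x : R) : a < b -> b <= c -> c < d -> 0 <= gate a b c d x <= 1.
Proof.
move=> ab bc cd; rewrite /gate.
have [xc|cx] := leP x c.
  by rewrite (ramp_le c d cd)// subr0 ramp_ge0 ramp_le1.
rewrite (ramp_ge a b ab x); last by lra.
by have := ramp_ge0 c d x; have := ramp_le1 c d x; lra.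
Qed.

Lemma gate_eq0 (a b c d x : R) : a < b -> b <= c -> c < d ->
  ~ `[a, d]%classic x -> gate a b c d x = 0.
Proof.
move=> ab bc cd /= h; rewrite /gate.
have [xa|ax] := leP x a; first by rewrite !ramp_le ?subrr//; lra.
have [xd|dx] := leP x d; first by case: h; rewrite in_itv /= (ltW ax).
by rewrite !ramp_ge ?subrr//; lra.
Qed.

Lemma derive1_beta0 t : ~ `[p, q]%classic t -> derive1 beta t = 0.
Proof.
move=> h; rewrite derive1E.
rewrite (@near_eq_derive _ _ _ _ (cst 0)) ?derive_cst//.
have oC : open (~` `[p, q]%classic : set R) by apply: closed_openC; exact: interval_closed.
by apply: filterS (open_nbhs_nbhs (conj oC h)) => x /= /beta0.
Qed.

Let cbeta : continuous beta. Proof. exact: Ck_continuous 0 _ (beta_smooth 0). Qed.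
Let cdbeta : continuous (derive1 beta). Proof. by have [_] := beta_smooth 1. Qed.
Let cdramp (a b : R) : continuous (derive1 (ramp a b)).
Proof. by have [_] := Ck_ramp a b 1. Qed.

Lemma tensor_entropy_inequality (S F : R -> R) (a b c d : R) : lax_pair J S F ->
  0 < a -> a < b -> b <= c -> c < d -> d < 1 ->
  0 <= eps * \int[leb2]_(z in strip) test_integrand u S (derive1 beta) (gate a b c d) z
    + (flux_integral F a b - flux_integral F c d)
    + eps * \int[leb]_(x in `[0, 1]) (S (u0 x) * (beta 0 * gate a b c d x)).
Proof.
move=> lSF a0 ab bc cd d1.
have [cS2 cF2 _ _] := lSF.
have cS := Ck_continuous _ _ cS2; have cF := Ck_continuous _ _ cF2.
have cg := Ck_continuous 0 _ (Ck_gate a b c d 0 ab cd).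
have st : smooth_test (tensor beta (gate a b c d)).
  apply: (smooth_test_tensor _ _ p q a d) => //.
  - by move=> k; exact: Ck_gate.
  - by move=> x; exact: gate_eq0.
have t0 z : 0 <= tensor beta (gate a b c d) z.
  by rewrite mulr_ge0//; have /andP[] := gate_bounds a b c d z.2 ab bc cd.
have I1 : leb2.-integrable strip (EFin \o test_integrand u S (derive1 beta) (gate a b c d)).
  exact: (integrable_test u M mu uM S _ _ p q cS cdbeta cg pq derive1_beta0).
have I2 (a' b' : R) : leb2.-integrable strip (EFin \o test_integrand u F beta (derive1 (ramp a' b'))).
  exact: (integrable_test u M mu uM F _ _ p q cF cbeta (cdramp _ _) pq beta0).
have mst := @measurable_strip R.
have := ent S F lSF _ st t0.
rewrite partial1_tensor ?partial2_tensor; [|exact: Ck_gate|exact: beta_smooth].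
rewrite derive_gate//.
rewrite (_ : \int[leb2]_(z in strip) _ =
  eps * (\int[leb2]_(z in strip) test_integrand u S (derive1 beta) (gate a b c d) z)
    + (flux_integral F a b - flux_integral F c d))//.
rewrite /flux_integral -RintegralB// -RintegralZl// -RintegralD//; last 2 first.
- have h := integrableZl mst eps I1; exact: h.
- have h := integrableB mst (I2 a b) (I2 c d); exact: h.
apply: eq_Rintegral => z _; rewrite /test_integrand /tensor.
move: (S (u z)) (F (u z)) (derive1 beta z.1) (beta z.1) (gate a b c d z.2)
  (derive1 (ramp a b) z.2) (derive1 (ramp c d) z.2) => *; ring.
Qed.

Lemma initial_term_le (S : R -> R) (CS a b c d : R) : continuous S -> 0 <= CS ->
  a < b -> b <= c -> c < d ->
  {ae leb, forall x, `[0, 1]%classic x -> `|S (u0 x)| <= CS} ->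
  \int[leb]_(x in `[0, 1]) (S (u0 x) * (beta 0 * gate a b c d x)) <= CS * beta 0.
Proof.
move=> cS CS0 ab bc cd hS.
apply: le_trans (ler_norm _) _.
apply: (@le_trans _ _ (\int[leb]_(x in `[0, 1]) (CS * beta 0))).
  apply: ae_normr_Rintegral_le => //.
  - apply: measurable_funM.
      by apply: measurableT_comp mu0; exact: continuous_measurable_fun.
    apply: measurable_funM => //; apply: measurable_funTS.
    exact: continuous_measurable_fun (Ck_continuous 0 _ (Ck_gate a b c d 0 ab cd)).
  - apply: measurable_bounded_integrable => //.
      by rewrite /leb /= lebesgue_measure_itv /= lte_fin ltr01 -EFinB ltry.
    by exists `|CS * beta 0|; split; [exact: num_real|move=> y h x _ /=; exact: ltW].
  - apply: aeS hS => x /= h /h hx.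
    have /andP[g0 g1] := gate_bounds a b c d x ab bc cd.
    rewrite !normrM (ger0_norm (beta_ge0 0)) (ger0_norm g0).
    by rewrite ler_pM ?mulr_ge0// ler_piMr.
rewrite Rintegral_cst// /leb /= lebesgue_measure_itv /= lte_fin ltr01.
by rewrite -EFinB /= subr0 mulr1.
Qed.

(** The factor eps multiplies both the term with the time derivative of beta and the initial term.
    The bound does not involve the widths of the layers [a, b] and [c, d], because the gate itself
    stays between 0 and 1 however steep it is. *)
Lemma flux_transport (S F : R -> R) (CS Cb a b c d : R) : lax_pair J S F ->
  0 <= CS -> {ae leb2, forall z, strip z -> `|S (u z)| <= CS} ->
  {ae leb, forall x, `[0, 1]%classic x -> `|S (u0 x)| <= CS} ->
  0 <= Cb -> (forall t, p <= t <= q -> `|derive1 beta t| <= Cb) ->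
  0 < a -> a < b -> b <= c -> c < d -> d < 1 ->
  flux_integral F c d <= flux_integral F a b + eps * (CS * Cb * (q - p) + CS * beta 0).
Proof.
move=> lSF CS0 hS hS0 Cb0 hb a0 ab bc cd d1.
have [cS2 cF2 _ _] := lSF.
have cS := Ck_continuous _ _ cS2.
have := tensor_entropy_inequality S F a b c d lSF a0 ab bc cd d1.
have := initial_term_le S CS a b c d cS CS0 ab bc cd hS0.
have := test_integral_le u mu S (derive1 beta) (gate a b c d) p q cS cdbeta
  (Ck_continuous 0 _ (Ck_gate a b c d 0 ab cd)) pq derive1_beta0 CS Cb 1 CS0 Cb0 ler01 hS hb.
have hg x : 0 <= x <= 1 -> `|gate a b c d x| <= 1.
  by move=> _; have /andP[g0 g1] := gate_bounds a b c d x ab bc cd; rewrite ger0_norm.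
move=> /(_ hg) /(le_trans (ler_norm _)); rewrite mulr1.
set X := (\int[leb2]_(z in _) _); set Y := (\int[leb]_(x in _) _) => h1 h2.
have h1' : eps * X <= eps * (CS * Cb * (q - p)) by rewrite ler_pM2l.
have h2' : eps * Y <= eps * (CS * beta 0) by rewrite ler_pM2l.
rewrite mulrDr; move: h1' h2'.
move: (eps * X) (eps * Y) (flux_integral F a b) (flux_integral F c d)
  (eps * (CS * Cb * (q - p))) (eps * (CS * beta 0)) => *; lra.
Qed.

(** The boundary conditions speak of the time integral G at single x, the entropy inequality of a
    double integral. Since k may vanish, measurability of G and integrability of almost all sections
    are read off the instance k = 1; the factor k x is then pulled out of the inner integral. *)
Lemma flux_fubini (F k : R -> R) : continuous F -> continuous k ->
  let G x := \int[leb]_(t in `[0, +oo[) (F (u (t, x)) * beta t) in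
  leb.-integrable `[0, 1] (fun x => (G x * k x)%:E) /\
  \int[leb2]_(z in strip) test_integrand u F beta k z = \int[leb]_(x in `[0, 1]) (G x * k x).
Proof.
move=> cF ck G.
have mst := @measurable_strip R.
pose one : R -> R := cst 1.
have cst1 : continuous one by exact: cst_continuous.
pose sect x : R -> R := (fun t : R => F (u (t, x)) * beta t) \_ `[0, +oo[.
pose f (k : R -> R) := (EFin \o test_integrand u F beta k) \_ strip.
have If k' : continuous k' ->
    ((@lebesgue_measure R) \x (@lebesgue_measure R))%E.-integrable setT (f k').
  move=> ck'; apply/(integrable_mkcond _ mst).
  exact: (integrable_test u M mu uM F _ _ p q cF cbeta ck' pq beta0).
have secE x : `[0, 1]%classic x -> forall k' t, f k' (t, x) =
    (sect x t * k' x)%:E.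
  move=> x01 k' t; rewrite /f /sect !patchE.
  have [t0|t0] := pselect (`[0, +oo[%classic t).
    by rewrite !mem_set//; split.
  rewrite memNset//; last by move=> -[].
  by rewrite memNset// mul0r.
have GE x : `[0, 1]%classic x -> fubini_G lebesgue_measure (f one) x = (\int[lebesgue_measure]_t (sect x t)%:E)%E.
  by move=> x01; apply: eq_integral => t _; rewrite secE// /one /cst /= mulr1.
have Gfine x : `[0, 1]%classic x -> G x = fine (fubini_G lebesgue_measure (f one) x).
  by move=> x01; rewrite GE// /G Rintegral_mkcond.
have mG : measurable_fun (`[0, 1]%classic : set (measurableTypeR R)) G.
  apply: (eq_measurable_fun (fun x => fine (fubini_G lebesgue_measure (f one) x))).
    by move=> x; rewrite inE => /Gfine.
  apply: measurable_funTS; apply: measurableT_comp; first exact: fine_measurable.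
  exact: measurable_fubini_G (If _ cst1).
have mGk : measurable_fun (`[0, 1]%classic : set (measurableTypeR R)) (fun x => G x * k x).
  apply: measurable_funM => //; apply: measurable_funTS; exact: continuous_measurable_fun.
have aeE : ae_eq (@lebesgue_measure R) setT (fubini_G lebesgue_measure (f k))
    ((fun x => (G x * k x)%:E) \_ `[0, 1]).
  have := ae_integrable2 (If _ cst1); apply: aeS => x /= Ix _.
  rewrite patchE; case: ifPn => [/set_mem x01|]; last first.
    move=> /negP x01; apply: integral0_eq => t _; rewrite /f patchE memNset//.
    by move=> -[_ /mem_set].
  rewrite Gfine// /fubini_G.
  have Ix' : lebesgue_measure.-integrable setT (EFin \o sect x).
    by apply: eq_integrable Ix => // t _; rewrite secE// /one /cst /= mulr1.
  have -> : (\int[lebesgue_measure]_t f one (t, x))%E = (\int[lebesgue_measure]_t (EFin \o sect x) t)%E.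
    exact: GE.
  have -> : (\int[lebesgue_measure]_t f k (t, x))%E =
      (\int[lebesgue_measure]_t ((k x)%:E * (EFin \o sect x) t))%E.
    by apply: eq_integral => t _; rewrite secE// -EFinM mulrC.
  rewrite integralZl// -[X in (_ * X)%E](fineK (integrable_fin_num measurableT Ix')).
  by rewrite -EFinM mulrC.
have IG : lebesgue_measure.-integrable setT (fubini_G lebesgue_measure (f k)).
  have /integrableP[mfk _] := If _ ck.
  apply/integrableP; split; first exact: measurable_fubini_G (If _ ck).
  have hfin := (integrable21ltyP lebesgue_measure lebesgue_measure mfk).1 (If _ ck).
  apply: le_lt_trans hfin.
  apply: ge0_le_integral => //.
  - by apply: measurableT_comp => //; exact: measurable_fubini_G (If _ ck).
  - apply: (@measurable_fun_fubini_tonelli_G _ _ _ _ R lebesgue_measure (abse \o f k)).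
      exact: measurableT_comp.
    by move=> z; exact: abse_ge0.
  - by move=> x _; apply: le_abse_integral => //; exact: measurableT_comp.
have mres : measurable_fun setT ((fun x : measurableTypeR R => (G x * k x)%:E) \_ `[0, 1]).
  have h := (measurable_EFinP _ _).2 mGk.
  apply/(measurable_restrictT _ _).1; [exact: measurable_itv|exact: h].
have IR : lebesgue_measure.-integrable setT ((fun x => (G x * k x)%:E) \_ `[0, 1]).
  apply/integrableP; split=> //.
  have /integrableP[mI +] := IG; apply: le_lt_trans.
  apply: ae_ge0_le_integral => //.
  - exact: measurableT_comp.
  - exact: measurableT_comp.
  - by apply: aeS aeE => x /= h _; rewrite h.
split; first by apply/integrable_mkcond.
rewrite /Rintegral integral_mkcond /leb2 -(integral21_prod_meas1 (If _ ck)).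
rewrite [in RHS]integral_mkcond; congr fine.
apply: ae_eq_integral => //; by have /integrableP[] := IG.
Qed.

End TensorEntropy.

(** * Boundary limits and interior estimates *)

Section RampKernel.
Context {R : realType}.
Variables (a b : R).
Hypothesis ab : a < b.

Lemma derive_step_eq0 (y : R) : y <= 0 \/ 1 <= y -> derive1 step y = 0.
Proof.
move=> h; rewrite derive1E (@derive_val _ _ _ _ _ _ _ (is_derive_step y)).
case: h => h; first by rewrite !(flat_le0 _ y)// !mul0r addr0 mul0r.
by rewrite !(flat_le0 _ (1 - y)) ?subr_le0// !mulr0 addr0 mul0r.
Qed.

Lemma derive_rampE x : derive1 (ramp a b) x = derive1 step ((x - a) / (b - a)) / (b - a).
Proof. by rewrite derive1E (@derive_val _ _ _ _ _ _ _ (is_derive_ramp a b x)). Qed.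

Lemma derive_ramp_ge0 x : 0 <= derive1 (ramp a b) x.
Proof. exact: ramp_derive_ge0. Qed.

Lemma derive_ramp_gt0 x : a < x < b -> 0 < derive1 (ramp a b) x.
Proof.
move=> /andP[ax xb]; rewrite derive_rampE divr_gt0 ?subr_gt0// derive_step_gt0//.
by rewrite divr_gt0 ?subr_gt0//= ltr_pdivrMr ?subr_gt0// mul1r ltrD2r.
Qed.

Lemma derive_ramp_eq0 x : ~~ (a < x < b) -> derive1 (ramp a b) x = 0.
Proof.
rewrite negb_and -!leNgt => h; rewrite derive_rampE derive_step_eq0 ?mul0r//.
case/orP: h => h; [left|right].
  by rewrite mulr_le0_ge0// ?subr_le0// invr_ge0 subr_ge0 ltW.
by rewrite ler_pdivlMr ?subr_gt0// mul1r lerD2r.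
Qed.

Lemma continuous_derive_ramp : continuous (derive1 (ramp a b)).
Proof. by have [_] := Ck_ramp a b 1. Qed.

Let integrable_kernel : (@leb R).-integrable `[0, 1] (EFin \o derive1 (ramp a b)).
Proof.
apply: continuous_compact_integrable; first exact: segment_compact.
exact/continuous_subspaceT/continuous_derive_ramp.
Qed.

Lemma integrable_derive_ramp (C : R) :
  (@leb R).-integrable `[0, 1] (fun x => (C * derive1 (ramp a b) x)%:E).
Proof.
have h := integrable_kernel.
have m01 : measurable (`[0, 1]%classic : set (measurableTypeR R)) by exact: measurable_itv.
have h2 := integrableZl m01 C h; exact: h2.
Qed.

Lemma Rintegral_derive_ramp (C : R) : 0 <= a -> b <= 1 ->
  \int[@leb R]_(x in `[0, 1]) (C * derive1 (ramp a b) x) = C.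
Proof.
move=> a0 b1; rewrite RintegralZl//.
have c := Ck_continuous 0 _ (Ck_ramp a b 0).
have h : (\int[@lebesgue_measure R]_(x in `[0%R, 1%R]) (derive1 (ramp a b) x)%:E = (ramp a b 1)%:E - (ramp a b 0)%:E)%E.
  apply: continuous_FTC2 => //; first exact/continuous_subspaceT/continuous_derive_ramp.
  split.
  - by move=> x _; have [] := is_derive_ramp a b x.
  - exact/cvg_at_right_filter/c.
  - exact/cvg_at_left_filter/c.
rewrite /Rintegral /leb h ramp_ge// (ramp_le a b ab)//= subr0 mulr1//.
Qed.

End RampKernel.

Lemma C0_test_support (R : realType) (b : R -> R) (p q : R) : continuous b ->
  (forall t, ~ `[p, q]%classic t -> b t = 0) -> C0_test b.
Proof.
move=> cb b0; split=> //.
apply: (@subclosed_compact _ _ `[p, q]%classic); [exact: closed_closure|exact: segment_compact|].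
exact: supp_subset (interval_closed _ _) b0.
Qed.

Section BoundaryLimits.
Context {R : realType}.
Local Notation strip := (@strip R).
Local Notation leb2 := (@leb2 R).
Local Notation leb := (@leb R).
Variables (J : R -> R) (eps : R) (rhom rhop u0 : R -> R) (u : R * R -> R) (M : R).
Hypothesis eps_gt0 : 0 < eps.
Hypothesis mu : measurable_fun (strip : set (measurableTypeR R * measurableTypeR R))
  (u : measurableTypeR R * measurableTypeR R -> measurableTypeR R).
Hypothesis uM : {ae leb2, forall z, strip z -> `|u z| <= M}.
Hypothesis mu0 : measurable_fun (`[0, 1]%classic : set (measurableTypeR R)) (u0 : R -> measurableTypeR R).
Hypothesis ent : entropy_inequality J eps u0 u.
Hypothesis bnd : boundary_conditions J rhom rhop u.
Variables (beta : R -> R) (p q : R).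
Hypotheses (pq : p <= q) (beta_smooth : forall k, Ck k beta) (beta_ge0 : forall t, 0 <= beta t)
  (beta0 : forall t, ~ `[p, q]%classic t -> beta t = 0).
Variables (W : set R) (S F : R -> R).
Hypothesis family : boundary_family J W S F.

Let cF : continuous F.
Proof. by have [[_ c _ _] _] := family; exact: Ck_continuous c. Qed.

Let G x := \int[leb]_(t in `[0, +oo[) (F (u (t, x)) * beta t).

Let test_beta : C0_test beta.
Proof. exact: C0_test_support (Ck_continuous 0 _ (beta_smooth 0)) beta0. Qed.

(** Where beta does not vanish the datum lies in W, so Q(., rhom t) is F and the time integral in
    the boundary condition is G. Hence G x <= e for almost all x in ]0, d[, and averaging against a
    kernel of mass one keeps the bound. The layer starts at r > 0 because test functions must vanish
    near x = 0. *)
Lemma flux_left : (forall t, 0 <= t -> beta t != 0 -> W (rhom t)) ->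
  forall e, 0 < e -> exists2 d, 0 < d &
    forall r, 0 < r -> 2 * r < d -> 2 * r <= 1 -> flux_integral u beta F r (2 * r) <= e.
Proof.
move=> Wb e e0; have [_ [Q bQ QF]] := family.
have [[l lim l0] _] := bnd Q bQ beta test_beta beta_ge0.
have [d d0 hd] := lim e e0; exists d => // r r0 rd r1.
have rr : r < 2 * r by lra.
rewrite /flux_integral; have [IG ->] := flux_fubini u M mu uM beta p q pq beta_smooth beta0 F _ cF
  (continuous_derive_ramp r (2 * r)).
rewrite -[leRHS](Rintegral_derive_ramp r (2 * r) rr e (ltW r0) r1).
apply: ae_le_Rintegral; [by []|exact: IG|exact: integrable_derive_ramp|].
apply: aeS hd => x hx _; have [xr|/derive_ramp_eq0 ->] := boolP (r < x < 2 * r); last first.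
- by [].
- by rewrite !mulr0.
have /hx : 0 < x < d by case/andP: xr => h1 h2; apply/andP; split; lra.
rewrite (_ : \int[leb]_(t in _) _ = G x); last first.
  apply: eq_Rintegral => t; rewrite inE /= in_itv /= andbT => t0.
  by have [->|bt] := eqVneq (beta t) 0; [rewrite !mulr0|rewrite QF//; exact: Wb].
move=> h; rewrite ler_wpM2r ?derive_ramp_ge0//.
by have := ler_norm (G x - l); rewrite -/(G x); move: h l0; lra.
Qed.

Lemma flux_right : (forall t, 0 <= t -> beta t != 0 -> W (rhop t)) ->
  forall e, 0 < e -> exists2 d, 0 < d &
    forall r, 0 < r -> 2 * r < d -> 2 * r <= 1 ->
      - e <= flux_integral u beta F (1 - 2 * r) (1 - r).
Proof.
move=> Wb e e0; have [_ [Q bQ QF]] := family.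
have [_ [l lim l0]] := bnd Q bQ beta test_beta beta_ge0.
have [d d0 /ae_reflect hd] := lim e e0; exists d => // r r0 rd r1.
have rr : 1 - 2 * r < 1 - r by lra.
rewrite /flux_integral; have [IG ->] := flux_fubini u M mu uM beta p q pq beta_smooth beta0 F _ cF
  (continuous_derive_ramp (1 - 2 * r) (1 - r)).
have h1 : 0 <= 1 - 2 * r by lra.
have h2 : 1 - r <= 1 by lra.
rewrite -(Rintegral_derive_ramp _ _ rr (- e) h1 h2).
apply: ae_le_Rintegral; [by []|exact: integrable_derive_ramp|exact: IG|].
apply: aeS hd => x hx _.
have [xr|/derive_ramp_eq0 ->] := boolP (1 - 2 * r < x < 1 - r); last first.
- by [].
- by rewrite !mulr0.
have /hx : 0 < 1 - x < d by case/andP: xr => h3 h4; apply/andP; split; lra.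
rewrite (_ : 1 - (1 - x) = x); last by ring.
rewrite (_ : \int[leb]_(t in _) _ = G x); last first.
  apply: eq_Rintegral => t; rewrite inE /= in_itv /= andbT => t0.
  by have [->|bt] := eqVneq (beta t) 0; [rewrite !mulr0|rewrite QF//; exact: Wb].
move=> h; rewrite ler_wpM2r ?derive_ramp_ge0//.
by have := ler_norm (- (G x - l)); rewrite normrN -/(G x); move: h l0; lra.
Qed.

Section InteriorEstimates.
Variables (CS Cb y : R).
Hypotheses (CS0 : 0 <= CS) (hS : {ae leb2, forall z, strip z -> `|S (u z)| <= CS})
  (hS0 : {ae leb, forall x, `[0, 1]%classic x -> `|S (u0 x)| <= CS})
  (Cb0 : 0 <= Cb) (hb : forall t, p <= t <= q -> `|derive1 beta t| <= Cb)
  (y0 : 0 < y) (y12 : 2 * y < 1).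

Let lSF : lax_pair J S F. Proof. by case: family. Qed.

(** Transport from the layer [r, 2r] to the wide layer [y, 1 - y]. The choice of r depends on e and
    on the solution, but the transport constant does not, so letting e tend to 0 leaves a pure
    O(eps) bound. *)
Lemma interior_flux_le : (forall t, 0 <= t -> beta t != 0 -> W (rhom t)) ->
  flux_integral u beta F y (1 - y) <= eps * (CS * Cb * (q - p) + CS * beta 0).
Proof.
move=> Wb; apply/ler_addgt0Pl => e e0.
have [d d0 hd] := flux_left Wb e e0.
have [r [r0 ry rd]] : exists r : R, [/\ 0 < r, r <= y / 2 & r <= d / 4].
  exists (Num.min (y / 2) (d / 4)).
  by rewrite lt_min !divr_gt0// !ge_min !lexx orbT.
have h1 : r < 2 * r by lra.
have h2 : 2 * r <= y by lra.
have h3 : y < 1 - y by rewrite ltrBrDr -mulr2n -mulr_natl.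
have h4 : 1 - y < 1 by rewrite ltrBlDr ltrDl.
have h5 : 2 * r < d by lra.
have h6 : 2 * r <= 1 by lra.
have h := flux_transport J eps u0 u M eps_gt0 mu uM mu0 ent beta p q pq beta_smooth beta_ge0 beta0
  S F CS Cb r (2 * r) y (1 - y) lSF CS0 hS hS0 Cb0 hb r0 h1 h2 h3 h4.
by apply: (le_trans h); rewrite lerD2r; exact: hd.
Qed.

Lemma interior_flux_ge : (forall t, 0 <= t -> beta t != 0 -> W (rhop t)) ->
  - (eps * (CS * Cb * (q - p) + CS * beta 0)) <= flux_integral u beta F y (1 - y).
Proof.
move=> Wb; rewrite lerNl; apply/ler_addgt0Pl => e e0.
have [d d0 hd] := flux_right Wb e e0.
have [r [r0 ry rd]] : exists r : R, [/\ 0 < r, r <= y / 2 & r <= d / 4].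
  exists (Num.min (y / 2) (d / 4)).
  by rewrite lt_min !divr_gt0// !ge_min !lexx orbT.
have h2 : y < 1 - y by rewrite ltrBrDr -mulr2n -mulr_natl.
have h3 : 1 - y <= 1 - 2 * r by lra.
have h4 : 1 - 2 * r < 1 - r by lra.
have h5 : 1 - r < 1 by lra.
have h6 : 2 * r < d by lra.
have h7 : 2 * r <= 1 by lra.
have := flux_transport J eps u0 u M eps_gt0 mu uM mu0 ent beta p q pq beta_smooth beta_ge0 beta0
  S F CS Cb y (1 - y) (1 - 2 * r) (1 - r) lSF CS0 hS hS0 Cb0 hb y0 h2 h3 h4 h5.
have := hd r r0 h6 h7.
move: (flux_integral u beta F (1 - 2 * r) (1 - r)) (flux_integral u beta F y (1 - y))
  (eps * _) => *; lra.
Qed.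

End InteriorEstimates.

End BoundaryLimits.

(** * Maximum principle *)

Lemma ae_forall_nat d (T : measurableType d) (R : realType) (mu : {measure set T -> \bar R})
    (P : nat -> T -> Prop) : (forall n, {ae mu, forall x, P n x}) ->
  {ae mu, forall x, forall n, P n x}.
Proof.
move=> h; have hN := @negligible_bigcup _ _ _ mu (fun n => ~` [set x | P n x]) h.
apply: negligibleS hN => x /= /existsNP[n Pn]; by exists n.
Qed.

Section MaximumPrinciple.
Context {R : realType}.
Local Notation strip := (@strip R).
Local Notation leb2 := (@leb2 R).
Local Notation leb := (@leb R).
Variables (J : R -> R) (eps : R) (rhom rhop u0 : R -> R) (u : R * R -> R) (M : R).
Hypothesis eps_gt0 : 0 < eps.
Hypothesis mu : measurable_fun (strip : set (measurableTypeR R * measurableTypeR R))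
  (u : measurableTypeR R * measurableTypeR R -> measurableTypeR R).
Hypothesis uM : {ae leb2, forall z, strip z -> `|u z| <= M}.
Hypothesis mu0 : measurable_fun (`[0, 1]%classic : set (measurableTypeR R)) (u0 : R -> measurableTypeR R).
Hypothesis ent : entropy_inequality J eps u0 u.
Hypothesis bnd : boundary_conditions J rhom rhop u.

Section Decreasing.
Variable T : R.
Hypothesis T0 : 0 < T.

(** For t >= -1 the first factor is 1, so on the half-line t >= 0 this decreases from 1 to 0,
    reached at T. The rise takes place on [-2, -1], outside the strip, and only makes the support
    compact. *)
Definition cutoff (t : R) : R := step (t + 2) * (1 - ramp 0 T t).

Lemma Ck_cutoff k : Ck k cutoff.
Proof.
apply: CkM.
  apply: (Ck_comp k step (fun t => t + 2)); first exact: Ck_step.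
  exact: CkD k _ _ (Ck_id k) (Ck_cst k 2).
exact: CkD k _ _ (Ck_cst k 1) (CkN k _ (Ck_ramp 0 T k)).
Qed.

Lemma cutoff_ge0 t : 0 <= cutoff t.
Proof. by rewrite mulr_ge0 ?step_ge0// subr_ge0 ramp_le1. Qed.

Lemma cutoff_eq0 t : ~ `[-2, T]%classic t -> cutoff t = 0.
Proof.
rewrite /= in_itv /= => /negP; rewrite negb_and -!ltNge => /orP[h|h]; rewrite /cutoff.
  by rewrite step_le0E ?mul0r//; lra.
by rewrite ramp_ge ?subrr ?mulr0// ltW.
Qed.

Lemma derive_cutoff t : 0 <= t -> derive1 cutoff t = - derive1 (ramp 0 T) t.
Proof.
move=> t0.
have d1 : is_derive t (1 : R) (fun t : R => step (t + 2)) 0.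
  have h := CkS_is_derive _ _ (Ck_step 1) (t + 2).
  rewrite derive_step_eq0 in h; last by right; lra.
  have h2 := is_deriveD (is_derive_id t (1 : R)) (is_derive_cst (2 : R) t 1).
  by apply: (is_derive_eq (@is_derive1_comp _ step (fun t : R => t + 2) _ _ _ h h2)); rewrite mul0r.
have d2 := is_deriveB (is_derive_cst (1 : R) t 1) (CkS_is_derive _ _ (Ck_ramp 0 T 1) t).
have h := is_deriveM d1 d2.
have e : derive1 cutoff t = step (t + 2) *: (0 - derive1 (ramp 0 T) t) + (1 - ramp 0 T t) *: 0.
  by rewrite derive1E; have [_] := h.
by rewrite e scaler0 addr0 step_ge1E ?scale1r ?sub0r//; lra.
Qed.

End Decreasing.

Variables (W : set R) (S F : R -> R).
Hypothesis family : boundary_family J W S F.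
Hypotheses (Wm : forall t, 0 <= t -> W (rhom t)) (Wp : forall t, 0 <= t -> W (rhop t)).
Hypotheses (S_ge0 : forall v, 0 <= S v)
  (S0 : {ae leb, forall x, `[0, 1]%classic x -> S (u0 x) = 0}).

Let lSF : lax_pair J S F. Proof. by case: family. Qed.
Let cS : continuous S. Proof. by case: lSF => c _ _ _; exact: Ck_continuous c. Qed.

Let box (r : R) := gate r (2 * r) (1 - 2 * r) (1 - r).

(** The support [s, 1 - s] of the narrower box lies inside the plateau [2r, 1 - 2r] of the wider
    one. *)
Let box_le (r s : R) x : 0 < r -> 2 * r <= s -> 4 * s <= 1 -> box s x <= box r x.
Proof.
move=> r0 rs s1.
have s01 : s < 2 * s by lra.
have s02 : 2 * s <= 1 - 2 * s by lra.
have s03 : 1 - 2 * s < 1 - s by lra.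
have r01 : r < 2 * r by lra.
have r02 : 2 * r <= 1 - 2 * r by lra.
have r03 : 1 - 2 * r < 1 - r by lra.
have /andP[g0 g1] := gate_bounds r (2 * r) (1 - 2 * r) (1 - r) x r01 r02 r03.
have [h|h] := pselect (`[s, 1 - s]%classic x); last by rewrite /box gate_eq0.
have /andP[_ le1] := gate_bounds s (2 * s) (1 - 2 * s) (1 - s) x s01 s02 s03.
move: h; rewrite /= in_itv /= => /andP[h1 h2].
apply: le_trans le1 _; rewrite /box /gate ramp_ge//; last by lra.
by rewrite ramp_le//; lra.
Qed.

(** The boundary terms are below e/2 only for boxes whose layers are close enough to the ends. As S
    >= 0 and [cutoff] decreases on t >= 0, the integral for such a wide box is at most the one for
    the fixed box s, which thereby inherits the lower bound -e; then e tends to 0. *)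
Lemma entropy_dissipated (T s : R) : 0 < T -> 0 < s -> 4 * s <= 1 ->
  0 <= \int[leb2]_(z in strip) test_integrand u S (derive1 (cutoff T)) (box s) z.
Proof.
move=> T0 s0 s1.
have pq : -2 <= T by lra.
have cdb : continuous (derive1 (cutoff T)) by have [_] := Ck_cutoff T 1.
have db0 := derive1_beta0 (cutoff T) (-2) T (cutoff_eq0 T T0).
have Ibox r : 0 < r -> 4 * r <= 1 ->
    leb2.-integrable strip (EFin \o test_integrand u S (derive1 (cutoff T)) (box r)).
  move=> r0 r1.
  have r01 : r < 2 * r by lra.
  have r03 : 1 - 2 * r < 1 - r by lra.
  exact: (integrable_test u M mu uM S _ _ (-2) T cS cdb
    (Ck_continuous 0 _ (Ck_gate _ _ _ _ 0 r01 r03)) pq db0).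
rewrite -(pmulr_rge0 _ eps_gt0); apply/ler_addgt0Pr => e e0.
have e20 : 0 < e / 2 by rewrite divr_gt0.
have arith A B C f g : A <= B -> C <= 0 -> 0 <= A + (f - g) + C -> f <= e / 2 ->
    - (e / 2) <= g -> 0 <= B + e :> R by move=> *; lra.
have [d1 d10 hd1] := flux_left J rhom rhop u M mu uM bnd (cutoff T) (-2) T pq
  (Ck_cutoff T) (cutoff_ge0 T) (cutoff_eq0 T T0) W S F family (fun t t0 _ => Wm t t0) _ e20.
have [d2 d20 hd2] := flux_right J rhom rhop u M mu uM bnd (cutoff T) (-2) T pq
  (Ck_cutoff T) (cutoff_ge0 T) (cutoff_eq0 T T0) W S F family (fun t t0 _ => Wp t t0) _ e20.
have [r [r0 rs rd1 rd2]] : exists r : R, [/\ 0 < r, r <= s / 2, r <= d1 / 4 & r <= d2 / 4].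
  exists (Num.min (s / 2) (Num.min (d1 / 4) (d2 / 4))).
  by rewrite !lt_min !divr_gt0// !ge_min !lexx !orbT.
have r2s : 2 * r <= s by lra.
have r41 : 4 * r <= 1 by lra.
have r21 : 2 * r <= 1 by lra.
have h1 : r < 2 * r by lra.
have h2 : 2 * r <= 1 - 2 * r by lra.
have h3 : 1 - 2 * r < 1 - r by lra.
have h4 : 1 - r < 1 by lra.
have h5 : 2 * r < d1 by lra.
have h6 : 2 * r < d2 by lra.
have L := hd1 r r0 h5 r21.
have G := hd2 r r0 h6 r21.
have E := tensor_entropy_inequality J eps u0 u M mu uM ent (cutoff T) (-2) T pq
  (Ck_cutoff T) (cutoff_ge0 T) (cutoff_eq0 T T0) S F r (2 * r) (1 - 2 * r) (1 - r) lSF r0 h1 h2 h3 h4.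
have S00 : {ae leb, forall x, `[0, 1]%classic x -> `|S (u0 x)| <= 0}.
  by apply: aeS S0 => x /= h /h ->; rewrite normr0.
have Y := initial_term_le u0 mu0 (cutoff T) (cutoff_ge0 T) S 0 r (2 * r) (1 - 2 * r) (1 - r)
  cS (lexx 0) h1 h2 h3 S00.
rewrite mul0r in Y.
have X : \int[leb2]_(z in strip) test_integrand u S (derive1 (cutoff T)) (box r) z <=
    \int[leb2]_(z in strip) test_integrand u S (derive1 (cutoff T)) (box s) z.
  apply: le_Rintegral; [exact: measurable_strip|exact: Ibox|exact: Ibox|].
  move=> z [/=]; rewrite in_itv /= andbT => t0 _.
  rewrite /test_integrand derive_cutoff// -!mulrA ler_wpM2l// !mulNr lerN2.
  by rewrite ler_wpM2l ?derive_ramp_ge0//; exact: box_le.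
move: X Y E L G; rewrite -/(box r).
set X := Rintegral _ _ _; set Y := Rintegral _ _ _; set X' := Rintegral _ _ _.
move=> h7 h8.
have h7' : eps * X <= eps * Y by rewrite ler_pM2l.
have h8' : eps * X' <= 0 by rewrite pmulr_rle0.
move=> h9 h10 h11; exact: (arith _ _ _ _ _ h7' h8' h9 h10 h11).
Qed.

(** The integrand in [entropy_dissipated] is nonpositive, so it vanishes almost everywhere, and its
    weight is nonzero for 0 < t < T on the plateau. Countably many choices of T and s exhaust the
    strip up to its edges, which are null. *)
Lemma entropy_vanishes : {ae leb2, forall z, strip z -> S (u z) = 0}.
Proof.
have H (T s : R) : 0 < T -> 0 < s -> 4 * s <= 1 ->
    {ae leb2, forall z, strip z -> 0 < z.1 < T -> 2 * s <= z.2 <= 1 - 2 * s -> S (u z) = 0}.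
  move=> T0 s0 s1.
  have s01 : s < 2 * s by lra.
  have s02 : 2 * s <= 1 - 2 * s by lra.
  have s03 : 1 - 2 * s < 1 - s by lra.
  have pq : -2 <= T by lra.
  have cdb : continuous (derive1 (cutoff T)) by have [_] := Ck_cutoff T 1.
  have I := integrable_test u M mu uM S _ _ (-2) T cS cdb
    (Ck_continuous 0 _ (Ck_gate _ _ _ _ 0 s01 s03)) pq (derive1_beta0 (cutoff T) (-2) T (cutoff_eq0 T T0)).
  have mst := @measurable_strip R.
  have I' := integrableZl mst (-1) I.
  have D := entropy_dissipated T s T0 s0 s1.
  have : {ae leb2, forall z, strip z -> -1 * test_integrand u S (derive1 (cutoff T)) (box s) z = 0}.
    apply: Rintegral_eq0_ae; [exact: mst|exact: I'| |].
      move=> z [/=]; rewrite in_itv /= andbT => t0 _.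
      rewrite mulN1r /test_integrand derive_cutoff// mulrN mulNr opprK.
      by rewrite !mulr_ge0 ?derive_ramp_ge0//; have /andP[] := gate_bounds _ _ _ _ z.2 s01 s02 s03.
    by rewrite RintegralZl// mulN1r oppr_le0.
  apply: aeS => z /= h sz /andP[t0 tT] /andP[x0 x1].
  have := h sz; rewrite /test_integrand derive_cutoff// 1?ltW// /box /gate ramp_ge//.
  rewrite ramp_le// subr0 mulr1 mulN1r mulrN opprK => /eqP; rewrite mulf_eq0 => /orP[/eqP//|/eqP e].
  have : 0 < derive1 (ramp 0 T) z.1 by apply: derive_ramp_gt0 => //; rewrite t0.
  by rewrite e ltxx.
(* The factor 4 ensures 4 * s n <= 1 already for n = 0. *)
pose s n : R := (4 * n.+1%:R)^-1.
have Hn n : {ae leb2, forall z, strip z -> 0 < z.1 < n.+1%:R -> 2 * s n <= z.2 <= 1 - 2 * s n -> S (u z) = 0}.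
  apply: H; [by []|by rewrite invr_gt0 mulr_gt0|].
  by rewrite /s invfM mulrA divff ?mul1r// invf_le1 ?ler1n.
have := aeI _ _ _ _ _ _ (aeI _ _ _ _ _ _ (ae_leb2_vertical 0) (aeI _ _ _ _ _ _ (ae_leb2_horizontal 0) (ae_leb2_horizontal 1))) (ae_forall_nat _ _ _ _ _ Hn).
apply: aeS => z /= [[t0 [x0 x1]] h] sz.
have [] := sz; rewrite /= !in_itv /= andbT => t0' /andP[x0' x1'].
have t_gt0 : 0 < z.1 by rewrite lt_neqAle eq_sym t0.
have x_gt0 : 0 < z.2 by rewrite lt_neqAle eq_sym x0.
have x_lt1 : z.2 < 1 by rewrite lt_neqAle x1.
have [n [n1 n2 n3]] : exists n, [/\ z.1 < n.+1%:R, 2 * s n <= z.2 & 2 * s n <= 1 - z.2].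
  pose b := Num.max z.1 (Num.max z.2^-1 (1 - z.2)^-1).
  have bn : b < (Num.truncn b).+1%:R by exact: Num.Theory.truncnS_gt.
  exists (Num.truncn b).
  have sE : 2 * s (Num.truncn b) <= ((Num.truncn b).+1%:R)^-1.
    rewrite /s invfM mulrA ler_piMl ?invr_ge0//; lra.
  move: bn; rewrite {1}/b !gt_max => /and3P[b1 b2 b3]; split=> //.
    by apply: (le_trans sE); rewrite invf_ple ?posrE//; exact: ltW.
  by apply: (le_trans sE); rewrite invf_ple ?posrE ?subr_gt0//; exact: ltW.
apply: (h n) => //; first by rewrite t_gt0.
by rewrite n2 lerBrDr -lerBrDl.
Qed.

End MaximumPrinciple.

(** The upper entropy with its step on [1, 2] vanishes exactly for v <= 1, the lower one with its
    step on [-1, 0] exactly for v >= 0. Both form boundary families for all data in [0,1], and both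
    vanish on the initial datum. *)
Lemma solution_bounds (R : realType) (J : R -> R) (eps : R) (rhom rhop u0 : R -> R)
    (u : R * R -> R) : Ck 2 J -> 0 < eps ->
  (forall t, 0 <= t -> 0 <= rhom t <= 1) -> (forall t, 0 <= t -> 0 <= rhop t <= 1) ->
  measurable_fun (`[0, 1]%classic : set (measurableTypeR R)) (u0 : R -> measurableTypeR R) ->
  {ae @leb R, forall x, 0 <= x <= 1 -> 0 <= u0 x <= 1} ->
  entropy_solution J eps rhom rhop u0 u ->
  {ae @leb2 R, forall z, @strip R z -> 0 <= u z <= 1}.
Proof.
move=> J2 eps0 hm hp mu0 u01 [uL _ ent bnd].
have [mu [M uM]] := Lp_onoo_bounded _ _ _ _ _ _ measurable_strip uL.
have hu0 : {ae @leb R, forall x, `[0, 1]%classic x -> 0 <= u0 x <= 1}.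
  by apply: aeS u01 => x h; rewrite /= in_itv.
have l12 : (1 : R) < 2 by lra.
have l10 : (-1 : R) < 0 by lra.
have [S [F [S' [F' [[fam [S0 Sp] _ _] _]]]]] := step_pairs J J2 1 2 l12.
have [T [G [T' [G' [_ [fam' [T0 Tp] _ _]]]]]] := step_pairs J J2 (-1) 0 l10.
have hi : {ae @leb2 R, forall z, @strip R z -> S (u z) = 0}.
  apply: (entropy_vanishes J eps rhom rhop u0 u M eps0 mu uM mu0 ent bnd _ S F fam).
  - by move=> t /hm /andP[].
  - by move=> t /hp /andP[].
  - by move=> v; have [/S0 ->//|/Sp/ltW] := leP v 1.
  - by apply: aeS hu0 => x h /h /andP[_ /S0].
have lo : {ae @leb2 R, forall z, @strip R z -> T' (u z) = 0}.
  apply: (entropy_vanishes J eps rhom rhop u0 u M eps0 mu uM mu0 ent bnd _ T' G' fam').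
  - by move=> t /hm /andP[].
  - by move=> t /hp /andP[].
  - by move=> v; have [/T0 ->//|/Tp/ltW] := leP 0 v.
  - by apply: aeS hu0 => x h /h /andP[/T0].
apply: aeS (aeI _ _ _ _ _ _ hi lo) => z [h1 h2] sz; apply/andP; split.
  by rewrite leNgt; apply/negP => /Tp; rewrite h2// ltxx.
by rewrite leNgt; apply/negP => /Sp; rewrite h1// ltxx.
Qed.

(** * Stationary states *)

Section StationaryStates.
Context {R : realType}.
Variables (J : R -> R) (m : R).
Hypotheses (J2 : Ck 2 J) (J_concave : forall x, derive1n 2 J x < 0)
  (J0 : J 0 = 0) (J1 : J 1 = 0) (m01 : 0 < m < 1) (m_max : forall x, x != m -> J x < J m).

Let cJ : continuous J. Proof. exact: Ck_continuous J2. Qed.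
Let incr := flux_incr J m J2 J_concave m_max.
Let decr := flux_decr J m J2 J_concave m_max.

(** J z lies between the common end value 0 and J m, so the intermediate value theorem on the other
    side of m shows that the set from which [star] picks is inhabited. *)
Lemma star_spec z : 0 <= z <= 1 -> z != m ->
  [/\ 0 <= star J m z <= 1, star J m z != m, star J m z != z & J (star J m z) = J z].
Proof.
move=> /andP[z0 z1] zm; have [m0 m1] := andP m01.
have Jz0 : 0 <= J z.
  have [zlt|zgt] := ltP z m.
    move: z0; rewrite le_eqVlt => /predU1P[<-|z0]; first by rewrite J0.
    by rewrite -J0 ltW// incr// ltW.
  move: z1; rewrite le_eqVlt => /predU1P[->|z1]; first by rewrite J1.
  by rewrite -J1 ltW// decr.
have JzM : J z < J m by exact: m_max.
suff [v hv] : exists v, [/\ 0 <= v <= 1, v != m, v != z & J v = J z].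
  rewrite /star (negbTE zm).
  exact: (@xgetPex R m [set v | [/\ 0 <= v <= 1, v != m, v != z & J v = J z]] (ex_intro _ v hv)).
have [zlt|zgt] := ltP z m.
  have [v + Jv] : exists2 v, v \in `[m, 1] & J v = J z.
    apply: (IVT (ltW m1)); first exact: continuous_subspaceT.
    by rewrite J1 ge_min Jz0 orbT le_max (ltW JzM).
  rewrite in_itv /= => /andP[mv v1]; exists v.
  have vm : v != m by apply: contra_eq_neq Jv => ->; rewrite gt_eqF.
  by rewrite (le_trans (ltW m0) mv) v1; split=> //; rewrite gt_eqF// (lt_le_trans zlt).
have mz : m < z by rewrite lt_neqAle eq_sym zm.
have [v + Jv] : exists2 v, v \in `[0, m] & J v = J z.
  apply: (IVT (ltW m0)); first exact: continuous_subspaceT.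
  by rewrite J0 ge_min Jz0 le_max (ltW JzM) orbT.
rewrite in_itv /= => /andP[v0 vm']; exists v.
have vm : v != m by apply: contra_eq_neq Jv => ->; rewrite gt_eqF.
by rewrite v0 (le_trans vm' (ltW m1)); split=> //; rewrite lt_eqF// (le_lt_trans vm').
Qed.

Lemma star_gt z : 0 <= z <= 1 -> z < m -> m < star J m z.
Proof.
move=> z01 zm; have [_ sm sz Js] := star_spec z z01 (negbT (lt_eqF zm)).
rewrite ltNge; apply/negP => /= sm'.
by have [h|h|h] := ltgtP (star J m z) z; [have := incr _ _ h (ltW zm)|have := incr _ _ h sm'|
  by move: sz; rewrite h eqxx]; rewrite Js ltxx.
Qed.

Lemma star_lt z : 0 <= z <= 1 -> m < z -> star J m z < m.
Proof.
move=> z01 mz; have [_ sm sz Js] := star_spec z z01 (negbT (gt_eqF mz)).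
rewrite ltNge; apply/negP => /= sm'.
by have [h|h|h] := ltgtP (star J m z) z; [have := decr _ _ h sm'|have := decr _ _ h (ltW mz)|
  by move: sz; rewrite h eqxx]; rewrite Js ltxx.
Qed.

(** J decreases to the right of m and takes the same value at z and at its conjugate; J (max w m) is
    the maximum of J over v >= w. The right-hand side is open in z and w and measurable along the
    data, which is hard to see from [star]. *)
Lemma lt_starE z w : 0 <= z <= 1 -> z < m -> (w < star J m z) = (J z < J (Num.max w m)).
Proof.
move=> z01 zm; have ms := star_gt z z01 zm.
have [_ _ _ Js] := star_spec z z01 (negbT (lt_eqF zm)).
have [wm|mw] := leP w m.
  by rewrite (le_lt_trans wm ms) m_max// lt_eqF.
rewrite -Js; have [h|h|<-] := ltgtP w (star J m z).
- by rewrite decr// ltW.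
- by apply/esym/negbTE; rewrite -leNgt ltW// decr// ltW.
- by rewrite ltxx.
Qed.

Lemma star_ltE z w : 0 <= z <= 1 -> m < z -> (star J m z < w) = (J z < J (Num.min w m)).
Proof.
move=> z01 mz; have sm := star_lt z z01 mz.
have [_ _ _ Js] := star_spec z z01 (negbT (gt_eqF mz)).
have [wm|mw] := ltP w m; last first.
  by rewrite (lt_le_trans sm mw) m_max// gt_eqF.
rewrite -Js; have [h|h|<-] := ltgtP (star J m z) w.
- by rewrite incr// ltW.
- by apply/esym/negbTE; rewrite -leNgt ltW// incr// ltW.
- by rewrite ltxx.
Qed.

(* The three phases: boundary layer at the right, at the left, at both ends. *)
Definition phase (a b c : R) : Prop :=
  [\/ [/\ a < m, J a < J (Num.max b m) & c = a],
      [/\ m < b, J b < J (Num.min a m) & c = b] |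
      [/\ m <= a, b <= m & c = m]].

(** The only configuration outside the three phases is a < m < b with J a = J b, that is, b = star
    a. *)
Lemma profile_phase (rhom rhop : R -> R) (t x : R) :
  0 <= rhom t <= 1 -> 0 <= rhop t <= 1 ->
  ~ critical_segment J m (rhom t, rhop t) ->
  phase (rhom t) (rhop t) (quasi_static_profile J m rhom rhop (t, x)).
Proof.
move=> a01 b01 nc; rewrite /quasi_static_profile /=.
set a := rhom t in a01 nc *; set b := rhop t in b01 nc *.
have [am|ma] /= := ltP a m.
  rewrite lt_starE//; have [h1|h1] := ltP (J a) _; first by constructor 1.
  have mb : m < b.
    rewrite ltNge; apply/negP => bm; move: h1; rewrite max_r// leNgt m_max//.
    by rewrite lt_eqF.
  rewrite mb /= star_ltE// min_l ?(ltW am)//.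
  have [h2|h2] := ltP (J b) (J a); first by constructor 2; rewrite min_l// ltW.
  case: nc; split=> //=.
  have [s01 _ _ Js] := star_spec a a01 (negbT (lt_eqF am)); have ms := star_gt a a01 am.
  have Jab : J a = J b by apply/eqP; rewrite eq_le h2/= -(max_l (ltW mb)).
  have [h|h|//] := ltgtP b (star J m a).
    by have := decr _ _ h (ltW mb); rewrite Js Jab ltxx.
  by have := decr _ _ h (ltW ms); rewrite Js Jab ltxx.
have [mb|bm] /= := ltP m b; last by constructor 3.
have h : J b < J (Num.min a m) by rewrite min_r// m_max// gt_eqF.
by rewrite star_ltE// h; constructor 2.
Qed.

End StationaryStates.

(** * Combinations of fluxes that control concentration *)

Section Dissipative.
Context {R : realType}.
Variables (J : R -> R) (m : R).
Hypotheses (J2 : Ck 2 J) (J_concave : forall x, derive1n 2 J x < 0)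
  (m_max : forall x, x != m -> J x < J m).
Let cJ : continuous J. Proof. exact: Ck_continuous J2. Qed.

(* Fluxes H whose space-time means are at most O(eps) when the boundary data
   stay d-close to a on the left and to b on the right. *)
Inductive dissipative (a b d : R) : (R -> R) -> Prop :=
| dissipative_left W S F : boundary_family J W S F ->
    (forall w, `|w - a| < d -> W w) -> dissipative a b d F
| dissipative_right W S F : boundary_family J W S F ->
    (forall w, `|w - b| < d -> W w) -> dissipative a b d (fun v => - F v)
| dissipativeD F G : dissipative a b d F -> dissipative a b d G ->
    dissipative a b d (fun v => F v + G v)
| dissipativeZ K F : 0 <= K -> dissipative a b d F -> dissipative a b d (fun v => K * F v).

Lemma dissipative_continuous a b d H : dissipative a b d H -> continuous H.
Proof.
elim=> [W S F [[_ c _ _] _] _|W S F [[_ c _ _] _] _|F G _ cF _ cG|K F _ _ cF] x.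
- exact: Ck_continuous c x.
- exact: cvgN (Ck_continuous _ _ c x).
- exact: cvgD (cF x) (cG x).
- exact: cvgM (cvg_cst _) (cF x).
Qed.

Lemma small_shift (f : R -> R) (e : R) : continuous f -> 0 < f 0 -> 0 < e ->
  exists d, [/\ 0 < d, d < e & 0 < f d].
Proof.
move=> cf f0 e0.
have near0 : \forall x \near (0 : R), 0 < f x by exact: (cf 0 _ (lt_nbhsr f0)).
have [d /= d0 hd] := near0.
exists (Num.min (d / 2) (e / 2)); rewrite lt_min !divr_gt0//.
have h1 : d / 2 < d by rewrite ltr_pdivrMr// ltr_pMr// ltr1n.
have h2 : e / 2 < e by rewrite ltr_pdivrMr// ltr_pMr// ltr1n.
split=> //; first by rewrite gt_min h2 orbT.
apply: hd; rewrite /= sub0r normrN gtr0_norm; first by rewrite gt_min h1.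
by rewrite lt_min !divr_gt0.
Qed.

(** In each phase, fluxes penalising v below and above c are combined. The steps start at distance d
    from the reference values and have width d, so that data within d stay on the flat side of the
    step. *)
Lemma dissipative_control (a b c r : R) : phase J m a b c -> 0 < r ->
  exists d H c0, [/\ 0 < d, dissipative a b d H, 0 < c0 &
    forall v, 0 <= v <= 1 -> 0 <= H v /\ (r <= `|v - c| -> c0 <= H v)].
Proof.
move=> ph r0.
have sgn (x y : R) : r <= `|x - y| -> x <= y - r \/ y + r <= x.
  by rewrite ler_normr => /orP[h|h]; [right|left]; lra.
have close (w x d : R) : `|w - x| < d -> x - d < w < x + d by rewrite ltr_distl.
case: ph => -[].
(* The left datum prevails. The left fluxes F1 and F2 penalise v above a and below a; the right flux
   -F3 is nonnegative and penalises v above k, where F1 may become negative. *)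
- move=> am Jab ->; pose k := Num.max b m.
  have mk : m <= k by rewrite le_max lexx orbT.
  have bk : b <= k by rewrite le_max lexx.
  (* At s = 0 this is the strict inequality of the phase; by continuity it survives a shift d > 0,
     chosen also so that 2d <= r and a + 2d <= m. *)
  have cf : continuous (fun s : R => J (k + 2 * s) - J (a + 2 * s)).
    move=> s; apply: cvgB; apply: continuous_comp; try exact: cJ;
    by apply: cvgD; [exact: cvg_cst|apply: cvgM; [exact: cvg_cst|exact: cvg_id]].
  have e0 : 0 < Num.min (r / 2) ((m - a) / 2) by rewrite lt_min !divr_gt0// subr_gt0.
  have [|d [d0 de hd]] := small_shift _ _ cf _ e0; first by rewrite !mulr0 !addr0 subr_gt0.
  move: de; rewrite lt_min => /andP[dr dm].
  have d2r : 2 * d <= r by lra.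
  have d2m : a + 2 * d <= m by lra.
  have l1 : a + d < a + 2 * d by lra.
  have l2 : a - 2 * d < a - d by lra.
  have l3 : k + d < k + 2 * d by lra.
  have [S1 [F1 [_ [_ [[fam1 _ F10 dF1] _]]]]] := step_pairs J J2 _ _ l1.
  have [_ [_ [S2 [F2 [_ [fam2 _ F20 dF2]]]]]] := step_pairs J J2 _ _ l2.
  have [S3 [F3 [_ [_ [[fam3 _ F30 dF3] _]]]]] := step_pairs J J2 _ _ l3.
  have D1 : dissipative a b d F1.
    by apply: (dissipative_left _ _ _ _ S1 _ fam1) => w /close /andP[_ h]; rewrite /= ltW.
  have D2 : dissipative a b d F2.
    by apply: (dissipative_left _ _ _ _ S2 _ fam2) => w /close /andP[h _]; rewrite /= ltW.
  have D3 : dissipative a b d (fun v => - F3 v).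
    apply: (dissipative_right _ _ _ _ S3 _ fam3) => w /close /andP[_ h] /=; lra.
  have F3lt v : k + d < v -> F3 v < 0.
    by move=> h; apply: (upper_lt0 J m J2 J_concave m_max _ _ _ l3 F30 dF3) => //; lra.
  have F3le v : F3 v <= 0 by have [/F30 ->//|/F3lt/ltW] := leP v (k + d).
  have F2ge v : 0 <= F2 v.
    have [h|h] := leP (a - d) v; first by rewrite F20.
    by rewrite ltW// (lower_gt0 J m J2 J_concave m_max _ _ _ l2 F20 dF2)//; lra.
  (* Past m the flux F1 is nonincreasing, so its smallest value on [m, k + 2d] is at the right end,
     where [upper_ge] bounds it below by J (k + 2d) - J (a + 2d) > 0. *)
  have F1gt v : a + d < v -> v <= k + 2 * d -> 0 < F1 v.
    move=> h h'; have [vm|mv] := leP v m.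
      exact: (upper_gt0 J m J2 J_concave m_max _ _ _ l1 F10 dF1).
    have h1 := upper_nincr J m J2 J_concave m_max _ _ _ dF1 _ _ (ltW mv) h'.
    have h2 : a + 2 * d <= k + 2 * d by lra.
    have h3 := upper_ge J m J2 J_concave m_max _ _ _ l1 F10 dF1 _ d2m h2.
    by apply: lt_le_trans h1; apply: lt_le_trans h3.
  have F1ge v : v <= k + 2 * d -> 0 <= F1 v.
    move=> h; have [h'|h'] := leP v (a + d); first by rewrite F10.
    by rewrite ltW// F1gt.
  (* F1 + F2 is nonnegative up to k + 2d. Beyond that point -F3 is at least its value there, because
     F3 is nonincreasing to the right of m. *)
  have [K [c0 [K0 c00 hK]]] : exists K c0, [/\ 0 <= K, 0 < c0 & forall v, 0 <= v <= 1 ->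
      0 <= (F1 v + F2 v) + K * - F3 v /\ (r <= `|v - a| -> c0 <= (F1 v + F2 v) + K * - F3 v)].
    apply: (separating_combination _ _ (fun v => - F3 v) _ _ (- F3 (k + 2 * d))).
    - exact: dissipative_continuous (dissipativeD _ _ _ _ _ D1 D2).
    - exact: dissipative_continuous D3.
    - by rewrite oppr_gt0 F3lt.
    - by move=> v _; rewrite oppr_ge0.
    - move=> v _; have [h|h] := leP v (k + 2 * d); [left|right].
        by rewrite addr_ge0// F1ge.
      rewrite lerN2; apply: (upper_nincr J m J2 J_concave m_max _ _ _ dF3); lra.
    - move=> v _ /sgn h; have [h'|h'] := leP v (k + d); last by right; rewrite oppr_gt0 F3lt.
      left; case: h => h.
        rewrite ltr_wpDl// ?F1ge//; first by lra.
        by rewrite (lower_gt0 J m J2 J_concave m_max _ _ _ l2 F20 dF2)//; lra.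
      by rewrite ltr_pwDl// F1gt//; lra.
  exists d, (fun v => (F1 v + F2 v) + K * - F3 v), c0; split=> //.
  exact: dissipativeD (dissipativeD _ _ _ _ _ D1 D2) (dissipativeZ _ _ _ _ _ K0 D3).
(* The right datum prevails: the previous case with the two ends, and the upper and lower steps,
   exchanged. *)
- move=> mb Jba ->; pose k := Num.min a m.
  have km : k <= m by rewrite ge_min lexx orbT.
  have ka : k <= a by rewrite ge_min lexx.
  have cf : continuous (fun s : R => J (k - 2 * s) - J (b - 2 * s)).
    move=> s; apply: cvgB; apply: continuous_comp; try exact: cJ;
    by apply: cvgB; [exact: cvg_cst|apply: cvgM; [exact: cvg_cst|exact: cvg_id]].
  have e0 : 0 < Num.min (r / 2) ((b - m) / 2) by rewrite lt_min !divr_gt0// subr_gt0.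
  have [|d [d0 de hd]] := small_shift _ _ cf _ e0; first by rewrite !mulr0 !subr0 subr_gt0.
  move: de; rewrite lt_min => /andP[dr dm].
  have d2r : 2 * d <= r by lra.
  have d2m : m <= b - 2 * d by lra.
  have l1 : b - 2 * d < b - d by lra.
  have l2 : b + d < b + 2 * d by lra.
  have l3 : k - 2 * d < k - d by lra.
  have [_ [_ [S1 [F1 [_ [fam1 _ F10 dF1]]]]]] := step_pairs J J2 _ _ l1.
  have [S2 [F2 [_ [_ [[fam2 _ F20 dF2] _]]]]] := step_pairs J J2 _ _ l2.
  have [_ [_ [S3 [F3 [_ [fam3 _ F30 dF3]]]]]] := step_pairs J J2 _ _ l3.
  have D1 : dissipative a b d (fun v => - F1 v).
    by apply: (dissipative_right _ _ _ _ S1 _ fam1) => w /close /andP[h _]; rewrite /= ltW.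
  have D2 : dissipative a b d (fun v => - F2 v).
    by apply: (dissipative_right _ _ _ _ S2 _ fam2) => w /close /andP[_ h]; rewrite /= ltW.
  have D3 : dissipative a b d F3.
    apply: (dissipative_left _ _ _ _ S3 _ fam3) => w /close /andP[h _] /=; lra.
  have F3gt v : v < k - d -> 0 < F3 v.
    by move=> h; apply: (lower_gt0 J m J2 J_concave m_max _ _ _ l3 F30 dF3) => //; lra.
  have F3ge v : 0 <= F3 v by have [/F30 ->//|/F3gt/ltW] := leP (k - d) v.
  have F2le v : F2 v <= 0.
    have [h|h] := leP v (b + d); first by rewrite F20.
    by rewrite ltW// (upper_lt0 J m J2 J_concave m_max _ _ _ l2 F20 dF2)//; lra.
  have F1lt v : v < b - d -> k - 2 * d <= v -> F1 v < 0.
    move=> h h'; have [mv|vm] := leP m v.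
      exact: (lower_lt0 J m J2 J_concave m_max _ _ _ l1 F10 dF1).
    have h1 := lower_nincr J m J2 J_concave m_max _ _ _ dF1 _ _ (ltW vm) h'.
    have h2 : k - 2 * d <= b - 2 * d by lra.
    have h3 := lower_le J m J2 J_concave m_max _ _ _ l1 F10 dF1 _ d2m h2.
    apply: (le_lt_trans h1); apply: (le_lt_trans h3).
    by rewrite -opprB oppr_lt0.
  have F1le v : k - 2 * d <= v -> F1 v <= 0.
    move=> h; have [h'|h'] := leP (b - d) v; first by rewrite F10.
    by rewrite ltW// F1lt.
  have [K [c0 [K0 c00 hK]]] : exists K c0, [/\ 0 <= K, 0 < c0 & forall v, 0 <= v <= 1 ->
      0 <= (- F1 v + - F2 v) + K * F3 v /\ (r <= `|v - b| -> c0 <= (- F1 v + - F2 v) + K * F3 v)].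
    apply: (separating_combination _ _ F3 _ _ (F3 (k - 2 * d))).
    - exact: dissipative_continuous (dissipativeD _ _ _ _ _ D1 D2).
    - exact: dissipative_continuous D3.
    - by rewrite F3gt.
    - by move=> v _.
    - move=> v _; have [h|h] := leP (k - 2 * d) v; [left|right].
        by rewrite addr_ge0// oppr_ge0// F1le.
      apply: (lower_nincr J m J2 J_concave m_max _ _ _ dF3); lra.
    - move=> v _ /sgn h; have [h'|h'] := leP (k - d) v; last by right; rewrite F3gt.
      left; case: h => h.
        by rewrite ltr_pwDl// ?oppr_gt0 ?oppr_ge0// F1lt//; lra.
      rewrite ltr_wpDl// ?oppr_gt0 ?oppr_ge0// ?F1le//; first by lra.
      by rewrite (upper_lt0 J m J2 J_concave m_max _ _ _ l2 F20 dF2)//; lra.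
  exists d, (fun v => (- F1 v + - F2 v) + K * F3 v), c0; split=> //.
  exact: dissipativeD (dissipativeD _ _ _ _ _ D1 D2) (dissipativeZ _ _ _ _ _ K0 D3).
- move=> ma bm ->; pose d := r / 4.
  have d0 : 0 < d by rewrite divr_gt0.
  have dr : 2 * d < r by rewrite /d; lra.
  have l1 : m - 2 * d < m - d by lra.
  have l2 : m + d < m + 2 * d by lra.
  have [_ [_ [S1 [F1 [_ [fam1 _ F10 dF1]]]]]] := step_pairs J J2 _ _ l1.
  have [S2 [F2 [_ [_ [[fam2 _ F20 dF2] _]]]]] := step_pairs J J2 _ _ l2.
  have D1 : dissipative a b d F1.
    apply: (dissipative_left _ _ _ _ S1 _ fam1) => w /close /andP[h _] /=; lra.
  have D2 : dissipative a b d (fun v => - F2 v).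
    apply: (dissipative_right _ _ _ _ S2 _ fam2) => w /close /andP[_ h] /=; lra.
  have F1gt v : v < m - d -> 0 < F1 v.
    by move=> h; apply: (lower_gt0 J m J2 J_concave m_max _ _ _ l1 F10 dF1) => //; lra.
  have F1ge v : 0 <= F1 v by have [/F10 ->//|/F1gt/ltW] := leP (m - d) v.
  have F2lt v : m + d < v -> F2 v < 0.
    by move=> h; apply: (upper_lt0 J m J2 J_concave m_max _ _ _ l2 F20 dF2) => //; lra.
  have F2le v : F2 v <= 0 by have [/F20 ->//|/F2lt/ltW] := leP v (m + d).
  have [K [c0 [K0 c00 hK]]] : exists K c0, [/\ 0 <= K, 0 < c0 & forall v, 0 <= v <= 1 ->
      0 <= F1 v + K * - F2 v /\ (r <= `|v - m| -> c0 <= F1 v + K * - F2 v)].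
    apply: (separating_combination _ F1 (fun v => - F2 v) _ _ 1) => //.
    - exact: dissipative_continuous D1.
    - exact: dissipative_continuous D2.
    - by move=> v _; rewrite oppr_ge0.
    - by move=> v _; left.
    - move=> v _ /sgn [h|h]; [left|right]; first by apply: F1gt; lra.
      by rewrite oppr_gt0 F2lt//; lra.
  exists d, (fun v => F1 v + K * - F2 v), c0; split=> //.
  exact: dissipativeD D1 (dissipativeZ _ _ _ _ _ K0 D2).
Qed.

End Dissipative.

(** * Local concentration *)

Section Window.
Context {R : realType}.

Definition window (p q t : R) : R := step (t - p) * step (q - t).

Lemma Ck_window p q k : Ck k (window p q).
Proof.
apply: CkM.
  by apply: (Ck_comp k step (fun t => t - p)); [exact: Ck_step|exact: CkD k _ _ (Ck_id k) (Ck_cst k (- p))].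
apply: (Ck_comp k step (fun t => q - t)); first exact: Ck_step.
exact: CkD k _ _ (Ck_cst k q) (CkN k _ (Ck_id k)).
Qed.

Lemma window_ge0 p q t : 0 <= window p q t.
Proof. by rewrite mulr_ge0 ?step_ge0. Qed.

Lemma window_gt0 p q t : p < t < q -> 0 < window p q t.
Proof. by move=> /andP[pt tq]; rewrite mulr_gt0// step_gt0 ?subr_gt0. Qed.

Lemma window_neq0 p q t : window p q t != 0 -> p < t < q.
Proof.
apply: contraR; rewrite negb_and -!leNgt /window => /orP[h|h].
  by rewrite step_le0E ?mul0r// subr_le0.
by rewrite (step_le0E (q - t)) ?mulr0// subr_le0.
Qed.

Lemma window_eq0 p q t : ~ `[p, q]%classic t -> window p q t = 0.
Proof.
move=> h; apply/eqP; have [//|/window_neq0/andP[pt tq]] := eqVneq (window p q t) 0.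
by case: h; rewrite /= in_itv /= !ltW.
Qed.

(** Near t0 the difference quotient is within 1 of the derivative l, so rho is Lipschitz at t0 with
    constant |l| + 1. *)
Lemma C1_Rplus_near (rho : R -> R) (t0 e : R) : C1_Rplus rho -> 0 <= t0 -> 0 < e ->
  exists2 d, 0 < d & forall t, 0 <= t -> `|t - t0| < d -> `|rho t - rho t0| < e.
Proof.
move=> [drho _ hd] t00 e0; have := hd t0 t00.
set l := drho t0 => /cvgrPdist_lt /(_ _ ltr01); rewrite near_withinE /= => -[d /= d0 near_d].
pose N := `|l| + 1.
have N0 : 0 < N by rewrite ltr_wpDl.
exists (Num.min d (e / N)); first by rewrite lt_min d0 divr_gt0.
move=> t t0' ; rewrite lt_min => /andP[td te].
have [->|tt] := eqVneq t t0; first by rewrite subrr normr0.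
pose h := t - t0.
have h0 : h != 0 by rewrite subr_eq0.
have th : t0 + h = t by rewrite /h addrC subrK.
have bh : ball (0 : R) d h by rewrite /ball /= sub0r normrN.
have := near_d h bh; rewrite /= th => /(_ h0 t0') hl.
have hN : `|h^-1 * (rho t - rho t0)| < N.
  rewrite /N; have := ler_normD (h^-1 * (rho t - rho t0) - l) l.
  by rewrite subrK distrC => h1; apply: (le_lt_trans h1); rewrite addrC ltrD2l.
have -> : rho t - rho t0 = h * (h^-1 * (rho t - rho t0)) by rewrite mulrA divff// mul1r.
rewrite normrM; apply: (@lt_trans _ _ (`|h| * N)).
  by rewrite ltr_pM2l// normr_gt0.
by rewrite -ltr_pdivlMr.
Qed.

Lemma continuous_maxr0 (rho : R -> R) : C1_Rplus rho ->
  continuous (fun t : R => rho (Num.max t 0)).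
Proof.
move=> h t; apply/cvgrPdist_lt => e e0 /=.
have m0 : 0 <= Num.max t 0 by rewrite le_max lexx orbT.
have [d d0 hd] := C1_Rplus_near rho _ e h m0 e0.
exists d => //= s; rewrite /ball /= distrC => sd; rewrite distrC; apply: hd.
  by rewrite le_max lexx orbT.
apply: le_lt_trans sd; rewrite !maxEle.
case: ifPn => h1; case: ifPn => h2; rewrite ?subrr ?normr0//.
- rewrite -ltNge in h2; rewrite sub0r normrN gtr0_norm//.
  by have := ler_norm (t - s); rewrite distrC; lra.
- rewrite -ltNge in h1; rewrite subr0 gtr0_norm//.
  by have := ler_norm (s - t); lra.
Qed.

End Window.

Section LocalEstimate.
Context {R : realType}.
Local Notation strip := (@strip R).
Local Notation leb2 := (@leb2 R).
Local Notation leb := (@leb R).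
Variables (J : R -> R) (rhom rhop u0 : R -> R) (u : R -> R * R -> R).
Hypotheses (J2 : Ck 2 J)
  (rhom01 : forall t, 0 <= t -> 0 <= rhom t <= 1)
  (rhop01 : forall t, 0 <= t -> 0 <= rhop t <= 1)
  (mu0 : measurable_fun (`[0, 1]%classic : set (measurableTypeR R)) (u0 : R -> measurableTypeR R))
  (u001 : {ae leb, forall x, 0 <= x <= 1 -> 0 <= u0 x <= 1})
  (u_sol : forall eps, 0 < eps -> entropy_solution J eps rhom rhop u0 (u eps)).

Lemma solution_measurable eps : 0 < eps ->
  measurable_fun (strip : set (measurableTypeR R * measurableTypeR R))
    (u eps : measurableTypeR R * measurableTypeR R -> measurableTypeR R).
Proof.
move=> /u_sol[uL _ _ _].
by have [] := Lp_onoo_bounded _ _ _ _ _ _ measurable_strip uL.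
Qed.

Lemma solution_in01 eps : 0 < eps -> {ae leb2, forall z, strip z -> 0 <= u eps z <= 1}.
Proof. by move=> e0; exact: (solution_bounds R J eps rhom rhop u0 (u eps) J2 e0 rhom01 rhop01 mu0 u001 (u_sol eps e0)). Qed.

Let solution_le1 eps : 0 < eps -> {ae leb2, forall z, strip z -> `|u eps z| <= 1}.
Proof.
move=> /solution_in01; apply: aeS => z h /h /andP[h1 h2].
by rewrite ger0_norm.
Qed.

Variables (a b d p q y : R).
Hypotheses (pq : p <= q) (y0 : 0 < y) (y12 : 2 * y < 1).
Hypotheses (near_a : forall t, 0 <= t -> p < t < q -> `|rhom t - a| < d)
  (near_b : forall t, 0 <= t -> p < t < q -> `|rhop t - b| < d).

Local Notation beta := (window p q).
Local Notation k := (derive1 (ramp y (1 - y))).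

Let y1 : y < 1 - y. Proof. by rewrite ltrBrDr -mulr2n -mulr_natl. Qed.
Let cbeta : continuous beta. Proof. exact: Ck_continuous 0 _ (Ck_window p q 0). Qed.
Let ck : continuous k. Proof. exact: continuous_derive_ramp. Qed.

Lemma integrable_flux eps H : 0 < eps -> continuous H ->
  leb2.-integrable strip (EFin \o test_integrand (u eps) H beta k).
Proof.
move=> e0 cH.
exact: (integrable_test (u eps) 1 (solution_measurable _ e0) (solution_le1 _ e0) H _ _ p q
  cH cbeta ck pq (window_eq0 p q)).
Qed.

(** Induction on the combination, with the interior estimates at its generators. The bound on S(u)
    is taken over [0,1], which by the maximum principle is valid for every eps; hence C can be
    chosen before eps. *)
Lemma dissipative_flux_le H : dissipative J a b d H ->
  exists2 C, 0 <= C & forall eps, 0 < eps -> flux_integral (u eps) beta H y (1 - y) <= eps * C.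
Proof.
have mst := @measurable_strip R.
have ctx (S : R -> R) : continuous S -> exists CS, [/\ 0 <= CS,
    forall eps, 0 < eps -> {ae leb2, forall z, strip z -> `|S (u eps z)| <= CS} &
    {ae leb, forall x, `[0, 1]%classic x -> `|S (u0 x)| <= CS}].
  move=> cS; have [CS CS0 hS] := continuous_bounded S 0 1 cS; exists CS; split=> //.
    by move=> eps /solution_in01; apply: aeS => z h /h; exact: hS.
  by apply: aeS u001 => x h; rewrite /= in_itv /= => /h; exact: hS.
have cdb : continuous (derive1 beta) by have [_] := Ck_window p q 1.
have [Cb Cb0 hb] := continuous_bounded _ p q cdb.
have C0 CS : 0 <= CS -> 0 <= CS * Cb * (q - p) + CS * beta 0.
  move=> CS0; apply: addr_ge0; last exact: mulr_ge0 CS0 (window_ge0 p q 0).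
  have qp : 0 <= q - p by rewrite subr_ge0.
  exact: mulr_ge0 (mulr_ge0 CS0 Cb0) qp.
elim=> [W S F fam hW|W S F fam hW|F G DF [C1 C10 h1] DG [C2 C20 h2]|K F K0 DF [C C0' hC]].
- have [[cS2 _ _ _] _] := fam.
  have [CS [CS0 hS hS0]] := ctx S (Ck_continuous _ _ cS2).
  exists (CS * Cb * (q - p) + CS * beta 0); first exact: C0.
  move=> eps e0; have [_ _ ent bnd] := u_sol eps e0.
  apply: (interior_flux_le J eps rhom rhop u0 (u eps) 1 e0 (solution_measurable _ e0)
    (solution_le1 _ e0) mu0 ent bnd beta p q pq (Ck_window p q) (window_ge0 p q) (window_eq0 p q)
    W S F fam CS Cb y CS0 (hS _ e0) hS0 Cb0 hb y0 y12).
  by move=> t t0 /window_neq0 tpq; apply: hW; exact: near_a.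
- have [[cS2 cF2 _ _] _] := fam.
  have [CS [CS0 hS hS0]] := ctx S (Ck_continuous _ _ cS2).
  exists (CS * Cb * (q - p) + CS * beta 0); first exact: C0.
  move=> eps e0; have [_ _ ent bnd] := u_sol eps e0.
  have -> : flux_integral (u eps) beta (fun v => - F v) y (1 - y) = - flux_integral (u eps) beta F y (1 - y).
    rewrite /flux_integral -[RHS]mulN1r -RintegralZl//; last first.
      exact: integrable_flux _ _ e0 (Ck_continuous _ _ cF2).
    by apply: eq_Rintegral => z _; rewrite /test_integrand mulN1r !mulNr.
  rewrite lerNl.
  apply: (interior_flux_ge J eps rhom rhop u0 (u eps) 1 e0 (solution_measurable _ e0)
    (solution_le1 _ e0) mu0 ent bnd beta p q pq (Ck_window p q) (window_ge0 p q) (window_eq0 p q)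
    W S F fam CS Cb y CS0 (hS _ e0) hS0 Cb0 hb y0 y12).
  by move=> t t0 /window_neq0 tpq; apply: hW; exact: near_b.
- exists (C1 + C2); first exact: addr_ge0.
  move=> eps e0; rewrite mulrDr.
  have -> : flux_integral (u eps) beta (fun v => F v + G v) y (1 - y) =
      flux_integral (u eps) beta F y (1 - y) + flux_integral (u eps) beta G y (1 - y).
    rewrite /flux_integral -RintegralD//.
    + by apply: eq_Rintegral => z _; rewrite /test_integrand !mulrDl.
    + exact: integrable_flux _ _ e0 (dissipative_continuous _ _ _ _ _ DF).
    + exact: integrable_flux _ _ e0 (dissipative_continuous _ _ _ _ _ DG).
  by apply: lerD; [exact: h1|exact: h2].
- exists (K * C); first exact: mulr_ge0.
  move=> eps e0; rewrite mulrCA.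
  have -> : flux_integral (u eps) beta (fun v => K * F v) y (1 - y) =
      K * flux_integral (u eps) beta F y (1 - y).
    rewrite /flux_integral -RintegralZl//.
      by apply: eq_Rintegral => z _; rewrite /test_integrand !mulrA.
    exact: integrable_flux _ _ e0 (dissipative_continuous _ _ _ _ _ DF).
  by rewrite ler_wpM2l// hC.
Qed.

Definition weight (z : R * R) : R := beta z.1 * k z.2.

Definition far_set (eps c r : R) : set (measurableTypeR R * measurableTypeR R) :=
  [set z | r <= `|u eps z - c|].

Lemma measurable_far_set eps c r : 0 < eps -> measurable (strip `&` far_set eps c r).
Proof.
move=> e0.
have mf : measurable_fun (strip : set (measurableTypeR R * measurableTypeR R)) (fun z => `|u eps z - c|).
  apply: measurableT_comp => //; apply: measurable_funB => //; exact: solution_measurable.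
have := mf (@measurable_strip R) _ (measurable_itv `[r, +oo[).
congr (measurable (_ `&` _)); apply/seteqP; split=> z /=; by rewrite /far_set /= in_itv /= andbT.
Qed.

Lemma measurable_weight : measurable_fun (setT : set (measurableTypeR R * measurableTypeR R)) weight.
Proof.
apply: measurable_funM.
- apply: (@measurableT_comp _ _ _ _ _ _ beta _ fst); last exact: measurable_fst.
  exact: continuous_measurable_fun.
- apply: (@measurableT_comp _ _ _ _ _ _ k _ snd); last exact: measurable_snd.
  exact: continuous_measurable_fun.
Qed.

Definition heavy_set (kap : R) : set (measurableTypeR R * measurableTypeR R) :=
  [set z | kap < weight z].

Lemma measurable_heavy_set kap : measurable (heavy_set kap).
Proof.
have := measurable_weight measurableT _ (measurable_itv `]kap, +oo[).
rewrite setTI; congr measurable; apply/seteqP; split=> z /=; by rewrite /heavy_set /= in_itv /= andbT.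
Qed.

(** Chebyshev's inequality: where u is far from c and the weight exceeds kap, the integrand of the
    flux average is at least kap * c0, and it is nonnegative elsewhere. The threshold kap is needed
    because the weight decays to 0 at the edges of the window. *)
Lemma far_set_small H (c r c0 kap : R) : dissipative J a b d H -> 0 < c0 -> 0 < kap ->
  (forall v, 0 <= v <= 1 -> 0 <= H v /\ (r <= `|v - c| -> c0 <= H v)) ->
  exists2 C, 0 <= C & forall eps, 0 < eps ->
    (leb2 (strip `&` far_set eps c r `&` heavy_set kap) <= (eps * C)%:E)%E.
Proof.
move=> DH c00 kap0 hH; have [C C0 hC] := dissipative_flux_le H DH.
have N0 : 0 < kap * c0 by rewrite mulr_gt0.
exists ((kap * c0)^-1 * C); first by rewrite mulr_ge0// invr_ge0 ltW.
move=> eps e0; set E := _ `&` _.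
have mst := @measurable_strip R.
have mE : measurable E by apply: measurableI; [exact: measurable_far_set|exact: measurable_heavy_set].
have ES : E `<=` strip by move=> z [[]].
have IH := integrable_flux eps H e0 (dissipative_continuous _ _ _ _ _ DH).
have IH' := integrableZl mst (kap * c0)^-1 IH.
have mI : measurable_fun (strip : set (measurableTypeR R * measurableTypeR R)) (\1_E : _ -> R).
  by apply: measurable_funTS.
have bound : {ae leb2, forall z, strip z -> \1_E z <= (kap * c0)^-1 * test_integrand (u eps) H beta k z}.
  apply: aeS (solution_in01 _ e0) => z h sz; have [H0 Hc] := hH _ (h sz).
  have W0 : 0 <= weight z by rewrite mulr_ge0 ?window_ge0// derive_ramp_ge0.
  rewrite /test_integrand -mulrA -/(weight z) indicE.
  have [zE|zE] := pselect (E z); last first.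
    have Ni : 0 <= (kap * c0)^-1 by rewrite invr_ge0 ltW.
    by rewrite memNset//; exact: mulr_ge0 Ni (mulr_ge0 H0 W0).
  rewrite mem_set//= ler_pdivlMl// mulr1.
  have [[_ far] heavy] := zE.
  rewrite mulrC; exact: ler_pM (ltW c00) (ltW kap0) (Hc far) (ltW heavy).
have IE : leb2.-integrable strip (EFin \o \1_E).
  apply: (ae_le_integrable _ _ _ leb2 _ mst _ _ mI IH').
  by apply: aeS bound => z h /h; rewrite ger0_norm.
have := ae_le_Rintegral _ _ _ leb2 _ mst _ _ IE IH' bound.
rewrite RintegralZl//.
have eE : (\int[leb2]_(z in strip) (\1_E z)%:E = leb2 E)%E.
  by rewrite integral_indic// setIidl.
have fE : leb2 E \is a fin_num by rewrite -eE; exact: integrable_fin_num IE.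
rewrite /Rintegral eE => h; rewrite -(fineK fE) lee_fin; apply: (le_trans h).
rewrite mulrCA ler_wpM2l ?invr_ge0 ?(ltW N0)//.
exact: hC.
Qed.

End LocalEstimate.

(** * Exhaustion by countably many cells *)

Section Exhaustion.
Context d (T : measurableType d) (R : realType).
Variable mu : {measure set T -> \bar R}.
Variables (D : set T) (w : T -> R) (B : R -> set T) (E : nat -> set T).
Hypotheses (mD : measurable D) (Iw : mu.-integrable D (EFin \o w)) (w0 : forall x, 0 <= w x).
Hypotheses (mB : forall eps, 0 < eps -> measurable (B eps)) (mE : forall j, measurable (E j)).
Hypothesis small : forall j, exists2 C, 0 <= C & forall eps, 0 < eps ->
  \int[mu]_(x in D) (w x * \1_(B eps `&` E j) x) <= eps * C.
Hypothesis cover : {ae mu, forall x, D x -> exists j, E j x}.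

Let mw : measurable_fun D w. Proof. by apply/measurable_EFinP; case/integrableP: Iw. Qed.

Let Iw1 A : measurable A -> mu.-integrable D (EFin \o (fun x => w x * \1_A x)).
Proof.
move=> mA; apply: (ae_le_integrable _ _ _ mu _ mD _ w) => //.
  by apply: measurable_funM => //; exact: measurable_funTS.
apply: aeW => x _; rewrite normrM ger0_norm// ler_piMr// indicE.
by case: (_ \in _); rewrite ?normr1 ?normr0.
Qed.

Let U n : set T := \big[setU/set0]_(j < n) E j.

Let mU n : measurable (U n). Proof. exact: bigsetU_measurable. Qed.

Let small_U n : exists2 C, 0 <= C & forall eps, 0 < eps ->
  \int[mu]_(x in D) (w x * \1_(B eps `&` U n) x) <= eps * C.
Proof.
elim: n => [|n [C C0 hC]].
  exists 0 => // eps e0; rewrite mulr0 (_ : Rintegral _ _ _ = 0)//.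
  under eq_Rintegral do rewrite /U big_ord0 setI0 indic0 mulr0.
  by rewrite Rintegral_cst// mul0r.
have [C' C'0 hC'] := small n; exists (C + C'); first exact: addr_ge0.
move=> eps e0; rewrite mulrDr; apply: le_trans (lerD (hC _ e0) (hC' _ e0)).
have m1 := measurableI _ _ (mB _ e0) (mU n).
have m2 := measurableI _ _ (mB _ e0) (mE n).
have m3 := measurableI _ _ (mB _ e0) (mU n.+1).
rewrite -RintegralD//; [|exact: Iw1|exact: Iw1].
apply: le_Rintegral => //; [exact: Iw1|have h := integrableD mD (Iw1 _ m1) (Iw1 _ m2); exact: h|].
move=> x _; rewrite -mulrDr ler_wpM2l// !indicE.
have [h|h] := boolP (x \in B eps `&` U n.+1); last by rewrite addr_ge0.
move: h; rewrite inE /U big_ord_recr /= => -[Bx [Ux|Ex]].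
  by rewrite (mem_set (conj Bx Ux : (B eps `&` U n) x)) lerDl.
by rewrite (mem_set (conj Bx Ex : (B eps `&` E n) x)) lerDr.
Qed.

(** The constants of the cells need not be bounded, so only finitely many cells are kept: by
    dominated convergence the w-mass outside them is at most e/2, and the constants of those kept
    add up. The price is that no rate in eps results. *)
Lemma integral_exhaustion e : 0 < e ->
  exists2 del, 0 < del & forall eps, 0 < eps < del ->
    \int[mu]_(x in D) (w x * \1_(B eps) x) <= e.
Proof.
move=> e0; have e20 : 0 < e / 2 by rewrite divr_gt0.
have mUC n : measurable (~` U n) by exact: measurableC.
have [N hN] : exists N, \int[mu]_(x in D) (w x * \1_(~` U N) x) <= e / 2.
  pose f n x := (w x * \1_(~` U n) x)%:E.
  have mf n : measurable_fun D (f n) by case/integrableP: (Iw1 _ (mUC n)).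
  have f0 : {ae mu, forall x, D x -> f n x @[n --> \oo] --> (0%:E : \bar R)}.
    apply: aeS cover => x h /h [j Ej]; apply: cvg_near_cst; near=> n.
    rewrite /f indicE memNset ?mulr0//= => /(_ _)/=; apply; rewrite /U.
    rewrite -bigcup_mkord; exists j => //=; near: n; exact: nbhs_infty_gt.
  have fw : {ae mu, forall x, forall n, D x -> (`|f n x| <= (EFin \o w) x)%E}.
    apply: aeW => x n _; rewrite /f /= lee_fin normrM ger0_norm// ler_piMr// indicE.
    by case: (_ \in _); rewrite ?normr1 ?normr0.
  have [_ _ lim] := dominated_convergence mD mf (measurable_cst _) f0 Iw fw.
  rewrite integral0 in lim.
  have /fine_cvgP[_ /cvgrPdist_lt /(_ _ e20) [N _ hN]] := lim.
  exists N; have := hN N (leqnn N); rewrite /= sub0r normrN => /ltW; apply: le_trans.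
  exact: ler_norm.
have [C C0 hC] := small_U N.
have C1 : 0 < C + 1 by rewrite ltr_wpDl.
(* C may be 0, hence C + 1 in the denominator. *)
exists (e / 2 / (C + 1)); first by rewrite divr_gt0.
move=> eps /andP[eps0 epsd].
have hB := mB _ eps0.
have m1 := measurableI _ _ hB (mU N).
apply: (@le_trans _ _ (\int[mu]_(x in D) (w x * \1_(B eps `&` U N) x)
    + \int[mu]_(x in D) (w x * \1_(~` U N) x))).
  rewrite -RintegralD//; [|exact: Iw1|exact: Iw1].
  apply: le_Rintegral => //; [exact: Iw1|have h := integrableD mD (Iw1 _ m1) (Iw1 _ (mUC N)); exact: h|].
  move=> x _; rewrite -mulrDr ler_wpM2l// !indicE.
  have [Bx|Bx] := boolP (x \in B eps); last by rewrite addr_ge0.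
  have [Ux|Ux] := pselect (U N x).
    rewrite [x \in B eps `&` _]mem_set ?lerDl//; split=> //; exact: set_mem.
  by rewrite [x \in ~` _]mem_set// lerDr.
have -> : e = e / 2 + e / 2 by rewrite -splitr.
apply: lerD => //; apply: le_trans (hC _ eps0) _.
apply: (@le_trans _ _ (eps * (C + 1))); first by rewrite ler_wpM2l ?(ltW eps0)// lerDl.
by apply: ltW; rewrite -ltr_pdivlMr.
Unshelve. all: by end_near. Qed.

End Exhaustion.

Lemma Lp_onoo_of_bounded d (T : measurableType d) (R : realType)
    (mu : {measure set T -> \bar R}) (D : set T) (f : T -> R) (M : R) :
  measurable D -> measurable_fun D f -> {ae mu, forall x, D x -> `|f x| <= M} ->
  Lp_on mu +oo%E D f.
Proof.
move=> mD mf fM; rewrite /Lp_on; apply/andP; split; rewrite inE /=.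
  exact: (measurable_restrictT _ mD).1 mf.
rewrite /finite_norm unlock /=; case: ifPn => // _.
(* The extension by zero takes the value 0 outside D, which M alone need not bound. *)
apply: (@le_lt_trans _ _ (Num.max M 0)%:E); last exact: ltry.
apply/ess_supP; apply: aeS fM => x h /=; rewrite patchE; case: ifPn => [/set_mem/h hx|_].
  by rewrite lee_fin le_max hx.
by rewrite normr0 lee_fin le_max lexx orbT.
Qed.

(** * Convergence *)

Section Profile.
Context {R : realType}.
Variables (J : R -> R) (m : R) (rhom rhop : R -> R).
Hypotheses (J2 : Ck 2 J) (J_concave : forall x, derive1n 2 J x < 0)
  (J0 : J 0 = 0) (J1 : J 1 = 0) (m01 : 0 < m < 1) (m_max : forall x, x != m -> J x < J m)
  (rhom_C1 : C1_Rplus rhom) (rhop_C1 : C1_Rplus rhop)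
  (rhom01 : forall t, 0 <= t -> 0 <= rhom t <= 1)
  (rhop01 : forall t, 0 <= t -> 0 <= rhop t <= 1).

(* Off [star]: b < star a becomes J a < J (max b m), which is visibly measurable;
   negative times are clamped to 0. *)
Definition profile_ext (z : R * R) : R :=
  let a := rhom (Num.max z.1 0) in let b := rhop (Num.max z.1 0) in
  if (a < m) && (J a < J (Num.max b m)) then a
  else if (m < b) && (J b < J (Num.min a m)) then b
  else if (m <= a) && (b <= m) then m else 0.

Lemma profile_extE z : @strip R z -> quasi_static_profile J m rhom rhop z = profile_ext z.
Proof.
move=> [/=]; rewrite in_itv /= andbT => t0 _.
have a01 := rhom01 _ t0; have b01 := rhop01 _ t0.
rewrite /profile_ext /quasi_static_profile /= max_l//.
have -> : (rhom z.1 < m) && (rhop z.1 < star J m (rhom z.1)) =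
    (rhom z.1 < m) && (J (rhom z.1) < J (Num.max (rhop z.1) m)).
  by have [h/=|//] := ltP (rhom z.1) m; rewrite (lt_starE J m J2 J_concave J0 J1 m01 m_max).
have -> // : (m < rhop z.1) && (star J m (rhop z.1) < rhom z.1) =
    (m < rhop z.1) && (J (rhop z.1) < J (Num.min (rhom z.1) m)).
by have [h/=|//] := ltP m (rhop z.1); rewrite (star_ltE J m J2 J_concave J0 J1 m01 m_max).
Qed.

Lemma measurable_profile_ext : measurable_fun setT
  (profile_ext : measurableTypeR R * measurableTypeR R -> measurableTypeR R).
Proof.
have ma : measurable_fun setT (fun z : measurableTypeR R * measurableTypeR R => (rhom (Num.max z.1 0) : measurableTypeR R)).
  apply: (@measurableT_comp _ _ _ _ _ _ (fun t : R => rhom (Num.max t 0)) _ fst); last exact: measurable_fst.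
  exact: continuous_measurable_fun (continuous_maxr0 rhom rhom_C1).
have mb : measurable_fun setT (fun z : measurableTypeR R * measurableTypeR R => (rhop (Num.max z.1 0) : measurableTypeR R)).
  apply: (@measurableT_comp _ _ _ _ _ _ (fun t : R => rhop (Num.max t 0)) _ fst); last exact: measurable_fst.
  exact: continuous_measurable_fun (continuous_maxr0 rhop rhop_C1).
have mJ : measurable_fun setT J := continuous_measurable_fun (Ck_continuous _ _ J2).
rewrite /profile_ext; apply: measurable_fun_ifT => //.
  apply: measurable_and; first exact: measurable_fun_ltr.
  apply: measurable_fun_ltr; first exact: measurableT_comp.
  by apply: measurableT_comp => //; exact: measurable_maxr.
apply: measurable_fun_ifT => //.
  apply: measurable_and; first exact: measurable_fun_ltr.
  apply: measurable_fun_ltr; first exact: measurableT_comp.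
  by apply: measurableT_comp => //; exact: measurable_minr.
apply: measurable_fun_ifT => //.
by apply: measurable_and; exact: measurable_fun_ler.
Qed.

Lemma profile_ext01 z : 0 <= profile_ext z <= 1.
Proof.
have h : 0 <= Num.max z.1 0 by rewrite le_max lexx orbT.
rewrite /profile_ext; case: ifP => _; first exact: rhom01.
case: ifP => _; first exact: rhop01.
case: ifP => _; last by rewrite lexx ler01.
by case/andP: m01 => h1 h2; rewrite !ltW.
Qed.

End Profile.

(** * Convergence in measure and against integrable functions *)

Section Convergence.
Context {R : realType}.
Local Notation strip := (@strip R).
Local Notation leb2 := (@leb2 R).
Local Notation leb := (@leb R).
Variables (J : R -> R) (m : R) (rhom rhop u0 : R -> R) (u : R -> R * R -> R).
Hypotheses (J2 : Ck 2 J) (J_concave : forall x, derive1n 2 J x < 0)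
  (J0 : J 0 = 0) (J1 : J 1 = 0) (m01 : 0 < m < 1) (m_max : forall x, x != m -> J x < J m)
  (rhom_C1 : C1_Rplus rhom) (rhop_C1 : C1_Rplus rhop)
  (rhom01 : forall t, 0 <= t -> 0 <= rhom t <= 1)
  (rhop01 : forall t, 0 <= t -> 0 <= rhop t <= 1)
  (mu0 : measurable_fun (`[0, 1]%classic : set (measurableTypeR R)) (u0 : R -> measurableTypeR R))
  (u001 : {ae leb, forall x, 0 <= x <= 1 -> 0 <= u0 x <= 1})
  (not_critical : {ae leb, forall t, 0 <= t -> ~ critical_segment J m (rhom t, rhop t)})
  (u_sol : forall eps, 0 < eps -> entropy_solution J eps rhom rhop u0 (u eps)).
Local Notation ubar := (profile_ext J m rhom rhop).

Lemma ae_not_critical : {ae leb2, forall z, strip z ->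
  ~ critical_segment J m (rhom z.1, rhop z.1)}.
Proof.
have [N [mN N0 hN]] := not_critical.
exists (N `*` setT); split.
- by apply: measurableX.
- by rewrite leb2_setX//; move: N0; rewrite /leb => ->; rewrite mul0e.
- move=> z /= h; split=> //; apply: hN => /= h'; apply: h => -[/=].
  by rewrite in_itv /= andbT => /h'.
Qed.

(** The lower end y of the wide layer [y, 1 - y]; starting from 1/3 keeps 2y < 1 for every n. *)
Let height (n : nat) : R := n.+3%:R^-1.

Let height_gt0 n : 0 < height n. Proof. by rewrite invr_gt0. Qed.

Let height_lt n : 2 * height n < 1.
Proof. by rewrite /height -ltr_pdivlMr ?invr_gt0// invrK mul1r ltr_nat. Qed.

(** The local concentration estimate as a property of a time window, a target value and a threshold;
    with rational and natural parameters only countably many instances occur. *)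
Let good (eta p q c : R) (n K : nat) : Prop := exists2 C, 0 <= C & forall eps, 0 < eps ->
  (leb2 (strip `&` far_set u eps c (2 * eta) `&` heavy_set p q (height n) K.+1%:R^-1)
    <= (eps * C)%:E)%E.

(** Around a noncritical time, [dissipative_control] at radius eta fixes d, and continuity of the
    data fixes a rational window. Replacing the value of the profile by a rational c costs another
    eta, whence the radius 2 eta in [good]. The index K serves twice: as a threshold for the weight
    and as a bound for g. *)
Lemma good_cover (eta : R) (g : R * R -> R) : 0 < eta ->
  {ae leb2, forall z, strip z -> exists p q c : rat, exists n K : nat,
    [/\ good eta (ratr p) (ratr q) (ratr c) n K, `|ubar z - ratr c| <= eta,
        heavy_set (ratr p) (ratr q) (height n) K.+1%:R^-1 z & `|g z| <= K%:R]}.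
Proof.
move=> eta0.
have := aeI _ _ _ _ _ _ ae_not_critical (aeI _ _ _ _ _ _ (ae_leb2_horizontal 0) (ae_leb2_horizontal 1)).
apply: aeS => z [nc [x0 x1]] sz.
have [] := sz; rewrite /= !in_itv /= andbT => t0 /andP[x0' x1'].
have x_gt0 : 0 < z.2 by rewrite lt_neqAle eq_sym x0.
have x_lt1 : z.2 < 1 by rewrite lt_neqAle x1.
have ph := profile_phase J m J2 J_concave J0 J1 m01 m_max rhom rhop z.1 z.2
  (rhom01 _ t0) (rhop01 _ t0) (nc sz).
have zE : (z.1, z.2) = z by case: (z).
rewrite zE (profile_extE J m rhom rhop J2 J_concave J0 J1 m01 m_max rhom01 rhop01)// in ph.
have [d [H [c0 [d0 DH c00 hH]]]] := dissipative_control J m J2 J_concave m_max _ _ _ _ ph eta0.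
have [d1 d10 h1] := C1_Rplus_near rhom _ d rhom_C1 t0 d0.
have [d2 d20 h2] := C1_Rplus_near rhop _ d rhop_C1 t0 d0.
pose del := Num.min d1 d2.
have del0 : 0 < del by rewrite lt_min d10.
have [p] : exists p : rat, ratr p \in `]z.1 - del, z.1[.
  by apply: rat_in_itvoo; rewrite ltrBlDr ltrDl.
rewrite in_itv /= => /andP[p1 p2].
have [q] : exists q : rat, ratr q \in `]z.1, z.1 + del[.
  by apply: rat_in_itvoo; rewrite ltrDl.
rewrite in_itv /= => /andP[q1 q2].
have [c] : exists c : rat, ratr c \in `](ubar z - eta), (ubar z + eta)[.
  by apply: rat_in_itvoo; rewrite ltrBlDr -addrA ltrDl addr_gt0.
rewrite in_itv /= -ltr_distl => cu.
have near_t t : 0 <= t -> ratr p < t < ratr q -> `|t - z.1| < del.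
  by move=> _ /andP[h3 h4]; rewrite ltr_distl (lt_trans p1 h3) (lt_trans h4 q2).
pose n := Num.truncn (Num.max z.2^-1 (1 - z.2)^-1).
have hn : Num.max z.2^-1 (1 - z.2)^-1 < n.+3%:R.
  apply: (lt_le_trans (Num.Theory.truncnS_gt _)); rewrite ler_nat; exact: ltnW (ltnW (leqnn n.+3)).
move: hn; rewrite gt_max => /andP[n1 n2].
have y1 : height n < z.2 by rewrite /height invf_plt ?posrE.
have y2 : height n < 1 - z.2 by rewrite /height invf_plt ?posrE ?subr_gt0.
have yy : height n < 1 - height n by have := height_lt n; move: (height n) => *; lra.
have w0 : 0 < weight (ratr p) (ratr q) (height n) z.
  apply: mulr_gt0; first by apply: window_gt0; rewrite p2.
  apply: derive_ramp_gt0; first exact: yy.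
  by rewrite y1 /= ltrBrDl -ltrBrDr.
pose K := Num.truncn (Num.max (weight (ratr p) (ratr q) (height n) z)^-1 `|g z|).
have hK : Num.max (weight (ratr p) (ratr q) (height n) z)^-1 `|g z| < K.+1%:R.
  exact: Num.Theory.truncnS_gt.
move: hK; rewrite gt_max => /andP[K1 K2].
exists p, q, c, n, K.+1; split.
- have pq : ratr p <= ratr q :> R by rewrite (le_trans (ltW p2) (ltW q1)).
  have na t : 0 <= t -> ratr p < t < ratr q -> `|rhom t - rhom z.1| < d.
    move=> t1 tpq; apply: h1 => //; have := near_t t t1 tpq.
    by rewrite lt_min => /andP[].
  have nb t : 0 <= t -> ratr p < t < ratr q -> `|rhop t - rhop z.1| < d.
    move=> t1 tpq; apply: h2 => //; have := near_t t t1 tpq.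
    by rewrite lt_min => /andP[].
  have kap0 : 0 < K.+2%:R^-1 :> R by rewrite invr_gt0.
  have [C C0 hC] := far_set_small J rhom rhop u0 u J2 rhom01 rhop01 mu0 u001 u_sol
    (rhom z.1) (rhop z.1) d (ratr p) (ratr q) (height n) pq (height_gt0 n) (height_lt n) na nb
    H (ubar z) eta c0 K.+2%:R^-1 DH c00 kap0 hH.
  exists C; [exact: C0|move=> eps e0]; have hCe := hC eps e0; apply: (le_trans _ hCe).
  apply: le_measure; rewrite ?inE.
  + apply: measurableI; last exact: measurable_heavy_set.
    exact: (measurable_far_set J rhom rhop u0 u u_sol).
  + apply: measurableI; last exact: measurable_heavy_set.
    exact: (measurable_far_set J rhom rhop u0 u u_sol).
  + apply: setSI; apply: setIS => z' /= h3.
    have := ler_normD (u eps z' - ubar z) (ubar z - ratr c); rewrite subrKA.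
    rewrite (distrC (ubar z)); move: h3 cu; rewrite /far_set /=.
    by move: `|_| `|_| `|_| => *; lra.
- by rewrite distrC ltW.
- rewrite /heavy_set /= invf_plt ?posrE//.
  by apply: (lt_trans K1); rewrite ltr_nat.
- by rewrite ltW// (lt_trans K2)// ltr_nat.
Qed.

Variables (T : R) (g : R * R -> R).
Hypothesis T0 : 0 < T.
Local Notation D := (`[0, T] `*` `[0, 1] : set (measurableTypeR R * measurableTypeR R)).
Hypothesis Ig : leb2.-integrable D (EFin \o (g : measurableTypeR R * measurableTypeR R -> R)).

Let mD : measurable D. Proof. exact: measurableX. Qed.

Let D_strip : D `<=` strip.
Proof.
move=> z [/=]; rewrite !in_itv /= => /andP[t0 _] x01; split=> //=.
by rewrite in_itv /= t0.
Qed.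

Let D_fin : (leb2 D < +oo)%E.
Proof. by rewrite leb2_rectangle ?ler01 ?ltry// ltW. Qed.

Let mg : measurable_fun D (fun z => `|g z|).
Proof.
by apply: measurableT_comp => //; apply/measurable_EFinP; case/integrableP: Ig.
Qed.

(** On a cell the profile is within eta of c, so a deviation of 3 eta from the profile forces a
    distance of at least 2 eta from c, the radius in [good]. *)
Definition deviation (eta eps : R) : set (measurableTypeR R * measurableTypeR R) :=
  strip `&` [set z | 3 * eta <= `|u eps z - ubar z|].

Lemma measurable_deviation eta eps : 0 < eps -> measurable (deviation eta eps).
Proof.
move=> e0.
have mu := solution_measurable J rhom rhop u0 u u_sol _ e0.
have mf : measurable_fun (strip : set (measurableTypeR R * measurableTypeR R))
    (fun z => `|u eps z - ubar z|).
  apply: measurableT_comp => //; apply: measurable_funB => //; apply: measurable_funTS.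
  exact: measurable_profile_ext.
have := mf (@measurable_strip R) _ (measurable_itv `[3 * eta, +oo[).
congr (measurable (_ `&` _)); apply/seteqP; split=> z /=; by rewrite in_itv /= andbT.
Qed.

Let cell (eta : R) (i : rat * rat * rat * nat * nat) : set (measurableTypeR R * measurableTypeR R) :=
  let: (p, q, c, n, K) := i in
  [set z | `|ubar z - ratr c| <= eta] `&` heavy_set (ratr p) (ratr q) (height n) K.+1%:R^-1
    `&` (D `&` [set z | `|g z| <= K%:R]).

Let measurable_cell eta i : measurable (cell eta i).
Proof.
case: i => [[[[p q] c] n] K]; apply: measurableI; first apply: measurableI.
- have mf : measurable_fun (setT : set (measurableTypeR R * measurableTypeR R))
      (fun z => `|ubar z - ratr c|).
    by apply: measurableT_comp => //; apply: measurable_funB => //; exact: measurable_profile_ext.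
  have := mf measurableT _ (measurable_itv `]-oo, eta]).
  rewrite setTI; congr measurable; apply/seteqP; split=> z /=; by rewrite in_itv /=.
- exact: measurable_heavy_set.
- have := mg mD _ (measurable_itv `]-oo, K%:R]).
  congr (measurable (_ `&` _)); apply/seteqP; split=> z /=; by rewrite in_itv /=.
Qed.

(** Enumeration through the countable encoding of the indices. Codes of no index, and indices that
    are not good, receive the empty set, for which the estimate is trivial. *)
Let cells (eta : R) (j : nat) : set (measurableTypeR R * measurableTypeR R) :=
  match unpickle j : option (rat * rat * rat * nat * nat) with
  | Some i => let: (p, q, c, n, K) := i in
      if `[< good eta (ratr p) (ratr q) (ratr c) n K >] then cell eta i else set0
  | None => set0
  end.

(** Exhaustion with weight |g|. Since |g| <= K on a cell, its integral over the deviating part is at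
    most K times a measure of order eps, although g is merely integrable. *)
Lemma deviation_small (eta e : R) : 0 < eta -> 0 < e ->
  exists2 del, 0 < del & forall eps, 0 < eps < del ->
    \int[leb2]_(z in D) (`|g z| * \1_(deviation eta eps) z) <= e.
Proof.
move=> eta0; apply: (@integral_exhaustion _ _ R leb2 D (fun z => `|g z|) (deviation eta) (cells eta)) => //.
- exact: integrable_norm.
- exact: measurable_deviation.
- move=> j; rewrite /cells; case: unpickle => [[[[[p q] c] n] K]|//].
  by case: ifPn => // _; exact: measurable_cell.
- move=> j; rewrite /cells.
  have triv : exists2 C, 0 <= C & forall eps, 0 < eps ->
      \int[leb2]_(z in D) (`|g z| * \1_(deviation eta eps `&` set0) z) <= eps * C.
    exists 0 => // eps _; rewrite mulr0.
    under eq_Rintegral do rewrite setI0 indic0 mulr0.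
    by rewrite Rintegral_cst// mul0r.
  case: unpickle => [[[[[p q] c] n] K]|//]; case: asboolP => // -[C C0 hC].
  exists (K%:R * C); first exact: mulr_ge0.
  move=> eps e0; have hCe := hC eps e0.
  set G := _ `&` _ `&` _ in hCe.
  have mG : measurable G.
    apply: measurableI; last exact: measurable_heavy_set.
    exact: (measurable_far_set J rhom rhop u0 u u_sol).
  have mA : measurable (deviation eta eps `&` cell eta (p, q, c, n, K)).
    by apply: measurableI; [exact: measurable_deviation|exact: measurable_cell].
  have IG : leb2.-integrable D (EFin \o (\1_G : _ -> R)).
    apply: measurable_bounded_integrable => //.
    exists 1; split=> // y y1 z _ /=; rewrite indicE.
    by case: (_ \in _); rewrite ?normr1 ?normr0 ltW// (lt_trans _ y1).
  have IA : leb2.-integrable D (EFin \o (fun z => `|g z| * \1_(deviation eta eps `&` cell eta (p, q, c, n, K)) z)).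
    apply: (ae_le_integrable _ _ _ leb2 _ mD _ (fun z => `|g z|)).
    + by apply: measurable_funM => //; exact: measurable_funTS.
    + exact: integrable_norm.
    + apply: aeW => z _; rewrite normrM normr_id ler_piMr// indicE.
      by case: (_ \in _); rewrite ?normr1 ?normr0.
  have IKG := integrableZl mD K%:R IG.
  apply: (@le_trans _ _ (\int[leb2]_(z in D) (K%:R * \1_G z))).
    apply: le_Rintegral; [exact: mD|exact: IA|exact: IKG|].
    move=> z _; rewrite !indicE.
    have [h|h] := boolP (z \in deviation eta eps `&` _); last by rewrite mulr0 mulr_ge0.
    have [[sz dev] [[zc hz] [Dz gz]]] := set_mem h.
    rewrite mem_set ?mulr1//; split=> //; split=> //=.
    rewrite /far_set /=; have := ler_normD (u eps z - ratr c) (ratr c - ubar z).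
    rewrite subrKA (distrC (ratr c)); move: dev zc => /=.
    by move: `|_| `|_| `|_| => *; lra.
  rewrite RintegralZl// mulrCA ler_wpM2l//.
  rewrite /Rintegral integral_indic//.
  have GD : (leb2 (G `&` D) <= (eps * C)%:E)%E.
    by apply: le_trans hCe; apply: le_measure; rewrite ?inE//; exact: measurableI.
  by rewrite -[leRHS]/(fine (eps * C)%:E) fine_le// ge0_fin_numE// (le_lt_trans GD) ?ltry.
- have := good_cover eta g eta0; apply: aeS => z h Dz.
  have [p [q [c [n [K [gd uc hz gz]]]]]] := h (D_strip _ Dz).
  exists (pickle (p, q, c, n, K)); rewrite /cells pickleK.
  by case: asboolP.
Qed.

(** Off the deviation set u and the profile differ by less than 3 eta; on it both lie in [0,1], so
    they differ by at most 1 and [deviation_small] applies. *)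
Lemma product_cvg : \int[leb2]_(z in D) (u eps z * g z) @[eps --> 0^'+] -->
  \int[leb2]_(z in D) (ubar z * g z).
Proof.
have mgD : measurable_fun D g by apply/measurable_EFinP; case/integrableP: Ig.
have mub : measurable_fun D ubar by apply: measurable_funTS; exact: measurable_profile_ext.
have Ing := integrable_norm Ig.
have In (f : R * R -> R) : measurable_fun D f -> {ae leb2, forall z, strip z -> 0 <= f z <= 1} ->
    leb2.-integrable D (EFin \o (fun z => f z * g z)).
  move=> mf f01; apply: (ae_le_integrable _ _ _ leb2 _ mD _ (fun z => `|g z|)) => //.
    exact: measurable_funM.
  apply: aeS f01 => z h /D_strip/h /andP[f0 f1].
  by rewrite normrM ger0_norm// ler_piMl.
have Iu eps : 0 < eps -> leb2.-integrable D (EFin \o (fun z => u eps z * g z)).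
  move=> e0; apply: In.
    exact: measurable_funS measurable_strip D_strip (solution_measurable J rhom rhop u0 u u_sol _ e0).
  exact: (solution_in01 J rhom rhop u0 u J2 rhom01 rhop01 mu0 u001 u_sol _ e0).
have Iub : leb2.-integrable D (EFin \o (fun z => ubar z * g z)).
  by apply: In => //; apply: aeW => z _; exact: profile_ext01.
apply/cvgrPdist_lt => e e0.
pose N := \int[leb2]_(z in D) `|g z|.
have N0 : 0 <= N by apply: Rintegral_ge0.
(* Chosen so that 3 * eta * N < e / 2, including when N = 0. *)
pose eta := e / (6 * (N + 1)).
have N1 : 0 < 6 * (N + 1) by rewrite mulr_gt0// ltr_wpDl.
have eta0 : 0 < eta by rewrite divr_gt0.
have e20 : 0 < e / 2 by rewrite divr_gt0.
have [del del0 hdel] := deviation_small eta (e / 2) eta0 e20.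
near=> eps.
have eps0 : 0 < eps by near: eps; exact: nbhs_right_gt.
have epsd : eps < del by near: eps; exact: nbhs_right_lt.
have hd : \int[leb2]_(z in D) (`|g z| * \1_(deviation eta eps) z) <= e / 2 by apply: hdel; rewrite eps0.
have Id : leb2.-integrable D (EFin \o (fun z => `|g z| * \1_(deviation eta eps) z)).
  apply: (ae_le_integrable _ _ _ leb2 _ mD _ (fun z => `|g z|)) => //.
    apply: measurable_funM => //; apply: measurable_funTS; apply: measurable_indic.
    exact: measurable_deviation.
  apply: aeW => z _; rewrite normrM normr_id ler_piMr// indicE.
  by case: (_ \in _); rewrite ?normr1 ?normr0.
have Ie := integrableZl mD (3 * eta) Ing.
have Ied := integrableD mD Ie Id.
rewrite -(RintegralB mD Iub (Iu _ eps0)).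
have bound : {ae leb2, forall z, D z -> `|ubar z * g z - u eps z * g z| <=
    3 * eta * `|g z| + `|g z| * \1_(deviation eta eps) z}.
  apply: aeS (solution_in01 J rhom rhop u0 u J2 rhom01 rhop01 mu0 u001 u_sol _ eps0) => z h Dz.
  have sz := D_strip _ Dz; have /andP[u0' u1'] := h sz.
  have /andP[b0 b1] := profile_ext01 J m rhom rhop m01 rhom01 rhop01 z.
  have eta30 : 0 <= 3 * eta by rewrite mulr_ge0// ltW.
  rewrite -mulrBl normrM distrC indicE.
  have [dz|dz] := boolP (z \in deviation eta eps).
    rewrite mulr1; apply: ler_wpDl; first exact: mulr_ge0.
    by rewrite ler_piMl// ler_norml; apply/andP; split; lra.
  rewrite mulr0 addr0 ler_wpM2r// leNgt; apply/negP => h'.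
  by move/negP: dz; apply; apply: mem_set; split=> //=; exact: ltW.
have mdiff : measurable_fun D (fun z => ubar z * g z - u eps z * g z).
  apply: measurable_funB; first exact: measurable_funM.
  by apply/measurable_EFinP; case/integrableP: (Iu _ eps0).
apply: le_lt_trans (ae_normr_Rintegral_le _ _ _ leb2 _ mD _ _ mdiff Ied bound) _.
rewrite (RintegralD mD Ie Id).
rewrite RintegralZl// -/N.
have : 3 * eta * N < e / 2.
  rewrite /eta; have -> : 3 * (e / (6 * (N + 1))) * N = e / 2 * (N / (N + 1)).
    by field; rewrite gt_eqF// ltr_wpDl.
  by rewrite gtr_pMr// ltr_pdivrMr ?mul1r ?ltrDl// ltr_wpDl.
move: hd; move: (Rintegral _ _ _) (3 * eta * N) => *; lra.
Unshelve. all: by end_near. Qed.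

End Convergence.

Theorem theorem3p5 (R : realType) (J : R -> R) (m : R)
    (rhom rhop u0 : R -> R) (u : R -> R * R -> R)
    (J_C2 : Ck 2 J)
    (J_concave : forall x, derive1n 2 J x < 0)
    (J0 : J 0 = 0) (J1 : J 1 = 0)
    (m01 : 0 < m < 1)
    (m_max : forall x, x != m -> J x < J m)
    (rhom_C1 : C1_Rplus rhom) (rhop_C1 : C1_Rplus rhop)
    (rhom01 : forall t, 0 <= t -> 0 <= rhom t <= 1)
    (rhop01 : forall t, 0 <= t -> 0 <= rhop t <= 1)
    (u0_Loo : Lp_on (@leb R) +oo%E `[0, 1] u0)
    (u0_01 : {ae @leb R, forall x, 0 <= x <= 1 -> 0 <= u0 x <= 1})
    (not_critical : {ae @leb R, forall t, 0 <= t ->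
       ~ critical_segment J m (rhom t, rhop t)})
    (u_sol : forall eps, 0 < eps ->
       entropy_solution J eps rhom rhop u0 (u eps)) :
  forall T : R, 0 < T ->
    weak_star_cvg (@leb2 R) (`[0, T] `*` `[0, 1]) 0^'+ u
      (quasi_static_profile J m rhom rhop).
Proof.
move=> T T0.
have m01' : measurable (`[0, 1]%classic : set (measurableTypeR R)) by exact: measurable_itv.
have [mu0 _] := Lp_onoo_bounded _ _ _ _ _ _ m01' u0_Loo.
pose D : set (measurableTypeR R * measurableTypeR R) := `[0, T] `*` `[0, 1].
have mD : measurable D by exact: measurableX.
have Ds z : D z -> @strip R z.
  move=> [/=]; rewrite !in_itv /= => /andP[t0 _] x01; split=> //=.
  by rewrite in_itv /= t0.
(* The two forms of the profile are known to agree on the strip, which contains D; measurability is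
   available for the second form. *)
have profE z : D z -> quasi_static_profile J m rhom rhop z = profile_ext J m rhom rhop z.
  by move=> /Ds sz; exact: profile_extE.
split.
- near=> eps.
  have eps0 : 0 < eps by near: eps; exact: nbhs_right_gt.
  apply: (@Lp_onoo_of_bounded _ _ _ _ _ _ 1) => //.
    exact: measurable_funS measurable_strip Ds (solution_measurable J rhom rhop u0 u u_sol _ eps0).
  apply: aeS (solution_in01 J rhom rhop u0 u J_C2 rhom01 rhop01 mu0 u0_01 u_sol _ eps0) => z h Dz.
  by have /andP[h0 h1] := h (Ds z Dz); rewrite ger0_norm.
- apply: (@Lp_onoo_of_bounded _ _ _ _ _ _ 1) => //.
    apply: (eq_measurable_fun (profile_ext J m rhom rhop)).
      by move=> z /set_mem Dz; rewrite profE.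
    apply: measurable_funTS; exact: measurable_profile_ext.
  apply: aeW => z Dz; rewrite profE//.
  by have /andP[h0 h1] := profile_ext01 J m rhom rhop m01 rhom01 rhop01 z; rewrite ger0_norm.
- move=> g /Lfun1_integrable Ig.
  have {}Ig : (@leb2 R).-integrable D (EFin \o g).
    by apply/(integrable_mkcond _ mD); rewrite restrict_EFin.
  have E : \int[@leb2 R]_(z in D) (quasi_static_profile J m rhom rhop z * g z) =
      \int[@leb2 R]_(z in D) (profile_ext J m rhom rhop z * g z).
    by apply: eq_Rintegral => z /set_mem Dz; rewrite profE.
  have := product_cvg J m rhom rhop u0 u J_C2 J_concave J0 J1 m01 m_max rhom_C1 rhop_C1
    rhom01 rhop01 mu0 u0_01 not_critical u_sol T g T0 Ig.
  by rewrite -E.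
Unshelve. all: by end_near. Qed.
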